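(* Let $f$ be a transcendental entire function. If $f$ has a finite logarithmic asymptotic value $\alpha\in J(f)$, then $BU(f)\cup\{\infty\}$ is a connected subset of the Riemann sphere.
   Context: For an entire function $f$, $f^n$ denotes its $n$-th iterate; $J(f)$ is the Julia set (points in no neighbourhood of which $(f^n)$ is normal). The escaping set is $I(f) := \{z : f^n(z)\to\infty\}$, the bounded orbit set is $BO(f) := \{z : \exists K>0,\ |f^n(z)|<K \ \forall n\ge0\}$, and the bungee set is $BU(f) := \mathbb{C}\setminus(I(f)\cup BO(f))$. Write $B(a,r)=\{z:|z-a|<r\}$. A value $\alpha\in\mathbb{C}$ is a finite logarithmic asymptotic value of $f$ if there exist $r>0$ and a component $U$ of $f^{-1}(B(\alpha,r))$ such that the restriction $f: U\to B(\alpha,r)\setminus\{\alpha\}$ is a universal covering. *)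

(* Defs.v *)
From HB Require Import structures.
From mathcomp Require Import all_boot all_order all_algebra.
From mathcomp Require Import complex.
From mathcomp Require Import all_classical all_reals all_analysis.
Import numFieldTopology.Exports numFieldNormedType.Exports.

Set Implicit Arguments.
Unset Strict Implicit.
Unset Printing Implicit Defensive.
Import Order.TTheory GRing.Theory Num.Theory.
Local Open Scope ring_scope.
Local Open Scope complex_scope.
Local Open Scope classical_set_scope.

(** The complex plane, with its canonical (norm) topology and normed structure
    over itself. *)
Definition CC (R : realType) : numClosedFieldType := R[i].

Definition cdisk (R : realType) (a : CC R) (r : R) : set (CC R) :=
  [set z | `|z - a| < r%:C].

Definition entire (R : realType) (f : CC R -> CC R) : Prop :=
  forall z : CC R, derivable f z 1.

Definition transcendental_entire (R : realType) (f : CC R -> CC R) : Prop :=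
  entire f /\ ~ (exists p : {poly CC R}, forall z, f z = p.[z]).

Definition loc_unif_cvg (R : realType) (U : set (CC R))
    (F : nat -> CC R -> CC R) (g : CC R -> CC R) : Prop :=
  forall K : set (CC R), K `<=` U -> compact K ->
  forall eps : R, 0 < eps ->
    \forall n \near \oo, forall z, K z -> `|F n z - g z| < eps%:C.

Definition loc_unif_to_infty (R : realType) (U : set (CC R))
    (F : nat -> CC R -> CC R) : Prop :=
  forall K : set (CC R), K `<=` U -> compact K ->
  forall M : R, \forall n \near \oo, forall z, K z -> M%:C < `|F n z|.

Definition normal_on (R : realType) (U : set (CC R))
    (F : nat -> CC R -> CC R) : Prop :=
  forall phi : nat -> nat, (forall n, (phi n < phi n.+1)%N) ->
  exists psi : nat -> nat, (forall n, (psi n < psi n.+1)%N) /\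
    ((exists g, loc_unif_cvg U (fun n => F (phi (psi n))) g) \/
     loc_unif_to_infty U (fun n => F (phi (psi n)))).

Definition julia (R : realType) (f : CC R -> CC R) : set (CC R) :=
  [set z | ~ (exists U : set (CC R),
               open U /\ U z /\ normal_on U (fun n => iter n f))].

Definition escaping (R : realType) (f : CC R -> CC R) : set (CC R) :=
  [set z | forall M : R, \forall n \near \oo, M%:C < `|iter n f z|].

Definition bounded_orbit (R : realType) (f : CC R -> CC R) : set (CC R) :=
  [set z | exists K : R, 0 < K /\ forall n, `|iter n f z| < K%:C].

Definition bungee (R : realType) (f : CC R -> CC R) : set (CC R) :=
  ~` (escaping f `|` bounded_orbit f).

Definition unit_square (R : realType) : set (R * R) :=
  [set p | (0 <= p.1 <= 1) && (0 <= p.2 <= 1)].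

Definition simply_connected (R : realType) (U : set (CC R)) : Prop :=
  connected U /\
  forall gamma : R -> CC R,
    {within [set s : R | 0 <= s <= 1], continuous gamma} ->
    (forall s : R, 0 <= s <= 1 -> U (gamma s)) ->
    gamma 0 = gamma 1 ->
    exists H : R * R -> CC R,
      {within (@unit_square R), continuous H} /\
      (forall p, @unit_square R p -> U (H p)) /\
      (forall s : R, 0 <= s <= 1 -> H (s, 0) = gamma s) /\
      (exists c : CC R, forall s : R, 0 <= s <= 1 -> H (s, 1) = c) /\
      (forall t : R, 0 <= t <= 1 -> H (0, t) = H (1, t)).

Definition covering_map (R : realType) (U V : set (CC R))
    (p : CC R -> CC R) : Prop :=
  {within U, continuous p} /\ p @` U = V /\
  forall v, V v ->
    exists W : set (CC R), open W /\ W v /\ W `<=` V /\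
    exists F : set (set (CC R)),
      (forall S, F S -> open S) /\
      (forall S T, F S -> F T -> S <> T -> S `&` T = set0) /\
      U `&` p @^-1` W = \bigcup_(S in F) S /\
      (forall S, F S -> exists q : CC R -> CC R,
         {within W, continuous q} /\
         (forall w, W w -> S (q w) /\ p (q w) = w) /\
         (forall z, S z -> q (p z) = z)).

Definition universal_covering (R : realType) (U V : set (CC R))
    (p : CC R -> CC R) : Prop :=
  covering_map U V p /\ simply_connected U.

Definition finite_log_asymptotic_value (R : realType) (f : CC R -> CC R)
    (alpha : CC R) : Prop :=
  exists r : R, 0 < r /\
  exists z0 : CC R, (f @^-1` cdisk alpha r) z0 /\
    universal_covering (connected_component (f @^-1` cdisk alpha r) z0)
                       (cdisk alpha r `\ alpha) f.

Definition riemann_sphere (R : realType) : topologicalType :=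
  one_point_compactification (CC R).

Definition with_infty (R : realType) (A : set (CC R)) : set (riemann_sphere R) :=
  (Some @` A) `|` [set None].

(* Main.v *)
Require Import Defs.
From HB Require Import structures.
From mathcomp Require Import all_boot all_order all_algebra.
From mathcomp Require Import complex.
From mathcomp Require Import all_classical all_reals all_analysis.
From mathcomp Require Import ring lra zify.
Import numFieldTopology.Exports numFieldNormedType.Exports.
Set Implicit Arguments.
Unset Strict Implicit.
Unset Printing Implicit Defensive.
Import Order.TTheory GRing.Theory Num.Theory.
Local Open Scope ring_scope.
Local Open Scope complex_scope.
Local Open Scope classical_set_scope.
Local Notation Re := complex.Re.
Local Notation Im := complex.Im.

(** If the set were disconnected, a bounded open U would meet BU(f) while its
    compact boundary avoided it; so it suffices to find points of BU(f) on the
    boundary of every bounded open U that meets BU(f).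

    Suppose a compact set E surrounds a point of J(f).  If every f^n(E) failed
    to surround a disk D(0, R), then f^n would omit, near the Julia point, a
    connected set joining D(0, R) to infinity.  Logarithmic potentials of finitely
    many poles in that set give positive harmonic functions with logarithmic
    growth, and Harnack's inequality makes (f^n) normal, which is absurd.  So some
    f^n(E) surrounds D(0, R).  A component of the preimage of a punctured
    neighbourhood of alpha inside the tract is connected and unbounded, hence must
    meet the part of f^n(E) outside D(0, R); therefore the image of that part
    contains a compact set that surrounds alpha and lies close to it.  As alpha is
    a Julia point the construction repeats, and a nested intersection is a point
    of E whose orbit is unbounded and returns near alpha infinitely often.

    If U misses J(f), let G be a component of the open set of points of U in BU(f),
    and w a finite limit point of the orbit of a point z0 of G.  Since BU(f) is
    open and closed in the Fatou set, w is a Julia point, so by the first part the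
    images of the boundary of G do not surround w, and the same potentials, with
    poles in the exterior of these images, show that the boundary points whose
    orbits do not follow that of z0 at suitably chosen times have arbitrarily small
    harmonic measure.  Hence some boundary point follows z0 at all of these times. *)

(** * The complex plane with a real-valued modulus *)

(** Membership in [bungee f] is not preserved under limits, so compactness alone does not produce a
    bungee point. Both constructions therefore fix two infinite sequences of times that do not
    depend on the point, and impose only non-strict inequalities at these times: large at the first,
    close to a fixed value at the second. Any finite number of them can be met on a compact set, and
    a cluster point then meets all of them.

    The set omitted by [f^n] changes with [n], so normality needs a bound that depends on the
    omitted set only through its distance from the origin. A connected unbounded set through [c]
    meets every circle about [c]; poles placed on it at equally spaced radii in [[S, 2S]] have a
    potential at least [ln S - 4] off the set, whatever its shape. This uniform constant feeds both
    the normality argument and the estimates of harmonic measure.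

    Harmonicity means the mean value property on small circles. Harmonic measure is never defined:
    its smallness is expressed by a nonnegative harmonic function that is small at the base point
    and at least 1 on the part of the boundary in question. *)

Definition nm (R : realType) (z : CC R) : R := ComplexField.Normc.normc z.

Lemma nmE (R : realType) (z : CC R) : `|z| = (nm z)%:C.
Proof. by []. Qed.

Lemma nm_ge0 (R : realType) (z : CC R) : 0 <= nm z.
Proof. by rewrite -lecR -nmE normr_ge0. Qed.

Lemma nm0 (R : realType) : nm (0 : CC R) = 0.
Proof. exact: ComplexField.Normc.normc0. Qed.

Lemma nm_eq0 (R : realType) (z : CC R) : (nm z == 0) = (z == 0).
Proof.
apply/eqP/eqP => [|->]; [exact: ComplexField.Normc.eq0_normc | exact: nm0].
Qed.

Lemma nm_gt0 (R : realType) (z : CC R) : (0 < nm z) = (z != 0).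
Proof. by rewrite lt_def nm_ge0 andbT nm_eq0. Qed.

Lemma nmM (R : realType) (z w : CC R) : nm (z * w) = nm z * nm w.
Proof. exact: ComplexField.Normc.normcM. Qed.

Lemma nmV (R : realType) (z : CC R) : nm z^-1 = (nm z)^-1.
Proof. exact: ComplexField.Normc.normcV. Qed.

Lemma nmD (R : realType) (z w : CC R) : nm (z + w) <= nm z + nm w.
Proof. by rewrite -lecR rmorphD /= -!nmE ler_normD. Qed.

Lemma nmN (R : realType) (z : CC R) : nm (- z) = nm z.
Proof. by apply: complexI; rewrite -!nmE normrN. Qed.

Lemma nm_distC (R : realType) (z w : CC R) : nm (z - w) = nm (w - z).
Proof. by rewrite -opprB nmN. Qed.

Lemma nm_dist_tri (R : realType) (y x z : CC R) :
  nm (x - z) <= nm (x - y) + nm (y - z).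
Proof. by have := nmD (x - y) (y - z); rewrite addrA subrK. Qed.

Lemma nm_leD (R : realType) (z w : CC R) : nm z <= nm (z - w) + nm w.
Proof. by have := nmD (z - w) w; rewrite subrK. Qed.

Lemma nmR (R : realType) (x : R) : nm (x%:C : CC R) = `|x|.
Proof. by rewrite /nm /= expr0n /= addr0 sqrtr_sqr. Qed.

Lemma ReB (R : realType) (z w : CC R) : Re (z - w) = Re z - Re w.
Proof. by case: z w => [a b] [c d]. Qed.

Lemma ImB (R : realType) (z w : CC R) : Im (z - w) = Im z - Im w.
Proof. by case: z w => [a b] [c d]. Qed.

Lemma ReD (R : realType) (z w : CC R) : Re (z + w) = Re z + Re w.
Proof. by case: z w => [a b] [c d]. Qed.

Lemma ImD (R : realType) (z w : CC R) : Im (z + w) = Im z + Im w.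
Proof. by case: z w => [a b] [c d]. Qed.

Lemma ReM (R : realType) (z w : CC R) : Re (z * w) = Re z * Re w - Im z * Im w.
Proof. by case: z w => [a b] [c d]. Qed.

Lemma ImM (R : realType) (z w : CC R) : Im (z * w) = Re z * Im w + Im z * Re w.
Proof. by case: z w => [a b] [c d]. Qed.

Lemma normr_Re_le (R : realType) (z : CC R) : `|Re z| <= nm z.
Proof.
case: z => a b /=; rewrite /nm /= -sqrtr_sqr ler_wsqrtr // lerDl.
exact: sqr_ge0.
Qed.

Lemma normr_Im_le (R : realType) (z : CC R) : `|Im z| <= nm z.
Proof.
case: z => a b /=; rewrite /nm /= -sqrtr_sqr ler_wsqrtr // lerDr.
exact: sqr_ge0.
Qed.

Lemma Re_le_nm (R : realType) (z : CC R) : Re z <= nm z.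
Proof. exact: le_trans (ler_norm _) (normr_Re_le z). Qed.

Lemma nm_le_ReIm (R : realType) (z : CC R) : nm z <= `|Re z| + `|Im z|.
Proof.
have {1}-> : z = ((Re z)%:C : CC R) + ((Im z)%:C : CC R) * (Complex 0 1 : CC R).
  by rewrite {1}(complexE z) mulrC.
apply: le_trans (nmD _ _) _; rewrite nmM !nmR.
by rewrite /nm /= expr0n /= add0r expr1n sqrtr1 mulr1.
Qed.

Lemma nbhsCP (R : realType) (z : CC R) (A : set (CC R)) :
  nbhs z A <-> exists2 r : R, 0 < r & forall w, nm (w - z) < r -> A w.
Proof.
split.
  move=> /nbhs_ballP[e /= e0 eA].
  have /complex_realP[r er] : e \is Num.real by rewrite gtr0_real.
  exists r; first by move: e0; rewrite er ltcR.
  by move=> w wr; apply: eA; rewrite /ball /= distrC nmE er ltcR.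
move=> [r r0 rA]; apply/nbhs_ballP; exists (r%:C : CC R) => /=.
  by rewrite ltcR.
by move=> w; rewrite /ball /= distrC nmE ltcR; exact: rA.
Qed.

Lemma openCP (R : realType) (A : set (CC R)) :
  open A <-> forall z, A z -> exists2 r : R, 0 < r & forall w, nm (w - z) < r -> A w.
Proof.
rewrite openE; split=> h z Az; first by apply/nbhsCP; exact: h.
by apply/nbhsCP/h.
Qed.

Lemma closureCP (R : realType) (A : set (CC R)) (z : CC R) :
  closure A z <-> forall r : R, 0 < r -> exists2 w, A w & nm (w - z) < r.
Proof.
split=> [h r r0|h B /nbhsCP[r r0 rB]].
  have [w [Aw wr]] : A `&` [set w | nm (w - z) < r] !=set0.
    by apply: h; apply/nbhsCP; exists r.
  by exists w.
by have [w Aw wr] := h r r0; exists w; split => //; exact: rB.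
Qed.

Lemma closedCP (R : realType) (A : set (CC R)) :
  closed A <-> forall z, (forall r : R, 0 < r -> exists2 w, A w & nm (w - z) < r) -> A z.
Proof.
split=> [cA z h|h z /closureCP]; [exact/cA/closureCP | exact: h].
Qed.

Lemma contCP (R : realType) (g : CC R -> CC R) (z : CC R) :
  {for z, continuous g} <-> forall e : R, 0 < e ->
    exists2 d, 0 < d & forall w, nm (w - z) < d -> nm (g w - g z) < e.
Proof.
split=> [h e e0|h A /nbhsCP[e e0 eA]].
  by apply/nbhsCP; apply: (h [set y | nm (y - g z) < e]); apply/nbhsCP; exists e.
by apply/nbhsCP; have [d d0 dh] := h e e0; exists d => // w /dh /eA.
Qed.

Lemma contCRP (R : realType) (u : CC R -> R) (z : CC R) :
  {for z, continuous u} <-> forall e : R, 0 < e ->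
    exists2 d, 0 < d & forall w, nm (w - z) < d -> `|u w - u z| < e.
Proof.
split=> [h e e0|h A].
  apply/nbhsCP; apply: (h [set y | `|y - u z| < e]).
  by apply/nbhs_ballP; exists e => //= y; rewrite /ball /= distrC.
move=> /nbhs_ballP[e /= e0 eA]; apply/nbhsCP; have [d d0 dh] := h e e0.
by exists d => // w /dh; rewrite distrC => ?; exact: eA.
Qed.

Lemma contRRP (R : realType) (u : R -> R) (x : R) :
  {for x, continuous u} <-> forall e : R, 0 < e ->
    exists2 d, 0 < d & forall y, `|y - x| < d -> `|u y - u x| < e.
Proof.
split=> [h e e0|h A].
  have /nbhs_ballP[d /= d0 dh] : nbhs x [set y | `|u y - u x| < e].
    apply: (h [set y | `|y - u x| < e]).
    by apply/nbhs_ballP; exists e => //= y; rewrite /ball /= distrC.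
  by exists d => // y; rewrite distrC => ?; exact: dh.
move=> /nbhs_ballP[e /= e0 eA]; have [d d0 dh] := h e e0.
apply/nbhs_ballP; exists d => //= y; rewrite /ball /= distrC => /dh.
by rewrite distrC => ?; exact: eA.
Qed.

Lemma continuous_nm (R : realType) (z : CC R) : {for z, continuous (@nm R)}.
Proof.
apply/contCRP => e e0; exists e => // w we; apply: le_lt_trans we.
have h1 := nm_leD w z; have := nm_leD z w; rewrite nm_distC ler_norml => h2.
by apply/andP; split; lra.
Qed.

Lemma continuous_Re (R : realType) (z : CC R) :
  {for z, continuous (fun w : CC R => Re w)}.
Proof.
apply/contCRP => e e0; exists e => // w we; apply: le_lt_trans we.
by rewrite -ReB; exact: normr_Re_le.
Qed.

Lemma continuous_Im (R : realType) (z : CC R) :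
  {for z, continuous (fun w : CC R => Im w)}.
Proof.
apply/contCRP => e e0; exists e => // w we; apply: le_lt_trans we.
by rewrite -ImB; exact: normr_Im_le.
Qed.

Lemma continuous_Complex (R : realType) :
  continuous (fun p : R * R => (Complex p.1 p.2 : CC R)).
Proof.
move=> [x y] A /nbhsCP[e e0 eA].
exists ([set a | `|x - a| < e / 2], [set b | `|y - b| < e / 2]).
  by split; apply/nbhs_ballP; exists (e / 2) => //=; rewrite divr_gt0.
move=> [a b] [/= ha hb]; apply: eA; apply: le_lt_trans (nm_le_ReIm _) _ => /=.
by rewrite [ltRHS](splitr e) distrC (distrC b) ltrD.
Qed.

Lemma closed_cdisc (R : realType) (a : CC R) (r : R) :
  closed [set z : CC R | nm (z - a) <= r].
Proof.
apply/closedCP => z h; rewrite /= leNgt; apply/negP => rz.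
have [w /= wr wz] := h (nm (z - a) - r) ltac:(by rewrite subr_gt0).
by have := nm_dist_tri w z a; rewrite (nm_distC z w); lra.
Qed.

Lemma compact_cdisc (R : realType) (a : CC R) (r : R) :
  compact [set z : CC R | nm (z - a) <= r].
Proof.
pose K : set (CC R) := (fun p : R * R => (Complex p.1 p.2 : CC R)) @`
  (`[Re a - r, Re a + r]%classic `*` `[Im a - r, Im a + r]%classic).
apply: (@subclosed_compact _ _ K); first exact: closed_cdisc.
- apply: continuous_compact.
    by apply: continuous_subspaceT; exact: continuous_Complex.
  by apply: compact_setX; exact: segment_compact.
- move=> z /= h; exists (Re z, Im z) => /=; last by case: (z).
  split => /=; rewrite in_itv /=.
    have := le_trans (normr_Re_le _) h; rewrite ReB ler_norml => /andP[h1 h2].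
    by apply/andP; split; lra.
  have := le_trans (normr_Im_le _) h; rewrite ImB ler_norml => /andP[h1 h2].
  by apply/andP; split; lra.
Qed.

Lemma compactC_closed (R : realType) (A : set (CC R)) : compact A -> closed A.
Proof. by apply: compact_closed; exact: norm_hausdorff. Qed.

Lemma bounded_closed_compactC (R : realType) (A : set (CC R)) (M : R) :
  closed A -> (forall z, A z -> nm z <= M) -> compact A.
Proof.
move=> cA AM; apply: (subclosed_compact cA (@compact_cdisc R 0 M)) => z /AM /=.
by rewrite subr0.
Qed.

Lemma compactC_bounded (R : realType) (A : set (CC R)) :
  compact A -> exists2 M : R, 0 < M & forall z, A z -> nm z < M.
Proof.
rewrite compact_cover => cA.
have [||D _ DA] := cA nat setT (fun n => [set z | nm z < n%:R]).
- move=> n _; apply/openCP => z /= zn; exists (n%:R - nm z); first by rewrite subr_gt0.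
  by move=> w wz; apply: le_lt_trans (nm_leD w z) _; rewrite -ltrBrDr.
- move=> z _; exists (Num.truncn (nm z)).+1 => //=.
  by have := truncnS_gt (nm z).
exists ((\max_(n <- finmap.enum_fset D) n).+1%:R) => // z /DA [n /= nD zn].
by apply: lt_trans zn _; rewrite ltr_nat ltnS leq_bigmax_seq.
Qed.

(** Stands in for the extraction of a convergent subsequence. Returning infinitely often to each
    neighbourhood is all that later limits use, and it is also available in a product space that is
    not sequentially compact. *)
Lemma compact_seq_cluster (T : topologicalType) (K : set T) (x : nat -> T) :
  compact K -> (forall n, K (x n)) ->
  exists2 p, K p & forall A, nbhs p A -> forall N, exists2 n, (N <= n)%N & A (x n).
Proof.
move=> cK xK; have [|p [Kp cp]] := cK (x @ \oo).
  by exists 0%N => // n _; exact: xK.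
exists p => // A nA N.
have [y [[n /= Nn ny] Ay]] : (x @` [set n | (N <= n)%N]) `&` A !=set0.
  by apply: cp => //; exists N => // n /= Nn; exists n.
by exists n => //; rewrite ny.
Qed.

Lemma compact_image (R : realType) (g : CC R -> CC R) (E : set (CC R)) :
  continuous g -> compact E -> compact (g @` E).
Proof. by move=> cg cE; apply: (continuous_compact _ cE); exact: continuous_subspaceT. Qed.

(** * Primitives and Goursat's lemma *)

Lemma primitive_exists (R : realType) (phi : R -> R) (A : R) :
  continuous phi ->
  exists Phi : R -> R, forall x, A < x -> is_derive x 1 Phi (phi x).
Proof.
move=> cphi.
exists (fun x => Rintegral lebesgue_measure `[A, x]%classic phi) => x Ax.
have xu : x < x + 1 by rewrite ltrDl.
have intf : lebesgue_measure.-integrable `[A, x + 1]%classic (EFin \o phi).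
  apply: continuous_compact_integrable; first exact: segment_compact.
  exact: continuous_subspaceT.
have [d e] := continuous_FTC1_closed xu intf Ax (cphi x).
by apply: (DeriveDef d); rewrite -derive1E.
Qed.

Lemma mvt_le (R : realType) (f df : R -> R) (a b : R) : a <= b ->
  (forall x, a <= x <= b -> is_derive x 1 f (df x)) ->
  exists2 c, a <= c <= b & f b - f a = df c * (b - a).
Proof.
move=> ab fdf.
have [||c] := @MVT_segment R f df a b ab.
- by move=> x; rewrite in_itv /= => /andP[ax xb]; apply: fdf; rewrite !ltW.
- apply: derivable_within_continuous => x; rewrite in_itv /= => xab.
  by have := fdf x xab.
- by rewrite in_itv /= => cab e; exists c.
Qed.

(* The functional is the boundary integral of v dx + u dy written through
   partial primitives: it is additive in the rectangle by construction, and the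
   mean value theorem replaces all estimates of integrals. *)
Definition bdry_form (R : realType) (P X : R -> R -> R) (a b c d : R) : R :=
  (P b d - P b c - (P a d - P a c)) - (X d b - X d a - (X c b - X c a)).

(** Differentiability of [u + iv] relative to a rectangle, with the Cauchy-Riemann equations built
    in: the derivative is multiplication by [p + iq]. *)
Definition cr_diff (R : realType) (u v : R -> R -> R) (x1 x2 y1 y2 x0 y0 : R) :=
  exists p q, forall e : R, 0 < e -> exists2 d, 0 < d &
    forall x y, x1 <= x <= x2 -> y1 <= y <= y2 ->
      `|x - x0| < d -> `|y - y0| < d ->
      `|u x y - u x0 y0 - (p * (x - x0) - q * (y - y0))|
         <= e * (`|x - x0| + `|y - y0|) /\
      `|v x y - v x0 y0 - (q * (x - x0) + p * (y - y0))|
         <= e * (`|x - x0| + `|y - y0|).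

Lemma nested_interval (R : realType) (a l : nat -> R) :
  (forall k, a k <= a k.+1) -> (forall k, a k.+1 + l k.+1 <= a k + l k) ->
  (forall k, 0 <= l k) -> exists x, forall k, a k <= x <= a k + l k.
Proof.
move=> ha hb hl.
have mono k j : a k <= a (k + j)%N.
  by elim: j => [|j IH]; rewrite ?addn0 // addnS; exact: le_trans IH (ha _).
have monob k j : a (k + j)%N + l (k + j)%N <= a k + l k.
  by elim: j => [|j IH]; rewrite ?addn0 // addnS; exact: le_trans (hb _) IH.
have ub m k : a m <= a k + l k.
  apply: le_trans (mono m k) _; rewrite addnC.
  by apply: le_trans (monob k m); rewrite lerDl.
exists (sup (range a)) => k; apply/andP; split.
  by apply: ub_le_sup; [exists (a 0%N + l 0%N) => _ [m _ <-] | exists k].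
by apply: ge_sup; [exists (a 0%N), 0%N | move=> _ [m _ <-]].
Qed.

(** The mean value theorem, applied to differences of primitives over opposite sides, evaluates [u]
    at one common height [tau] and [v] at one common abscissa [sig]. The [q] terms then cancel
    within each difference, the two [p] terms cancel each other as [p * l * h], and only the
    approximation errors are left. *)
Lemma bdry_form_estimate (R : realType) (u v P X : R -> R -> R)
    (a l c h x0 y0 p q e : R) : 0 < l -> 0 < h -> 0 <= e ->
  (forall x y, a <= x <= a + l -> c <= y <= c + h -> is_derive y 1 (P x) (u x y)) ->
  (forall x y, a <= x <= a + l -> c <= y <= c + h -> is_derive x 1 (X y) (v x y)) ->
  a <= x0 <= a + l -> c <= y0 <= c + h ->
  (forall x y, a <= x <= a + l -> c <= y <= c + h ->
    `|u x y - u x0 y0 - (p * (x - x0) - q * (y - y0))|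
       <= e * (`|x - x0| + `|y - y0|) /\
    `|v x y - v x0 y0 - (q * (x - x0) + p * (y - y0))|
       <= e * (`|x - x0| + `|y - y0|)) ->
  `|bdry_form P X a (a + l) c (c + h)| <= e * (l + h) *+ 2 * (l + h).
Proof.
move=> l0 h0 e0 dP dX hx0 hy0 hd.
have la : a <= a <= a + l by rewrite lexx lerDl ltW.
have lb : a <= a + l <= a + l by rewrite lexx lerDl ltW.
have hc : c <= c <= c + h by rewrite lexx lerDl ltW.
have hc' : c <= c + h <= c + h by rewrite lexx lerDl ltW.
have [||tau tauP etau] := @mvt_le R (P (a + l) - P a)
  (fun y => u (a + l) y - u a y) c (c + h).
- by rewrite lerDl ltW.
- by move=> y hy; apply: is_deriveB; apply: dP.
have [||sig sigP esig] := @mvt_le R (X (c + h) - X c)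
  (fun x => v x (c + h) - v x c) a (a + l).
- by rewrite lerDl ltW.
- by move=> x hx; apply: is_deriveB; apply: dX.
have ab (x y : R) : a <= x <= a + l -> c <= y <= c + h ->
  `|u x y - u x0 y0 - (p * (x - x0) - q * (y - y0))| <= e * (l + h) /\
  `|v x y - v x0 y0 - (q * (x - x0) + p * (y - y0))| <= e * (l + h).
  move=> hx hy; have [A B] := hd x y hx hy.
  have h1 : `|x - x0| <= l.
    by clear -hx hx0; rewrite ler_norml; apply/andP; split; lra.
  have h2 : `|y - y0| <= h.
    by clear -hy hy0; rewrite ler_norml; apply/andP; split; lra.
  have hh : e * (`|x - x0| + `|y - y0|) <= e * (l + h).
    by rewrite ler_wpM2l // lerD.
  by split; apply: le_trans hh.
have [U1 _] := ab (a + l) tau lb tauP.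
have [U2 _] := ab a tau la tauP.
have [_ V1] := ab sig (c + h) sigP hc'.
have [_ V2] := ab sig c sigP hc.
have BE : bdry_form P X a (a + l) c (c + h) =
   ((u (a + l) tau - u a tau) * h) - ((v sig (c + h) - v sig c) * l).
  move: etau esig; rewrite !fctE /bdry_form [c + h - c]addrC addKr [a + l - a]addrC addKr.
  by move=> <- <-; ring.
have U : `|(u (a + l) tau - u a tau) - p * l| <= e * (l + h) *+ 2.
  rewrite mulr2n; apply: le_trans (lerD U1 U2).
  apply: le_trans (ler_normB _ _); rewrite le_eqVlt; apply/orP; left; apply/eqP.
  by congr (`|_|); ring.
have V : `|(v sig (c + h) - v sig c) - p * h| <= e * (l + h) *+ 2.
  rewrite mulr2n; apply: le_trans (lerD V1 V2).
  apply: le_trans (ler_normB _ _); rewrite le_eqVlt; apply/orP; left; apply/eqP.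
  by congr (`|_|); ring.
rewrite BE [X in `|X|](_ : _ = (u (a + l) tau - u a tau - p * l) * h
   - ((v sig (c + h) - v sig c) - p * h) * l); last by ring.
apply: le_trans (ler_normB _ _) _; rewrite !normrM (gtr0_norm h0) (gtr0_norm l0).
rewrite [leRHS]mulrDr addrC.
by apply: lerD; rewrite ler_pM2r.
Qed.

(** Goursat's bisection: one of the four quarters keeps at least a quarter of the functional, and at
    the limit point of the nested rectangles differentiability makes it smaller than that share. *)
Lemma goursat_rect (R : realType) (u v P X : R -> R -> R) (x1 x2 y1 y2 : R) :
  x1 < x2 -> y1 < y2 ->
  (forall x y, x1 <= x <= x2 -> y1 <= y <= y2 -> is_derive y 1 (P x) (u x y)) ->
  (forall x y, x1 <= x <= x2 -> y1 <= y <= y2 -> is_derive x 1 (X y) (v x y)) ->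
  (forall x y, x1 <= x <= x2 -> y1 <= y <= y2 -> cr_diff u v x1 x2 y1 y2 x y) ->
  bdry_form P X x1 x2 y1 y2 = 0.
Proof.
move=> x12 y12 dP dX cr; apply/eqP/negPn/negP => B0.
pose L := x2 - x1; pose H := y2 - y1.
pose eta := `|bdry_form P X x1 x2 y1 y2|.
have eta0 : 0 < eta by rewrite normr_gt0.
pose t k : R := (2^-1) ^+ k.
have t0 k : 0 < t k by rewrite exprn_gt0.
have tS k : t k.+1 = t k / 2 by rewrite /t exprS mulrC.
have L0 : 0 < L by rewrite subr_gt0.
have H0 : 0 < H by rewrite subr_gt0.
pose good (s : nat * (R * R)) :=
  let: (k, (a, c)) := s in
  [/\ x1 <= a, a + L * t k <= x2, y1 <= c, c + H * t k <= y2 &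
    eta * t k ^+ 2 <= `|bdry_form P X a (a + L * t k) c (c + H * t k)|].
pose step (s s' : nat * (R * R)) := good s ->
  [/\ s'.1 = s.1.+1, good s', s.2.1 <= s'.2.1,
    s'.2.1 + L * t s'.1 <= s.2.1 + L * t s.1 & s.2.2 <= s'.2.2 /\
    s'.2.2 + H * t s'.1 <= s.2.2 + H * t s.1].
have stepP s : {s' | step s s'}.
  apply/cid; case: s => k [a c].
  have [g|ng] := pselect (good (k, (a, c))); last by exists (k, (a, c)) => /ng.
  have [xa ax yc cy big] := g.
  pose l := L * t k.+1; pose h := H * t k.+1.
  have l0 : 0 < l by rewrite mulr_gt0.
  have h0 : 0 < h by rewrite mulr_gt0.
  have lE : L * t k = l + l by rewrite /l tS; field.
  have hE : H * t k = h + h by rewrite /h tS; field.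
  have split4 : bdry_form P X a (a + L * t k) c (c + H * t k) =
    bdry_form P X a (a + l) c (c + h) + bdry_form P X (a + l) (a + l + l) c (c + h)
    + bdry_form P X a (a + l) (c + h) (c + h + h)
    + bdry_form P X (a + l) (a + l + l) (c + h) (c + h + h).
    by rewrite lE hE /bdry_form !addrA; ring.
  have [b big'] : exists b : bool * bool, eta * t k.+1 ^+ 2 <=
      `|bdry_form P X (a + (if b.1 then l else 0)) (a + (if b.1 then l else 0) + l)
         (c + (if b.2 then h else 0)) (c + (if b.2 then h else 0) + h)|.
    apply: contrapT => /forallNP no.
    have n1 := no (false, false); have n2 := no (true, false).
    have n3 := no (false, true); have n4 := no (true, true).
    move: n1 n2 n3 n4 => /=; rewrite !addr0.
    move=> /negP; rewrite -ltNge => n1 /negP; rewrite -ltNge => n2.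
    move=> /negP; rewrite -ltNge => n3 /negP; rewrite -ltNge => n4.
    move: big; rewrite split4 leNgt => /negP; apply.
    apply: le_lt_trans (ler_normD _ _) _.
    have : eta * t k ^+ 2 = eta * t k.+1 ^+ 2 *+ 4.
      by rewrite tS; field.
    have := ler_normD (bdry_form P X a (a + l) c (c + h)
      + bdry_form P X (a + l) (a + l + l) c (c + h))
      (bdry_form P X a (a + l) (c + h) (c + h + h)).
    have := ler_normD (bdry_form P X a (a + l) c (c + h))
      (bdry_form P X (a + l) (a + l + l) c (c + h)).
    lra.
  exists (k.+1, (a + (if b.1 then l else 0), c + (if b.2 then h else 0))) => _ /=.
  rewrite lE in ax; rewrite hE in cy; rewrite -/l -/h lE hE.
  split=> //; first split => //; case: b big' => [[] []] /= _; rewrite ?addr0; lra.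
have [s [s0 sS]] := dependent_choice stepP (0%N, (x1, y1)).
have sg k : (s k).1 = k /\ good (s k).
  elim: k => [|k [e g]].
    by rewrite s0 /=; rewrite /t expr0 !mulr1 expr1n mulr1 /L /H !subrKC; split.
  by have [e' g' _ _ _] := sS k g; rewrite e' e.
have [x0 hx0] : exists x, forall k, (s k).2.1 <= x <= (s k).2.1 + L * t k.
  apply: nested_interval => k; last by rewrite ltW // mulr_gt0.
    by have [e' _ h _ _] := sS k (sg k).2.
  by have [e' _ _ h _] := sS k (sg k).2; move: h; rewrite e' (sg k).1.
have [y0 hy0] : exists y, forall k, (s k).2.2 <= y <= (s k).2.2 + H * t k.
  apply: nested_interval => k; last by rewrite ltW // mulr_gt0.
    by have [e' _ _ _ [h _]] := sS k (sg k).2.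
  by have [e' _ _ _ [_ h]] := sS k (sg k).2; move: h; rewrite e' (sg k).1.
have x0r : x1 <= x0 <= x2.
  by have := hx0 0%N; rewrite s0 /= /t expr0 mulr1 /L subrKC.
have y0r : y1 <= y0 <= y2.
  by have := hy0 0%N; rewrite s0 /= /t expr0 mulr1 /H subrKC.
have [p [q crpq]] := cr _ _ x0r y0r.
have LH0 : 0 < L + H by rewrite addr_gt0.
(* The estimate on the [k]-th rectangle is [2 * e * (L + H)^2 * (t k)^2]; this [e] makes it half of
   the lower bound [eta * (t k)^2]. *)
have [|d d0 hd] := crpq (eta / (4 * (L + H) ^+ 2)).
  by rewrite divr_gt0 // mulr_gt0 // exprn_gt0.
set e := eta / _ in hd.
have [k tk] : exists k, (L + H) * t k < d.
  have [k hk] : exists k : nat, (L + H) / d < k%:R.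
    by exists (Num.truncn ((L + H) / d)).+1; exact: truncnS_gt.
  exists k; rewrite /t exprVn ltr_pdivrMr ?exprn_gt0 //.
  rewrite ltr_pdivrMr // in hk; apply: (lt_le_trans hk).
  by rewrite mulrC ler_pM2l // -natrX ler_nat ltnW // ltn_expl.
case: (s k) (sg k) (hx0 k) (hy0 k) => k' [a c] /= [-> [xa ax yc cy big]] ha hc.
set l := L * t k in ax big ha; set h := H * t k in cy big hc.
have l0 : 0 < l by rewrite mulr_gt0.
have h0 : 0 < h by rewrite mulr_gt0.
have lh : l + h < d by rewrite -mulrDl.
have El : l = L * t k by [].
have Eh : h = H * t k by [].
have e0 : 0 < e by rewrite /e divr_gt0 // mulr_gt0 // exprn_gt0.
clearbody l h.
have inx (x : R) : a <= x <= a + l -> x1 <= x <= x2.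
  by move=> /andP[h1 h2]; rewrite (le_trans xa h1) (le_trans h2 ax).
have iny (y : R) : c <= y <= c + h -> y1 <= y <= y2.
  by move=> /andP[h1 h2]; rewrite (le_trans yc h1) (le_trans h2 cy).
have : `|bdry_form P X a (a + l) c (c + h)| <= e * (l + h) *+ 2 * (l + h).
  apply: (@bdry_form_estimate R u v P X a l c h x0 y0 p q e l0 h0 (ltW e0)) => //.
  - by move=> x y hx hy; apply: dP; [exact: inx | exact: iny].
  - by move=> x y hx hy; apply: dX; [exact: inx | exact: iny].
  - move=> x y hx hy; apply: hd; [exact: inx | exact: iny | |].
      apply: le_lt_trans lh; clear -hx ha h0; rewrite ler_norml.
      by apply/andP; split; lra.
    apply: le_lt_trans lh; clear -hy hc l0; rewrite ler_norml.
    by apply/andP; split; lra.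
apply/negP; rewrite -ltNge; apply: lt_le_trans big.
have -> : e * (l + h) *+ 2 * (l + h) = eta * t k ^+ 2 / 2.
  by rewrite /e El Eh -mulrDl; field; rewrite gt_eqF.
by rewrite ltr_pdivrMr // ltr_pMr ?mulr_gt0 ?exprn_gt0 // ltr1n.
Qed.

(** * The mean value property in polar coordinates *)

Lemma derivable_approx (K : numFieldType) (f : K -> K) (a : K) :
  derivable f a 1 -> exists l, forall e, 0 < e -> exists2 d, 0 < d &
    forall w, `|w - a| < d -> `|f w - f a - l * (w - a)| <= e * `|w - a|.
Proof.
move=> df; exists ('D_1 f a) => e e0.
have /cvgrPdist_lt /(_ e e0) := df.
move=> /nbhs_ballP[d /= d0 hd]; exists d => // w wd.
have [->|wa] := eqVneq w a; first by rewrite !subrr mulr0 subr0 normr0 mulr0.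
have wa0 : w - a != 0 by rewrite subr_eq0.
have := hd (w - a); rewrite /ball /= sub0r normrN => /(_ wd wa0).
rewrite /GRing.scale /= mulr1 subrK => h.
have -> : f w - f a - 'D_1 f a * (w - a) =
   - (('D_1 f a - (w - a)^-1 * (f w - f a)) * (w - a)).
  by field.
by rewrite normrN normrM ler_pM2r ?normr_gt0 // ltW.
Qed.

Lemma derivable_approxR (R : realType) (f : R -> R) (x d : R) :
  is_derive x 1 f d -> forall e, 0 < e -> exists2 r, 0 < r &
    forall h, `|h| < r -> `|f (x + h) - f x - d * h| <= e * `|h|.
Proof.
move=> df e e0; have := @ex_derive _ _ _ _ _ _ _ df.
move=> /cvgrPdist_lt /(_ e e0).
move=> /nbhs_ballP[r /= r0 hr]; exists r => // h hh.
have [->|h0] := eqVneq h 0; first by rewrite addr0 subrr mulr0 subr0 normr0 mulr0.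
have := hr h; rewrite /ball /= sub0r normrN => /(_ hh h0).
have := @derive_val _ _ _ _ _ _ _ df; rewrite /derive => ->.
rewrite /GRing.scale /= mulr1 [h + x]addrC => H.
have -> : f (x + h) - f x - d * h = - ((d - h^-1 * (f (x + h) - f x)) * h).
  by field.
by rewrite normrN normrM ler_pM2r ?normr_gt0 // ltW.
Qed.

Lemma derivable_approxC (R : realType) (g : CC R -> CC R) (a : CC R) :
  derivable g a 1 -> exists l, forall e : R, 0 < e -> exists2 d, 0 < d &
    forall w, nm (w - a) < d -> nm (g w - g a - l * (w - a)) <= e * nm (w - a).
Proof.
move=> /derivable_approx[l hl]; exists l => e e0.
have [|d d0 hd] := hl (e%:C); first by rewrite ltcR.
have /complex_realP[r dr] : d \is Num.real by rewrite gtr0_real.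
exists r; first by move: d0; rewrite dr ltcR.
move=> w wr; have := hd w; rewrite !nmE dr ltcR => /(_ wr).
by rewrite -rmorphM /= lecR.
Qed.

Lemma derivable_continuousC (R : realType) (g : CC R -> CC R) (a : CC R) :
  derivable g a 1 -> {for a, continuous g}.
Proof. by move=> /derivable1_diffP /differentiable_continuous. Qed.

Definition circ (R : realType) (a : CC R) (rho t : R) : CC R :=
  a + Complex (rho * cos t) (rho * sin t).

Lemma nm_circ (R : realType) (a : CC R) (rho t : R) :
  0 <= rho -> nm (circ a rho t - a) = rho.
Proof.
move=> r0; rewrite /circ addrC addKr /nm /= !exprMn -mulrDr cos2Dsin2 mulr1.
by rewrite sqrtr_sqr ger0_norm.
Qed.

Lemma circ_cont (R : realType) (a : CC R) (p : R * R) :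
  {for p, continuous (fun p : R * R => circ a p.1 p.2)}.
Proof.
rewrite /circ; apply: cvgD; first exact: cvg_cst.
apply: (@continuous_comp _ _ _ (fun p : R * R => (p.1 * cos p.2, p.1 * sin p.2))
  (fun q : R * R => (Complex q.1 q.2 : CC R))); last exact: continuous_Complex.
have c1 : (fun p : R * R => p.1) @ p --> p.1 by exact: cvg_fst.
have c2 : (fun p : R * R => p.2) @ p --> p.2 by exact: cvg_snd.
have c3 : (fun p : R * R => cos p.2) @ p --> cos p.2.
  by apply: (@continuous_comp _ _ _ snd cos) => //; exact: continuous_cos.
have c4 : (fun p : R * R => sin p.2) @ p --> sin p.2.
  by apply: (@continuous_comp _ _ _ snd sin) => //; exact: continuous_sin.
exact: (cvg_pair (cvgM c1 c3) (cvgM c1 c4)).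
Qed.

(** Complex differentiability in the variable [s + it] with derivative [c], kept in real coordinates
    so that it yields [cr_diff] directly. *)
Definition lin_at (R : realType) (G : R -> R -> CC R) (s0 t0 : R) (c : CC R) :=
  forall e : R, 0 < e -> exists2 d, 0 < d & forall s t,
    `|s - s0| < d -> `|t - t0| < d ->
    nm (G s t - G s0 t0 - c * Complex (s - s0) (t - t0))
      <= e * (`|s - s0| + `|t - t0|).

(** The map is [a + exp(s + it)], whose derivative is its own value minus [a]. These coordinates
    turn an annulus into a rectangle, to which Goursat's lemma applies. *)
Lemma lin_at_exp (R : realType) (a : CC R) (s0 t0 : R) :
  lin_at (fun s t => circ a (expR s) t) s0 t0 (circ a (expR s0) t0 - a).
Proof.
move=> e e0; set E0 := _ - a.
pose M := nm E0 + 1.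
have M0 : 0 < M by rewrite ltr_pwDr // nm_ge0.
(* The real and imaginary errors below add up to at most [3 * e1 * |x| + 5 * e1 * |y|], hence the
   8. *)
pose e1 := Num.min 1 (e / (8 * M)).
have e10 : 0 < e1 by rewrite lt_min ltr01 divr_gt0 // mulr_gt0.
have e1M : e1 <= e / (8 * M) by rewrite ge_min lexx orbT.
have e11 : e1 <= 1 by rewrite ge_min lexx.
clearbody e1.
have [r1 r10 h1] := derivable_approxR (is_derive_expR (0 : R)) e10.
have [r2 r20 h2] := derivable_approxR (is_derive_cos (0 : R)) e10.
have [r3 r30 h3] := derivable_approxR (is_derive_sin (0 : R)) e10.
pose d := Num.min (Num.min r1 r2) (Num.min r3 e1).
have d0 : 0 < d by rewrite !lt_min r10 r20 r30 e10.
exists d => // s t; set x := s - s0; set y := t - t0.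
rewrite /d !lt_min => /andP[/andP[xr1 xr2] /andP[xr3 xe]].
move=> /andP[/andP[yr1 yr2] /andP[yr3 ye]].
move: (h1 x xr1) (h2 y yr2) (h3 y yr3).
rewrite !add0r expR0 cos0 sin0 oppr0 !mul1r mul0r !(subr0, addr0) => H1 H2 H3.
have -> : circ a (expR s) t - circ a (expR s0) t0 - E0 * Complex x y =
   E0 * (Complex (expR x * cos y - 1 - x) (expR x * sin y - y)).
  have -> : s = s0 + x by rewrite /x subrKC.
  have -> : t = t0 + y by rewrite /y subrKC.
  rewrite /E0 /circ [a + _ - a]addrC addKr expRD cosD sinD.
  apply/eqP; rewrite eq_complex !(ReB, ReM, ImB, ImM, ReD, ImD) /=.
  by apply/andP; split; apply/eqP; ring.
rewrite nmM.
have EM : nm E0 <= M by rewrite lerDl.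
have xy0 : 0 <= `|x| + `|y| by rewrite addr_ge0.
have hx0 := normr_ge0 x; have hy0 := normr_ge0 y.
have key : nm (Complex (expR x * cos y - 1 - x) (expR x * sin y - y) : CC R)
    <= e / M * (`|x| + `|y|).
  apply: le_trans (nm_le_ReIm _) _ => /=.
  have ex2 : `|expR x - 1| <= 2 * `|x|.
    have -> : expR x - 1 = (expR x - 1 - x) + x by ring.
    apply: le_trans (ler_normD _ _) _.
    have : e1 * `|x| <= 1 * `|x| by rewrite ler_wpM2r.
    by move: H1; lra.
  have x1 : `|x| <= 1 by lra.
  have ex3 : `|expR x| <= 3.
    have -> : expR x = (expR x - 1) + 1 by ring.
    by apply: le_trans (ler_normD _ _) _; rewrite normr1; lra.
  have A : `|expR x * cos y - 1 - x| <= e1 * `|x| + 2 * (e1 * `|y|).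
    have -> : expR x * cos y - 1 - x = (expR x - 1 - x) * cos y + (cos y - 1) * (1 + x).
      by ring.
    apply: le_trans (ler_normD _ _) _; rewrite !normrM; apply: lerD.
      by rewrite -[leRHS]mulr1; apply: ler_pM => //; exact: cos_max.
    rewrite [leRHS]mulrC; apply: ler_pM => //.
    by apply: le_trans (ler_normD _ _) _; rewrite normr1; lra.
  have B : `|expR x * sin y - y| <= 3 * (e1 * `|y|) + 2 * `|x| * e1.
    have -> : expR x * sin y - y = expR x * (sin y - y) + (expR x - 1) * y by ring.
    apply: le_trans (ler_normD _ _) _; rewrite !normrM; apply: lerD.
      by apply: ler_pM.
    by apply: ler_pM => //; exact: ltW.
  have : e1 * (`|x| + `|y|) * 8 <= e / M * (`|x| + `|y|).
    rewrite mulrAC ler_wpM2r // -ler_pdivlMr //.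
    by apply: le_trans e1M _; rewrite -mulrA -invfM [M * 8]mulrC.
  have : 0 <= e1 * `|x| by rewrite mulr_ge0 // ltW.
  have : 0 <= e1 * `|y| by rewrite mulr_ge0 // ltW.
  by lra.
have -> : e * (`|x| + `|y|) = M * (e / M * (`|x| + `|y|)).
  by field; rewrite gt_eqF.
by apply: ler_pM => //; exact: nm_ge0.
Qed.

Lemma lin_at_comp (R : realType) (G : R -> R -> CC R) (g : CC R -> CC R)
    (s0 t0 : R) (c : CC R) :
  lin_at G s0 t0 c -> derivable g (G s0 t0) 1 ->
  exists c', lin_at (fun s t => g (G s t)) s0 t0 c'.
Proof.
move=> hG /derivable_approxC[l hl]; exists (l * c) => e e0.
pose M := nm c + 1; pose L := nm l + 1.
have M0 : 0 < M by rewrite ltr_pwDr // nm_ge0.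
have L0 : 0 < L by rewrite ltr_pwDr // nm_ge0.
have [|d d0 hd] := hl (e / (2 * M)); first by rewrite divr_gt0 // mulr_gt0.
pose e1 := Num.min 1 (e / (2 * L)).
have e10 : 0 < e1 by rewrite lt_min ltr01 divr_gt0 // mulr_gt0.
have e1L : e1 <= e / (2 * L) by rewrite ge_min lexx orbT.
have e11 : e1 <= 1 by rewrite ge_min lexx.
clearbody e1.
have [d1 d10 hd1] := hG e1 e10.
exists (Num.min d1 (d / (2 * M))).
  by rewrite lt_min d10 divr_gt0 // mulr_gt0.
move=> s t; rewrite !lt_min => /andP[s1 s2] /andP[t1 t2].
have := hd1 s t s1 t1; set x := s - s0; set y := t - t0.
rewrite -/x -/y in s1 s2 t1 t2 *.
set D := G s t - G s0 t0 => H1.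
have hx0 := normr_ge0 x; have hy0 := normr_ge0 y.
have xy0 : 0 <= `|x| + `|y| by rewrite addr_ge0.
have DM : nm D <= M * (`|x| + `|y|).
  apply: le_trans (nm_leD D (c * Complex x y)) _.
  rewrite nmM [leRHS]mulrDl addrC; apply: lerD.
    by apply: ler_wpM2l; [exact: nm_ge0 | exact: nm_le_ReIm].
  by apply: le_trans H1 _; rewrite ler_wpM2r.
have Dd : nm D < d.
  apply: le_lt_trans DM _; rewrite mulrC -ltr_pdivlMr //.
  have -> : d / M = d / (2 * M) + d / (2 * M) by field; rewrite gt_eqF.
  exact: ltrD.
have H2 := hd _ Dd; rewrite -/D in H2.
have -> : g (G s t) - g (G s0 t0) - l * c * Complex x y =
   (g (G s t) - g (G s0 t0) - l * D) + l * (D - c * Complex x y) by ring.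
apply: le_trans (nmD _ _) _; rewrite nmM.
have -> : e * (`|x| + `|y|) = e / 2 * (`|x| + `|y|) + e / 2 * (`|x| + `|y|) by field.
apply: lerD.
  apply: le_trans H2 _.
  have -> : e / 2 * (`|x| + `|y|) = e / (2 * M) * (M * (`|x| + `|y|)).
    by field; rewrite gt_eqF.
  by apply: ler_wpM2l => //; rewrite ltW // divr_gt0 // mulr_gt0.
have -> : e / 2 * (`|x| + `|y|) = L * (e / (2 * L) * (`|x| + `|y|)).
  by field; rewrite gt_eqF.
apply: ler_pM; [exact: nm_ge0 | exact: nm_ge0 | by rewrite lerDl |].
by apply: le_trans H1 _; rewrite ler_wpM2r.
Qed.

Lemma lin_at_cr (R : realType) (G : R -> R -> CC R) (x1 x2 y1 y2 s0 t0 : R) (c : CC R) :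
  lin_at G s0 t0 c ->
  cr_diff (fun s t => Re (G s t)) (fun s t => Im (G s t)) x1 x2 y1 y2 s0 t0.
Proof.
move=> h; exists (Re c), (Im c) => e e0; have [d d0 hd] := h e e0.
exists d => // x y _ _ hx hy; have H := hd x y hx hy.
split; apply: le_trans H.
  by have := normr_Re_le (G x y - G s0 t0 - c * Complex (x - s0) (y - t0));
    rewrite !ReB ReM.
have := normr_Im_le (G x y - G s0 t0 - c * Complex (x - s0) (y - t0)).
by rewrite !ImB ImM (addrC (Re c * _)).
Qed.

(** The mean value property on all small circles, the integral being the increment of a primitive
    [P]. Starting at [-1] instead of [0] leaves room for a two-sided derivative at the end point
    [0]. *)
Definition harm_at (R : realType) (u : CC R -> R) (a : CC R) :=
  exists2 r : R, 0 < r & forall rho : R, 0 < rho < r -> exists P : R -> R,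
    (forall t : R, -1 < t -> is_derive t 1 P (u (circ a rho t))) /\
    P (pi *+ 2) - P 0 = pi *+ 2 * u a.

(** * Harmonic functions and the maximum principle *)

Lemma polar_cont (R : realType) (a : CC R) (p : R * R) :
  {for p, continuous (fun p : R * R => circ a (expR p.1) p.2)}.
Proof.
apply: (@continuous_comp _ _ _ (fun p : R * R => (expR p.1, p.2))
  (fun p : R * R => circ a p.1 p.2)); last exact: circ_cont.
have c1 : (fun p : R * R => p.1) @ p --> p.1 by exact: cvg_fst.
have c2 : (fun p : R * R => p.2) @ p --> p.2 by exact: cvg_snd.
have c3 : (fun p : R * R => expR p.1) @ p --> expR p.1.
  by apply: (@continuous_comp _ _ _ fst expR) => //; exact: continuous_expR.
exact: (cvg_pair c3 c2).
Qed.

Lemma circ2pi (R : realType) (a : CC R) (rho : R) : circ a rho (pi *+ 2) = circ a rho 0.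
Proof. by rewrite /circ cos2pi sin2pi cos0 sin0. Qed.

(** In logarithmic polar coordinates the sides [t = 0] and [t = 2 pi] carry equal data and cancel in
    Goursat's lemma, so the mean over a circle does not depend on its radius; continuity at [a]
    identifies it as the radius shrinks. Differentiability is asked only off the centre, so that
    difference quotients with a removable singularity qualify. *)
Lemma harm_at_Re (R : realType) (g : CC R -> CC R) (a : CC R) (r : R) :
  0 < r -> {for a, continuous g} ->
  (forall z, 0 < nm (z - a) < r -> derivable g z 1) ->
  harm_at (fun z => Re (g z)) a.
Proof.
move=> r0 ga gd; exists r => // rho /andP[rho0 rhor].
pose s2 := ln rho.
have es2 : expR s2 = rho by rewrite lnK // posrE.
pose G (s t : R) := g (circ a (expR s) t).
have es (s : R) : s <= s2 -> 0 < expR s < r.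
  by move=> ss; rewrite expR_gt0 /= (le_lt_trans _ rhor) // -es2 ler_expR.
have dg (s t : R) : s <= s2 -> derivable g (circ a (expR s) t) 1.
  by move=> ss; apply: gd; rewrite nm_circ ?expR_ge0 //; exact: es.
have Gc (s t : R) : s <= s2 ->
    {for (s, t), continuous (fun p : R * R => g (circ a (expR p.1) p.2))}.
  move=> ss; apply: (@continuous_comp _ _ _ (fun p : R * R => circ a (expR p.1) p.2) g).
    exact: polar_cont.
  exact/derivable_continuousC/dg.
have ct (s : R) : s <= s2 -> continuous (fun t : R => Re (G s t)).
  move=> ss t.
  apply: (@continuous_comp _ _ _ (fun t : R => G s t) (fun z : CC R => Re z));
    last exact: continuous_Re.
  apply: (@continuous_comp _ _ _ (fun t : R => (s, t))
    (fun p : R * R => g (circ a (expR p.1) p.2))); last exact: Gc.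
  have c1 : (fun _ : R => s) @ t --> s by exact: cvg_cst.
  have c2 : (fun x : R => x) @ t --> t by exact: cvg_id.
  exact: (cvg_pair c1 c2).
(* Continuity of [G] is known only for [s <= s2]; clamping [s] gives a function continuous on the
   whole line, as [primitive_exists] requires, without changing it on the rectangle. *)
have cs (t : R) : continuous (fun s : R => Im (G (Num.min s s2) t)).
  move=> s.
  apply: (@continuous_comp _ _ _ (fun s : R => G (Num.min s s2) t) (fun z : CC R => Im z));
    last exact: continuous_Im.
  apply: (@continuous_comp _ _ _ (fun s : R => (Num.min s s2, t))
    (fun p : R * R => g (circ a (expR p.1) p.2))); last first.
    by apply: Gc; rewrite ge_min lexx orbT.
  have c1 : (fun _ : R => t) @ s --> t by exact: cvg_cst.
  have c2 : (fun x : R => Num.min x s2) @ s --> Num.min s s2.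
    apply/(contRRP (fun x : R => Num.min x s2)) => e e0; exists e => // y.
    rewrite !ltr_norml /Num.min => /andP[y1 y2].
    by case: (ltP y s2) => ?; case: (ltP s s2) => ?; apply/andP; split; lra.
  exact: (cvg_pair c2 c1).
have [P hP] : {P : R -> R -> R & forall s, s <= s2 ->
    forall t : R, -1 < t -> is_derive t 1 (P s) (Re (G s t))}.
  apply: (choice (P := fun s Q => s <= s2 ->
    forall t : R, -1 < t -> is_derive t 1 Q (Re (G s t)))) => s.
  have [ss|ss] := pselect (s <= s2); last by exists (cst 0) => /ss.
  by have [Q hQ] := primitive_exists (-1) (ct s ss); exists Q.
have pi0 : 0 < pi *+ 2 :> R by rewrite mulrn_wgt0 // pi_gt0.
have mean s1 : s1 < s2 -> P s2 (pi *+ 2) - P s2 0 = P s1 (pi *+ 2) - P s1 0.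
  move=> s12.
  have [X hX] : {X : R -> R -> R & forall t (s : R), s1 - 1 < s ->
      is_derive s 1 (X t) (Im (G (Num.min s s2) t))}.
    apply: (choice (P := fun t Q => forall s : R, s1 - 1 < s ->
      is_derive s 1 Q (Im (G (Num.min s s2) t)))) => t.
    exact: primitive_exists (cs t).
  have dX t s : s1 <= s <= s2 -> is_derive s 1 (X t) (Im (G s t)).
    move=> /andP[h1 h2]; have := hX t s ltac:(lra).
    by rewrite min_l.
  have := @goursat_rect R (fun s t => Re (G s t)) (fun s t => Im (G s t)) P X
    s1 s2 0 (pi *+ 2) s12 pi0.
  have H1 : forall x y : R, s1 <= x <= s2 -> 0 <= y <= pi *+ 2 ->
      is_derive y 1 (P x) (Re (G x y)).
    by move=> s t /andP[h1 h2] /andP[h3 h4]; apply: hP; lra.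
  have H2 : forall x y : R, s1 <= x <= s2 -> 0 <= y <= pi *+ 2 ->
      is_derive x 1 (X y) (Im (G x y)).
    by move=> s t h1 h2; apply: dX.
  have H3 : forall x y : R, s1 <= x <= s2 -> 0 <= y <= pi *+ 2 ->
      cr_diff (fun s t : R => Re (G s t)) (fun s t : R => Im (G s t)) s1 s2 0 (pi *+ 2) x y.
    move=> s t /andP[h1 h2] h3.
    have [c' hc'] := lin_at_comp (lin_at_exp a s t) (dg s t h2).
    exact: lin_at_cr hc'.
  move=> /(_ H1 H2 H3).
  have [|c _] := @mvt_le R (X (pi *+ 2) - X 0) (cst 0) s1 s2 (ltW s12).
    move=> s hs; have := is_deriveB (dX (pi *+ 2) s hs) (dX 0 s hs).
    by rewrite /G circ2pi subrr.
  rewrite !fctE mul0r /bdry_form => e1 e2.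
  have {}e1 : X (pi *+ 2) s2 - X 0 s2 - (X (pi *+ 2) s1 - X 0 s1) = 0 by [].
  by move: (P s2 (pi *+ 2)) (P s2 0) (P s1 (pi *+ 2)) (P s1 0) e1 e2 => *; lra.
exists (P s2); split.
  by move=> t ht; have := hP s2 (lexx _) t ht; rewrite /G es2.
apply/eqP; rewrite -subr_eq0 -normr_le0; apply/ler_addgt0Pl => e e0; rewrite addr0.
have [d d0 hd] := (contCP g a).1 ga (e / (pi *+ 2)) ltac:(by rewrite divr_gt0).
pose s1 := Num.min (s2 - 1) (ln (d / 2)).
have s12 : s1 < s2 by rewrite gt_min ltrBlDr ltrDl ltr01.
have es1 : expR s1 < d.
  have : expR s1 <= d / 2.
    have d20 : d / 2 \is Num.pos by rewrite posrE divr_gt0.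
    by rewrite -[leRHS](lnK d20) ler_expR ge_min lexx orbT.
  by move=> h; apply: le_lt_trans h _; lra.
rewrite (mean _ s12).
have [|tau /andP[t1 t2] ->] := @mvt_le R (P s1) (fun t => Re (G s1 t)) 0 (pi *+ 2) (ltW pi0).
  by move=> t /andP[h1 h2]; apply: hP; [exact: ltW | lra].
rewrite subr0 mulrC -mulrBr normrM gtr0_norm // mulrC -ler_pdivlMr //.
rewrite -ReB; apply: le_trans (normr_Re_le _) _; apply/ltW/hd.
by rewrite nm_circ ?expR_ge0.
Qed.

Lemma harm_atD (R : realType) (u v : CC R -> R) (a : CC R) :
  harm_at u a -> harm_at v a -> harm_at (fun z => u z + v z) a.
Proof.
move=> [r r0 hr] [s s0 hs]; exists (Num.min r s); first by rewrite lt_min r0.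
move=> rho /andP[rho0]; rewrite lt_min => /andP[h1 h2].
have [P [dP eP]] := hr rho ltac:(by rewrite rho0).
have [Q [dQ eQ]] := hs rho ltac:(by rewrite rho0).
exists (P + Q); split; first by move=> t ht; apply: is_deriveD; [exact: dP | exact: dQ].
by rewrite !fctE mulrDr -eP -eQ; ring.
Qed.

Lemma harm_atZ (R : realType) (k : R) (u : CC R -> R) (a : CC R) :
  harm_at u a -> harm_at (fun z => k * u z) a.
Proof.
move=> [r r0 hr]; exists r => // rho /hr[P [dP eP]].
exists (k \*: P); split; first by move=> t ht; apply: is_deriveZ; exact: dP.
by rewrite /= /GRing.scale /= -mulrBr eP; ring.
Qed.

Lemma harm_at_cst (R : realType) (k : R) (a : CC R) : harm_at (fun=> k) a.
Proof.
exists 1 => // rho _; exists (fun t => k * t); split; last by rewrite mulr0 subr0 mulrC.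
move=> t _; have := is_deriveZ k (is_derive_id t (1 : R)).
by rewrite /GRing.scale /= mulr1.
Qed.

Lemma harm_at_sum (R : realType) (N : nat) (u : nat -> CC R -> R) (a : CC R) :
  (forall i, (i < N)%N -> harm_at (u i) a) ->
  harm_at (fun z => \sum_(i < N) u i z) a.
Proof.
elim: N => [|N IH] h.
  have -> : (fun z => \sum_(i < 0) u i z) = (fun=> 0).
    by apply/funext => z; rewrite big_ord0.
  exact: harm_at_cst.
have -> : (fun z => \sum_(i < N.+1) u i z) = (fun z => \sum_(i < N) u i z + u N z).
  by apply/funext => z; rewrite big_ord_recr.
by apply: harm_atD; [apply: IH => i iN; exact/h/ltnW | exact: h].
Qed.

Lemma harm_at_near (R : realType) (u v : CC R -> R) (a : CC R) (r : R) : 0 < r ->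
  (forall z, nm (z - a) < r -> u z = v z) -> harm_at u a -> harm_at v a.
Proof.
move=> r0 uv [s s0 hs]; exists (Num.min r s); first by rewrite lt_min r0.
move=> rho /andP[rho0]; rewrite lt_min => /andP[h1 h2].
have [P [dP eP]] := hs rho ltac:(by rewrite rho0).
exists P; rewrite -uv ?subrr ?nm0 //; split => // t ht.
by rewrite -uv ?nm_circ // ?(ltW rho0) //; exact: dP.
Qed.

(** If the bound failed, the set of maximum points would be a compact subset of [O]. The mean value
    property at its leftmost point forces the maximum also at the leftmost point of a small circle,
    further to the left. The argument is indifferent to whether [O] is connected. *)
Lemma max_principle (R : realType) (u : CC R -> R) (O : set (CC R)) (B M : R) :
  open O -> (forall z, O z -> nm z <= B) ->
  (forall z, closure O z -> {for z, continuous u}) ->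
  (forall z, O z -> harm_at u z) ->
  (forall z, closure O z -> ~ O z -> u z <= M) ->
  forall z, O z -> u z <= M.
Proof.
move=> oO bO cu hu bd z Oz; rewrite leNgt; apply/negP => Mz.
have cO : compact (closure O).
  apply: (@bounded_closed_compactC _ _ (B + 1)); first exact: closed_closure.
  move=> w /closureCP /(_ 1 ltr01)[w' /bO w'B ww'].
  by have := nm_leD w w'; rewrite nm_distC; lra.
have uc : {within closure O, continuous u}.
  by apply: continuous_in_subspaceT => w /set_mem; exact: cu.
have cO0 : closure O z by exact: subset_closure.
have [m mO mmax] := @compact_EVT_max _ _ u (closure O) ltac:(by exists z) cO uc.
have mO' : closure O m by exact: set_mem.
pose S := [set w | closure O w /\ u w = u m].
have SO w : S w -> O w.
  move=> [cw uw]; apply: contrapT => /(bd _ cw); rewrite uw => h.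
  have := mmax z; rewrite inE => /(_ cO0) h'.
  by have := lt_le_trans Mz h'; rewrite ltNge h.
have cS : compact S.
  apply: (subclosed_compact _ cO); last by move=> w [].
  apply/closedCP => w hw.
  have cw : closure O w.
    apply: closed_closure; apply/closureCP => e e0.
    by have [w' [? _] ?] := hw e e0; exists w'.
  split => //; apply/eqP; rewrite -subr_eq0 -normr_le0; apply/ler_addgt0Pl => e e0.
  rewrite addr0; have [d d0 hd] := (contCRP u w).1 (cu w cw) e e0.
  have [w' [_ <-] w'w] := hw d d0.
  by rewrite distrC ltW // hd.
have [a aS amin] := @compact_EVT_min _ _ (fun w : CC R => Re w) S
  ltac:(by exists m) cS
  ltac:(by apply: continuous_subspaceT => w; exact: continuous_Re).
have {aS} aS : S a by exact: set_mem.
have [ca ua] := aS; have Oa := SO _ aS.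
have [r1 r10 h1] := (openCP O).1 oO a Oa.
have [r2 r20 h2] := hu a Oa.
pose rho := Num.min r1 r2 / 2.
have rm : 0 < Num.min r1 r2 by rewrite lt_min r10.
have rho0 : 0 < rho by rewrite divr_gt0.
have rhom : rho < Num.min r1 r2 by rewrite /rho; lra.
move: (rhom); rewrite lt_min => /andP[rho1 rho2].
have [P [dP eP]] := h2 rho ltac:(by rewrite rho0).
have le (t : R) : u (circ a rho t) <= u m.
  apply: mmax; rewrite inE; apply/subset_closure/h1.
  by rewrite nm_circ // ltW.
have pi0 : 0 < pi :> R by exact: pi_gt0.
(* [Q] is nonincreasing because [u <= u m], and has equal values at [0] and [2 pi], so it is
   constant; a value of [u] below the maximum at angle [pi] would give it a negative derivative
   there. *)
pose Q : R -> R := fun t => P t - u m * t.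
have dQ (t : R) : -1 < t -> is_derive t 1 Q (u (circ a rho t) - u m).
  move=> ht; apply: is_deriveB; first exact: dP.
  have := is_deriveZ (u m) (is_derive_id t (1 : R)).
  by rewrite /GRing.scale /= mulr1.
have Qmon (x y : R) : 0 <= x -> x <= y -> Q y <= Q x.
  move=> x0 xy; have [|c hc e] := @mvt_le R Q (fun t => u (circ a rho t) - u m) x y xy.
    by move=> t ht; apply: dQ; lra.
  rewrite -subr_le0 e; apply: mulr_le0_ge0; first by rewrite subr_le0.
  by rewrite subr_ge0.
have Qend : Q (pi *+ 2) = Q 0.
  by move: eP; rewrite /Q ua mulr0 subr0 mulrC => /eqP; rewrite subr_eq => /eqP ->; ring.
have Qc (t : R) : 0 <= t <= pi *+ 2 -> Q t = Q 0.
  move=> /andP[t0 t2]; apply/eqP; rewrite eq_le Qmon //=.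
  by rewrite -Qend Qmon.
have strict : u (circ a rho pi) = u m.
  apply/eqP; rewrite eq_le le /= leNgt; apply/negP => lt.
  have [|d d0 hd] := @derivable_approxR R Q pi _ (dQ pi ltac:(lra))
    ((u m - u (circ a rho pi)) / 2).
    by rewrite divr_gt0 // subr_gt0.
  pose h := Num.min d pi / 2.
  have dp : 0 < Num.min d pi by rewrite lt_min d0.
  have h0 : 0 < h by rewrite divr_gt0.
  have hdp : h < Num.min d pi by rewrite /h; lra.
  move: (hdp); rewrite lt_min => /andP[hd' hp].
  have := hd h; rewrite gtr0_norm // => /(_ hd').
  rewrite (Qc (pi + h)) ?(Qc pi); [|by rewrite mulr2n; lra|by rewrite mulr2n; lra].
  rewrite subrr sub0r -mulNr opprB normrM [`|h|]gtr0_norm // ler_pM2r //.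
  by rewrite gtr0_norm ?subr_gt0 //; lra.
have Sp : S (circ a rho pi).
  split; last exact: strict.
  by apply/subset_closure/h1; rewrite (nm_circ _ _ (ltW rho0)).
have := amin (circ a rho pi); rewrite inE => /(_ Sp).
rewrite /circ ReD /= cospi mulrN1 lerDl.
by lra.
Qed.

(** * Logarithms and Lipschitz bounds *)

Lemma approx_derivableC (R : realType) (g : CC R -> CC R) (a l : CC R) :
  (forall e : R, 0 < e -> exists2 d, 0 < d &
    forall w, nm (w - a) < d -> nm (g w - g a - l * (w - a)) <= e * nm (w - a)) ->
  derivable g a 1.
Proof.
move=> h; apply/cvg_ex; exists l; apply/cvgrPdist_le => e e0.
have /complex_realP[r er] : e \is Num.real by rewrite gtr0_real.
have r0 : 0 < r by move: e0; rewrite er ltcR.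
have [d d0 hd] := h r r0.
apply/nbhs_ballP; exists (d%:C) => /=; first by rewrite ltcR.
move=> w; rewrite /ball /= sub0r normrN nmE ltcR => wd w0.
rewrite /GRing.scale /= mulr1.
have := hd (w + a); rewrite addrK => /(_ wd) H.
have -> : l - w^-1 * (g (w + a) - g a) = - ((g (w + a) - g a - l * w) / w) by field.
rewrite normrN nmE er lecR nmM nmV ler_pdivrMr //.
by rewrite nm_gt0.
Qed.

Definition clog (R : realType) (z : CC R) : CC R :=
  Complex (ln (nm z)) (atan (Im z / Re z)).

Lemma clogK (R : realType) (z : CC R) : 0 < Re z ->
  circ 0 (expR (ln (nm z))) (atan (Im z / Re z)) = z.
Proof.
move=> x0; have n0 : 0 < nm z by exact: lt_le_trans x0 (Re_le_nm z).
rewrite lnK ?posrE //; set x := Re z in x0 *; set y := Im z.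
have s0 : 0 < Num.sqrt (1 + (y / x) ^+ 2).
  by rewrite sqrtr_gt0 ltr_pwDl // sqr_ge0.
have nE : nm z = x * Num.sqrt (1 + (y / x) ^+ 2).
  rewrite -[X in _ = X * _](ger0_norm (ltW x0)) -sqrtr_sqr -sqrtrM ?sqr_ge0 //.
  transitivity (Num.sqrt (x ^+ 2 + y ^+ 2)); first by rewrite /x /y; case: (z).
  by congr Num.sqrt; field; rewrite gt_eqF.
have cE := cos_atan (y / x).
have c0 : cos (atan (y / x)) != 0 by rewrite cE invr_eq0 gt_eqF.
have sE : sin (atan (y / x)) = y / x * cos (atan (y / x)).
  by rewrite -{2}(atanK (y / x)) /tan mulfVK.
rewrite /circ add0r sE cE nE; transitivity (Complex x y); last by rewrite /x /y; case: (z).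
by congr Complex; field; rewrite ?gt_eqF.
Qed.

Lemma clog_cont (R : realType) (z : CC R) : 0 < Re z -> {for z, continuous (@clog R)}.
Proof.
move=> x0; have n0 : 0 < nm z by exact: lt_le_trans x0 (Re_le_nm z).
apply: (@continuous_comp _ _ _ (fun z : CC R => (ln (nm z), atan (Im z / Re z)))
  (fun q : R * R => (Complex q.1 q.2 : CC R))); last exact: continuous_Complex.
have c1 : (fun z : CC R => ln (nm z)) @ z --> ln (nm z).
  apply: (@continuous_comp _ _ _ (@nm R) (@ln R)); first exact: continuous_nm.
  exact: continuous_ln.
have c2 : (fun z : CC R => Im z / Re z) @ z --> Im z / Re z.
  have cI : (fun z : CC R => Im z) @ z --> Im z by exact: continuous_Im.
  have cR : (fun z : CC R => Re z) @ z --> Re z by exact: continuous_Re.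
  exact: (cvgM cI (cvgV (lt0r_neq0 x0) cR)).
have c3 : (fun z : CC R => atan (Im z / Re z)) @ z --> atan (Im z / Re z).
  apply: (@continuous_comp _ _ _ (fun z : CC R => Im z / Re z) (@atan R)) => //.
  exact: continuous_atan.
exact: (cvg_pair c1 c3).
Qed.

(** [clog] is a continuous right inverse of the exponential, so the linear approximation of the
    latter can be inverted. The bound [m / 4] on [e1] gives [m / 2 * nm D <= nm (z - z0)]; the bound
    [e * m^2 / 4] makes the final error at most [e]. *)
Lemma derivable_clog (R : realType) (z0 : CC R) : 0 < Re z0 -> derivable (@clog R) z0 1.
Proof.
move=> x0; have m0 : 0 < nm z0 by exact: lt_le_trans x0 (Re_le_nm z0).
have z00 : z0 != 0 by rewrite -nm_gt0.
apply: (@approx_derivableC _ _ _ z0^-1) => e e0.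
set m := nm z0 in m0; pose e1 := Num.min (m / 4) (e * m ^+ 2 / 4).
have e10 : 0 < e1 by rewrite lt_min !divr_gt0 // mulr_gt0 // exprn_gt0.
have e1m : e1 <= m / 4 by rewrite ge_min lexx.
have e1e : e1 <= e * m ^+ 2 / 4 by rewrite ge_min lexx orbT.
clearbody e1.
have := lin_at_exp 0 (ln (nm z0)) (atan (Im z0 / Re z0)) e10.
rewrite clogK // subr0 => -[d d0 hd].
have [d1 d10 hd1] := (contCP _ _).1 (clog_cont x0) d d0.
have [d2 d20 hd2] := (contCRP _ _).1 (continuous_Re (z := z0)) _ x0.
exists (Num.min d1 d2); first by rewrite lt_min d10.
move=> z; rewrite lt_min => /andP[/hd1 z1 /hd2 z2].
have x1 : 0 < Re z.
  by move: z2; rewrite ltr_norml => /andP[]; lra.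
have := hd (ln (nm z)) (atan (Im z / Re z)).
have Rez : `|ln (nm z) - ln (nm z0)| <= nm (clog z - clog z0).
  by have := normr_Re_le (clog z - clog z0); rewrite ReB.
have Imz : `|atan (Im z / Re z) - atan (Im z0 / Re z0)| <= nm (clog z - clog z0).
  by have := normr_Im_le (clog z - clog z0); rewrite ImB.
move=> /(_ (le_lt_trans Rez z1) (le_lt_trans Imz z1)); rewrite clogK //.
have -> : (Complex (ln (nm z) - ln (nm z0))
   (atan (Im z / Re z) - atan (Im z0 / Re z0)) : CC R) = clog z - clog z0 by [].
set D := clog z - clog z0 in Rez Imz *.
move=> H; have {}H : nm (z - z0 - z0 * D) <= 2 * e1 * nm D.
  apply: le_trans H _; rewrite [2 * e1]mulrC -mulrA ler_pM2l // mulr_natl mulr2n.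
  exact: lerD.
have D0 := nm_ge0 D.
have DB : m / 2 * nm D <= nm (z - z0).
  have := nm_leD (z0 * D) (z - z0); rewrite nmM -/m nm_distC.
  have : 2 * e1 * nm D <= m / 2 * nm D by rewrite ler_wpM2r //; lra.
  by lra.
have -> : D - z0^-1 * (z - z0) = - (z0^-1 * (z - z0 - z0 * D)).
  by field.
rewrite nmN nmM nmV -/m ler_pdivrMl //.
apply: le_trans H _; rewrite mulrA.
apply: (@le_trans _ _ (e * m * (m / 2 * nm D))); last first.
  by rewrite [m * e]mulrC ler_pM2l // mulr_gt0.
rewrite !mulrA ler_wpM2r //.
have -> : e * m * m / 2 = 2 * (e * m ^+ 2 / 4) by field.
by rewrite ler_pM2l.
Qed.

Lemma derivable_compC (R : realType) (g h : CC R -> CC R) (z : CC R) :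
  derivable h z 1 -> derivable g (h z) 1 -> derivable (g \o h) z 1.
Proof.
move=> /derivable1_diffP dh /derivable1_diffP dg; apply/derivable1_diffP.
exact (differentiable_comp dh dg).
Qed.

(** Dividing by [phi a] moves the values near 1, into the half-plane where [clog] is holomorphic;
    the division costs only an additive constant. *)
Lemma harm_at_ln (R : realType) (phi : CC R -> CC R) (a : CC R) (r : R) :
  0 < r -> (forall z, nm (z - a) < r -> derivable phi z 1) -> phi a != 0 ->
  harm_at (fun z => ln (nm (phi z))) a.
Proof.
move=> r0 dphi pa0; pose psi z := (phi a)^-1 * phi z.
have dpsi z : nm (z - a) < r -> derivable psi z 1.
  by move=> /dphi h; apply: (derivableZ (k := (phi a)^-1) h).
have psia : psi a = 1 by rewrite /psi mulVf.
have ca : {for a, continuous psi}.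
  by apply/derivable_continuousC/dpsi; rewrite subrr nm0.
have [d d0 hd] := (contCP _ _).1 ca (1 / 2) ltac:(by rewrite divr_gt0).
have Rep z : nm (z - a) < d -> 0 < Re (psi z).
  move=> /hd h; have := le_lt_trans (normr_Re_le _) h.
  by rewrite ReB psia /= ltr_norml => /andP[]; lra.
pose rr := Num.min r d; have rr0 : 0 < rr by rewrite lt_min r0.
have hh : harm_at (fun z => Re (clog (psi z))) a.
  apply: (@harm_at_Re _ (fun z => clog (psi z)) a rr rr0).
    apply: (@continuous_comp _ _ _ psi (@clog R)); first exact: ca.
    by apply: clog_cont; apply: Rep; rewrite subrr nm0.
  move=> z /andP[_]; rewrite lt_min => /andP[z1 z2].
  apply: (@derivable_compC _ (@clog R) psi); first exact: dpsi.
  exact/derivable_clog/Rep.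
apply: (@harm_at_near _ (fun z => Re (clog (psi z)) + ln (nm (phi a))) _ a d d0).
  move=> z /Rep; rewrite /psi => pz /=; rewrite nmM nmV.
  have pz0 : 0 < nm (phi z).
    rewrite nm_gt0; apply/eqP => pz0.
    by move: pz; rewrite pz0 mulr0 /= ltxx.
  have pa : 0 < nm (phi a) by rewrite nm_gt0.
  by rewrite mulrC ln_div ?posrE // subrK.
exact: (harm_atD hh (harm_at_cst _ _)).
Qed.

Lemma derivable_quotC (R : realType) (g : CC R -> CC R) (z l w : CC R) :
  w != z -> derivable g w 1 ->
  derivable (fun w => if w == z then l else (g w - g z) / (w - z)) w 1.
Proof.
move=> wz dg.
have d1 : derivable (fun w => (g w - g z) / (w - z)) w 1.
  apply: (@derivableM _ _ (fun w => g w - g z) (fun w => (w - z)^-1)).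
    have h2 : derivable (fun _ : CC R => g z) w 1 by exact: derivable_cst.
    exact: (derivableB dg h2).
  apply: (@derivableV _ _ (fun w => w - z)); first by rewrite subr_eq0.
  have h1 : derivable (fun w : CC R => w) w 1 by exact: derivable_id.
  have h2 : derivable (fun _ : CC R => z) w 1 by exact: derivable_cst.
  exact: (derivableB h1 h2).
apply: near_eq_derivable d1.
apply/nbhsCP; exists (nm (w - z)); first by rewrite nm_gt0 subr_eq0.
move=> y yw /=; case: eqP => // yz; move: yw.
by rewrite yz nm_distC ltxx.
Qed.

Lemma closure_cdisk_sub (R : realType) (p : CC R) (r : R) (z : CC R) :
  closure [set w | nm (w - p) < r] z -> nm (z - p) <= r.
Proof.
move=> /closureCP h; rewrite leNgt; apply/negP => rz.
have [w /= wr wz] := h (nm (z - p) - r) ltac:(by rewrite subr_gt0).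
by have := nm_dist_tri w z p; rewrite (nm_distC z w); lra.
Qed.

Lemma open_cdisk (R : realType) (p : CC R) (r : R) : open [set w | nm (w - p) < r].
Proof.
apply/openCP => z /= zr; exists (r - nm (z - p)); first by rewrite subr_gt0.
by move=> w wz; have := nm_dist_tri z w p; lra.
Qed.

(** The maximum principle is applied to the difference quotient [q] of [g] at [z], whose singularity
    is removable. On the circle of radius [r / 2] the numerator is at most [2 * M] and the
    denominator at least [r / 4]. *)
Lemma cauchy_lipschitz (R : realType) (g : CC R -> CC R) (p : CC R) (r M : R) :
  0 < r -> (forall z, nm (z - p) < r -> derivable g z 1) ->
  (forall z, nm (z - p) < r -> nm (g z) <= M) ->
  forall z z', nm (z - p) < r / 4 -> nm (z' - p) < r / 4 ->
    nm (g z' - g z) <= 8 * M / r * nm (z' - z).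
Proof.
move=> r0 dg gM z z' zp z'p.
have zr : nm (z - p) < r by lra.
have [l hl] := derivable_approxC (dg z zr).
pose q (w : CC R) : CC R := if w == z then l else (g w - g z) / (w - z).
have dq (w : CC R) : w != z -> nm (w - p) < r -> derivable q w 1.
  by move=> wz wr; apply: derivable_quotC => //; exact: dg.
have cq (w : CC R) : nm (w - p) < r -> {for w, continuous q}.
  move=> wr; have [->|wz] := eqVneq w z; last exact/derivable_continuousC/dq.
  apply/contCP => e e0; have [|d d0 hd] := hl (e / 2); first by rewrite divr_gt0.
  exists d => // y yz; rewrite /q eqxx; case: eqP => [|/eqP yz0].
    by rewrite subrr nm0.
  have y0 : y - z != 0 by rewrite subr_eq0.
  have -> : (g y - g z) / (y - z) - l = (g y - g z - l * (y - z)) / (y - z).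
    by field.
  rewrite nmM nmV; apply: (@le_lt_trans _ _ (e / 2)); last by lra.
  by rewrite ler_pdivrMr ?nm_gt0 //; exact: hd.
have [->|z'z] := eqVneq z' z; first by rewrite !subrr nm0 mulr0.
have z'z0 : 0 < nm (z' - z) by rewrite nm_gt0 subr_eq0.
suff : nm (q z') <= 8 * M / r.
  by rewrite /q (negPf z'z) nmM nmV ler_pdivrMr.
have [q0|q0] := eqVneq (q z') 0.
  have : 0 <= M by apply: le_trans (nm_ge0 _) (gM _ zr).
  by rewrite q0 nm0 => M0; rewrite divr_ge0 ?mulr_ge0 // ltW.
(* A rotation that makes [q z'] real and positive, so that its modulus is the value of a harmonic
   function. *)
pose lam : CC R := (nm (q z'))%:C / q z'.
have nq : 0 < nm (q z') by rewrite nm_gt0.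
have lam1 : nm lam = 1.
  by rewrite nmM nmV nmR ger0_norm ?nm_ge0 // divff // gt_eqF.
have -> : nm (q z') = Re (lam * q z') by rewrite /lam mulfVK.
pose O := [set w : CC R | nm (w - p) < r / 2].
have r4 : 0 < r / 4 by rewrite divr_gt0.
have clO w : closure O w -> nm (w - p) <= r / 2 by exact: closure_cdisk_sub.
have dlq (w : CC R) : w != z -> nm (w - p) < r -> derivable (fun w : CC R => lam * q w) w 1.
  by move=> wz wr; apply: (derivableZ (k := lam)); exact: dq.
have clq (w : CC R) : nm (w - p) < r -> {for w, continuous (fun w : CC R => lam * q w)}.
  move=> wr; apply/contCP => e e0; have [d d0 hd] := (contCP q w).1 (cq w wr) e e0.
  by exists d => // y /hd; rewrite -mulrBr nmM lam1 mul1r.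
apply: (@max_principle R (fun w : CC R => Re (lam * q w)) O (nm p + r)); last first.
- by rewrite /O /=; lra.
- move=> w /clO wr Ow; have {}wr : nm (w - p) = r / 2.
    by apply/eqP; rewrite eq_le wr /= leNgt; exact/negP.
  apply: le_trans (Re_le_nm _) _; rewrite nmM lam1 mul1r.
  have wz : w != z.
    by apply: contraPneq zp => <-; rewrite wr; lra.
  rewrite /q (negPf wz) nmM nmV.
  have wzr : r / 4 <= nm (w - z).
    by have := nm_dist_tri z w p; lra.
  rewrite ler_pdivrMr; last by apply: lt_le_trans wzr.
  apply: (@le_trans _ _ (2 * M)).
    apply: le_trans (nmD _ _) _; rewrite nmN mulr_natl mulr2n.
    by apply: lerD; apply: gM; lra.
  have -> : 2 * M = 8 * M / r * (r / 4) by field; rewrite gt_eqF.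
  apply: ler_wpM2l => //; rewrite divr_ge0 ?(ltW r0) // mulr_ge0 //.
  exact: le_trans (nm_ge0 _) (gM _ zr).
- move=> w /= Ow.
  have wr : nm (w - p) < r by rewrite /O /= in Ow; lra.
  (* The punctured disk about [w] must avoid [z], where [q] is only known to be continuous; if
     [w = z], the puncture itself does so. *)
  pose rr := if w == z then r - nm (w - p) else Num.min (nm (w - z)) (r - nm (w - p)).
  have rr0 : 0 < rr.
    rewrite /rr; case: eqP => [_|/eqP wz]; first by rewrite subr_gt0.
    by rewrite lt_min nm_gt0 subr_eq0 wz subr_gt0.
  apply: (@harm_at_Re _ (fun w : CC R => lam * q w) _ rr rr0 (clq _ wr)).
  move=> y /andP[y0 yr].
  have yr' : nm (y - w) < r - nm (w - p).
    by apply: lt_le_trans yr _; rewrite /rr; case: eqP => // _; rewrite ge_min lexx orbT.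
  apply: dlq; last by have := nm_dist_tri w y p; lra.
  apply/eqP => yz; move: y0 yr; rewrite /rr yz.
  case: eqP => [->|_]; first by rewrite subrr nm0 ltxx.
  by rewrite lt_min (nm_distC z w) ltxx.
- move=> w /clO wr.
  apply: (@continuous_comp _ _ _ (fun w : CC R => lam * q w) (fun x : CC R => Re x)).
    by apply: clq; lra.
  exact: continuous_Re.
- by move=> w /= Ow; have := nm_leD w p; rewrite /O /= in Ow; lra.
- exact: open_cdisk.
Qed.

(** * Discrete logarithmic potentials *)

Lemma ln2_le1 (R : realType) : ln (2 : R) <= 1.
Proof. by have := @le_ln1Dx R 1 ltac:(lra). Qed.

Lemma ln2_ge (R : realType) : 1 / 2 <= ln (2 : R).
Proof.
have := @le_ln1Dx R (- (1 / 2)) ltac:(lra).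
have -> : 1 + - (1 / 2) = (2 : R)^-1 by field.
by rewrite lnV ?posrE //; lra.
Qed.

(** The weak form of Stirling's formula for [ln n!], by induction from [n * ln (1 + 1/n) <= 1]. *)
Lemma sum_ln_lower (R : realType) (n : nat) :
  n%:R * ln n%:R - n%:R <= \sum_(m < n) ln (m.+1%:R : R).
Proof.
elim: n => [|n IH]; first by rewrite big_ord0 mul0r subr0.
rewrite big_ord_recr /=; apply: le_trans (lerD IH (lexx _)).
have [->|n0] := posnP n.
  by rewrite !mul0r ln1; lra.
have n0' : (0 : R) < n%:R by rewrite ltr0n.
have : n%:R * (ln n.+1%:R - ln n%:R) <= 1 :> R.
  rewrite -ln_div ?posrE ?ltr0n // mulrC -ler_pdivlMr // div1r.
  have -> : n.+1%:R / n%:R = 1 + n%:R^-1 :> R.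
    by rewrite -natr1; field; rewrite gt_eqF.
  by apply: le_ln1Dx; rewrite (lt_trans _ (_ : 0 < _)) ?invr_gt0 // ltrN10.
by rewrite -natr1; lra.
Qed.

(** With truncated subtraction the argument of [F] is [|i - j|]. Each distance occurs for at most
    two [i], and since [F <= 0] the missing occurrences only lower the left side. *)
Lemma sum_dist_lower (R : realType) (F : nat -> R) (N j : nat) : (j < N)%N ->
  F 0%N = 0 -> (forall m, (m < N)%N -> F m <= 0) ->
  2 * \sum_(m < N) F m <= \sum_(i < N) F ((i - j) + (j - i))%N.
Proof.
move=> jN F0 Fle.
have part n : (n <= N)%N -> \sum_(0 <= m < N) F m <= \sum_(0 <= m < n) F m.
  move=> nN; rewrite (big_cat_nat (n := n)) //= gerDl big_nat_cond.
  by apply: sumr_le0 => m; rewrite andbT => /andP[_]; exact: Fle.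
rewrite -(big_mkord xpredT F) -(big_mkord xpredT (fun i => F ((i - j) + (j - i))%N)).
rewrite [leRHS](big_cat_nat (n := j)) //=; last exact: ltnW.
rewrite mulr_natl mulr2n; apply: lerD.
  rewrite [leRHS]big_nat_rev /= [leRHS](eq_big_nat _ _ (F2 := fun i => F i.+1)); last first.
    by move=> i /andP[_ ij]; congr F; lia.
  apply: le_trans (part j.+1 jN) _.
  by rewrite big_nat_recl //= F0 add0r.
rewrite [leRHS](_ : _ = \sum_(0 + j <= i < N) F (i - j + (j - i))%N) ?add0n //.
rewrite -{1}[j]add0n big_addn [leRHS](eq_big_nat _ _ (F2 := F)); last first.
  by move=> i _; congr F; lia.
by apply: part; rewrite leq_subr.
Qed.

Definition pot (R : realType) (N : nat) (k : nat -> CC R) (w : CC R) : R :=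
  N%:R^-1 * \sum_(i < N) ln (nm (w - k i)).

Lemma pot_le (R : realType) (N : nat) (k : nat -> CC R) (w : CC R) (T : R) :
  (0 < N)%N -> (forall i, (i < N)%N -> 0 < nm (w - k i) <= T) -> pot N k w <= ln T.
Proof.
move=> N0 h; have N0' : (0 : R) < N%:R by rewrite ltr0n.
rewrite /pot ler_pdivrMl // mulr_natl -[X in _ *+ X](card_ord N) -sumr_const.
apply: ler_sum => i _; have /andP[h1 h2] := h i (ltn_ord i).
by rewrite ler_ln ?posrE //; exact: lt_le_trans h2.
Qed.

Lemma pot_ge (R : realType) (N : nat) (k : nat -> CC R) (w : CC R) (T : R) :
  (0 < N)%N -> 0 < T -> (forall i, (i < N)%N -> T <= nm (w - k i)) -> ln T <= pot N k w.
Proof.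
move=> N0 T0 h; have N0' : (0 : R) < N%:R by rewrite ltr0n.
rewrite /pot ler_pdivlMl // mulr_natl -[X in _ *+ X](card_ord N) -sumr_const.
apply: ler_sum => i _; have h1 := h i (ltn_ord i).
by rewrite ler_ln ?posrE //; exact: lt_le_trans h1.
Qed.

(* A point at distance x from c is at distance at least |x - |k i - c|| from
   k i, so the average is controlled by the radii alone, except for the nearest
   radius, whose term is damped by the factor 1/N. *)
Lemma pot_lower (R : realType) (S delta : R) : 0 < S -> 0 < delta ->
  exists2 N : nat, (0 < N)%N & forall (c : CC R) (k : nat -> CC R),
    (forall i, (i < N)%N -> nm (k i - c) = S * (1 + i.+1%:R / N%:R)) ->
    forall w, (forall i, (i < N)%N -> delta <= nm (w - k i)) ->
    ln S - 4 <= pot N k w.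
Proof.
move=> S0 d0; pose T := `|ln (delta / S)|.
(* The nearest pole can contribute as little as [ln S - T]; with [N >= T] and weight [1/N] this
   costs at most 1. *)
exists (Num.truncn T).+1 => // c k hk w hw; set N := _.+1 in hk hw *.
have TN : T <= N%:R by exact/ltW/truncnS_gt.
have N0 : (0 : R) < N%:R by rewrite ltr0n.
have dS0 : 0 < delta / S by rewrite divr_gt0.
pose x := nm (w - c) / S; pose s (i : nat) : R := 1 + i.+1%:R / N%:R.
have xs i : (i < N)%N -> `|x - s i| <= nm (w - k i) / S.
  move=> iN; rewrite ler_pdivlMr // -[X in _ * X <= _](gtr0_norm S0) -normrM.
  rewrite mulrBl /x mulfVK ?gt_eqF //.
  rewrite /s [_ * S]mulrC -hk // ler_norml.
  have := nm_dist_tri (k i) w c; have := nm_dist_tri w (k i) c.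
  by rewrite (nm_distC (k i) w) => ? ?; apply/andP; split; lra.
have [j _ jmin] : exists2 j : 'I_N, true & forall i : 'I_N, `|x - s j| <= `|x - s i|.
  case: (arg_minP (fun i : 'I_N => `|x - s i|) (i0 := ord0) (P := xpredT)) => // j _ h.
  by exists j => // i; exact: h.
pose F (m : nat) : R := if m == 0%N then 0 else ln m%:R - ln N%:R.
have Fle m : (m < N)%N -> F m <= 0.
  rewrite /F; case: eqP => // /eqP m0 mN; rewrite subr_le0 ler_ln ?posrE ?ltr0n ?lt0n //.
  by rewrite ler_nat ltnW.
have Fsum : - N%:R <= \sum_(m < N) F m.
  rewrite /N big_ord_recl {1}/F eqxx add0r.
  rewrite (eq_bigr (fun m : 'I__ => ln m.+1%:R - ln N%:R)); last first.
    by move=> m _; rewrite /F /bump.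
  rewrite big_split /= sumr_const card_ord -[X in _ + X]mulr_natl.
  have := sum_ln_lower R N; rewrite /N big_ord_recr /= -/N.
  move: (ln N%:R) (\sum_(i < _) _) => L Sg.
  have -> : N%:R = (Num.truncn T)%:R + 1 :> R by rewrite natr1.
  by lra.
(* Since [j] is nearest, [|s i - s j| <= 2 * |x - s i|], whence [ln 2]. Averaging gives the 4: a
   loss of 1 from [T], 2 from the two-sided sum of [F], and at most 1 from [ln 2]. *)
have term (i : 'I_N) : ln S + (if i == j then - T else 0) + F ((i - j) + (j - i))%N - ln 2
    <= ln (nm (w - k i)).
  have wk0 : 0 < nm (w - k i) by apply: lt_le_trans d0 (hw i (ltn_ord i)).
  have -> : nm (w - k i) = S * (nm (w - k i) / S) by field; rewrite gt_eqF.
  have wkS : 0 < nm (w - k i) / S by rewrite divr_gt0.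
  rewrite lnM ?posrE // -!addrA lerD2l.
  have [->|ij] := eqVneq i j.
    rewrite subnn addn0 /F eqxx add0r.
    have : - T <= ln (delta / S) by rewrite lerNl /T -normrN; exact: ler_norm.
    have : ln (delta / S) <= ln (nm (w - k j) / S).
      rewrite ler_ln ?posrE ?divr_gt0 //; last by apply: lt_le_trans d0 (hw j (ltn_ord j)).
      by rewrite ler_pM2r ?invr_gt0 // hw.
    by have := ln2_ge R; lra.
  rewrite add0r.
  have ij' : (0 < (i - j) + (j - i))%N.
    by move: ij; rewrite -val_eqE /= neq_ltn; lia.
  rewrite /F gtn_eqF // -!ln_div ?posrE ?divr_gt0 ?ltr0n // ler_ln ?posrE ?divr_gt0 ?ltr0n //.
  apply: le_trans (xs i (ltn_ord i)).
  have sij : `|s i - s j| = ((i - j) + (j - i))%:R / N%:R.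
    rewrite /s opprD addrACA subrr add0r -mulrBl normrM [`|N%:R^-1|]gtr0_norm ?invr_gt0 //.
    congr (_ * _); have -> : i.+1%:R - j.+1%:R = i%:R - j%:R :> R.
      by rewrite -!natr1; ring.
    have [ji|ij2] := leqP j i.
      rewrite (_ : (i - j + (j - i) = i - j)%N); last by lia.
      by rewrite natrB // ger0_norm // subr_ge0 ler_nat.
    rewrite (_ : (i - j + (j - i) = j - i)%N); last by lia.
    by rewrite distrC natrB ?(ltnW ij2) // ger0_norm // subr_ge0 ler_nat ltnW.
  have := jmin i; have := ler_distD x (s i) (s j).
  by rewrite sij (distrC (s i) x); move: (_ / N%:R) => q; lra.
rewrite /pot ler_pdivlMl //.
have := ler_sum (index_enum _) (fun (i : 'I_N) (_ : true) => term i).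
rewrite !big_split /= !sumr_const !card_ord.
have -> : \sum_(i < N) (if i == j then - T else 0) = - T.
  by rewrite -big_mkcond /= big_pred1_eq.
have := sum_dist_lower (ltn_ord j) (erefl (F 0%N)) Fle.
rewrite -(mulr_natl (ln S)) -(mulr_natl (- ln 2)).
have : N%:R * ln 2 <= N%:R * 1 :> R by rewrite ler_pM2l // ln2_le1.
by lra.
Qed.

(** * Harnack's inequality and potentials with poles in a connected set *)

Lemma contCR_D (R : realType) (u v : CC R -> R) (z : CC R) :
  {for z, continuous u} -> {for z, continuous v} ->
  {for z, continuous (fun w => u w + v w)}.
Proof. by move=> cu cv; exact: (cvgD cu cv). Qed.

Lemma contCR_cst (R : realType) (k : R) (z : CC R) :
  {for z, continuous (fun _ : CC R => k)}.
Proof. by apply/contCRP => e e0; exists 1 => // w _; rewrite subrr normr0. Qed.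

Lemma contCR_Z (R : realType) (k : R) (u : CC R -> R) (z : CC R) :
  {for z, continuous u} -> {for z, continuous (fun w => k * u w)}.
Proof. by move=> cu; exact: (cvgM (@contCR_cst R k z) cu). Qed.

Lemma contCR_sum (R : realType) (N : nat) (u : nat -> CC R -> R) (z : CC R) :
  (forall i, (i < N)%N -> {for z, continuous (u i)}) ->
  {for z, continuous (fun w => \sum_(i < N) u i w)}.
Proof.
elim: N => [|N IH] h.
  have -> : (fun w => \sum_(i < 0) u i w) = (fun=> 0).
    by apply/funext => w; rewrite big_ord0.
  exact: contCR_cst.
have -> : (fun w => \sum_(i < N.+1) u i w) = (fun w => \sum_(i < N) u i w + u N w).
  by apply/funext => w; rewrite big_ord_recr.
by apply: contCR_D; [apply: IH => i iN; exact/h/ltnW | exact: h].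
Qed.

Lemma cont_ln_sub (R : realType) (g : CC R -> CC R) (k a : CC R) :
  {for a, continuous g} -> g a != k ->
  {for a, continuous (fun z => ln (nm (g z - k)))}.
Proof.
move=> cg gk.
apply: (@continuous_comp _ _ _ (fun z => nm (g z - k)) (@ln R)); last first.
  by apply: continuous_ln; rewrite nm_gt0 subr_eq0.
apply: (@continuous_comp _ _ _ (fun z => g z - k) (@nm R)); last exact: continuous_nm.
apply/contCP => e e0; have [d d0 hd] := (contCP g a).1 cg e e0.
exists d => // w /hd.
by have -> : g w - k - (g a - k) = g w - g a by ring.
Qed.

Lemma harm_ln_sub (R : realType) (g : CC R -> CC R) (k a : CC R) (r : R) :
  0 < r -> (forall z, nm (z - a) < r -> derivable g z 1) -> g a != k ->
  harm_at (fun z => ln (nm (g z - k))) a.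
Proof.
move=> r0 dg gk; apply: (@harm_at_ln _ (fun z => g z - k) a r r0); last by rewrite subr_eq0.
move=> z /dg dz.
have h2 : derivable (fun _ : CC R => k) z 1 by exact: derivable_cst.
exact: (derivableB dz h2).
Qed.

Lemma pot_cont (R : realType) (g : CC R -> CC R) (N : nat) (k : nat -> CC R) (a : CC R) :
  {for a, continuous g} -> (forall i, (i < N)%N -> g a != k i) ->
  {for a, continuous (fun z => pot N k (g z))}.
Proof.
move=> cg gk; apply: contCR_Z; apply: (@contCR_sum _ N (fun i z => ln (nm (g z - k i)))).
by move=> i iN; exact: (cont_ln_sub cg (gk i iN)).
Qed.

Lemma pot_harm (R : realType) (g : CC R -> CC R) (N : nat) (k : nat -> CC R)
    (a : CC R) (r : R) :
  0 < r -> (forall z, nm (z - a) < r -> derivable g z 1) ->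
  (forall i, (i < N)%N -> g a != k i) ->
  harm_at (fun z => pot N k (g z)) a.
Proof.
move=> r0 dg gk; apply: harm_atZ; apply: (@harm_at_sum _ N (fun i z => ln (nm (g z - k i)))).
by move=> i iN; exact: (harm_ln_sub r0 dg (gk i iN)).
Qed.

Lemma compact_unif_cont (R : realType) (u : CC R -> R) (K : set (CC R)) (e : R) :
  compact K -> (forall z, K z -> {for z, continuous u}) -> 0 < e ->
  exists2 d : R, 0 < d & forall z w, K z -> K w -> nm (w - z) < d -> `|u w - u z| < e.
Proof.
move=> cK cu e0; apply: contrapT => no.
have sel n : exists p : CC R * CC R,
    [/\ K p.1, K p.2, nm (p.2 - p.1) < n.+1%:R^-1 & e <= `|u p.2 - u p.1|].
  apply: contrapT => /forallNP no'; apply: no.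
  exists (n.+1%:R^-1); first by rewrite invr_gt0 ltr0n.
  move=> z w Kz Kw zw; rewrite ltNge; apply/negP => h.
  by apply: (no' (z, w)).
have [s hs] := choice sel.
have sK n : K (s n).1 by have [] := hs n.
have [p Kp hp] := compact_seq_cluster cK sK.
have [d d0 hd] := (contCRP u p).1 (cu p Kp) (e / 2) ltac:(by rewrite divr_gt0).
have [n0 hn0] : exists n : nat, 2 / d < n%:R.
  by exists (Num.truncn (2 / d)).+1; exact: truncnS_gt.
have nb : nbhs p [set w : CC R | nm (w - p) < d / 2].
  by apply/nbhsCP; exists (d / 2) => //; rewrite divr_gt0.
have [n nn0 /= sp] := hp _ nb n0.
have [_ _ h1 h2] := hs n.
have hn : (n.+1%:R)^-1 < d / 2.
  rewrite -[ltRHS]invf_div ltf_pV2 ?posrE ?ltr0n ?divr_gt0 //.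
  by apply: lt_le_trans hn0 _; rewrite ler_nat ltnW.
have {h1 hn}h1 := lt_trans h1 hn.
have a1 := hd (s n).1 ltac:(by lra).
have a2 : `|u (s n).2 - u p| < e / 2.
  by apply: hd; have := nm_dist_tri (s n).1 (s n).2 p; lra.
have := ler_distD (u p) (u (s n).2) (u (s n).1).
by rewrite (distrC (u p)); lra.
Qed.

(* The maximum principle on circles produces poles k i at which u is at least
   u z; below half that level u dominates a multiple of their potential. *)
Lemma harnack (R : realType) (u : CC R -> R) (p : CC R) (r : R) : 0 < r ->
  (forall z, nm (z - p) < r -> {for z, continuous u}) ->
  (forall z, nm (z - p) < r -> harm_at u z) ->
  (forall z, nm (z - p) < r -> 0 <= u z) ->
  forall z, nm (z - p) <= r / 8 -> u z <= 20 * u p.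
Proof.
move=> r0 cu hu u0 z1 z1p; set A := u z1.
have up0 : 0 <= u p by apply: u0; rewrite subrr nm0.
have [A0|A0] := leP A 0; first by apply: le_trans A0 _; rewrite mulr_ge0.
have [Ap|Ap] := leP (A / 2) (u p); first by lra.
have pole (s : R) : r / 8 < s <= r / 4 -> exists2 k : CC R, nm (k - p) = s & A <= u k.
  move=> /andP[s1 s2].
  have s0 : 0 < s by lra.
  have cC : compact [set z : CC R | nm (z - p) = s].
    apply: (subclosed_compact _ (@compact_cdisc R p s)); last by move=> z /= ->.
    apply/closedCP => z h; apply/eqP; rewrite -subr_eq0 -normr_le0.
    apply/ler_addgt0Pl => e e0; rewrite addr0.
    have [w /= <- wz] := h e e0.
    rewrite ler_norml; have := nm_dist_tri w z p; have := nm_dist_tri z w p.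
    by rewrite (nm_distC z w) => ? ?; apply/andP; split; lra.
  have [||k kC kmax] := @compact_EVT_max _ _ u _ _ cC.
  - by exists (circ p s 0); rewrite /= nm_circ // ltW.
  - apply: continuous_in_subspaceT => z /set_mem /= zs; apply: cu.
    by rewrite zs; lra.
  have {}kC : nm (k - p) = s by exact: (set_mem kC).
  exists k => //; pose O := [set z : CC R | nm (z - p) < s].
  have clO z : closure O z -> nm (z - p) <= s by exact: closure_cdisk_sub.
  apply: (@max_principle R u O (nm p + r)); last by rewrite /O /=; lra.
  - exact: open_cdisk.
  - by move=> z /= zs; have := nm_leD z p; rewrite /O /= in zs; lra.
  - by move=> z /clO zs; apply: cu; lra.
  - by move=> z; rewrite /O /= => zs; apply: hu; lra.
  - move=> z /clO zs nO; apply: kmax; rewrite inE /=.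
    by apply/eqP; rewrite eq_le zs /= leNgt; exact/negP.
pose K := [set z : CC R | nm (z - p) <= 3 * r / 4].
have cK : compact K by exact: compact_cdisc.
have A20 : 0 < A / 2 by rewrite divr_gt0.
(* Uniform continuity keeps every point of [K] with [u <= A / 2] at distance [delta] from the poles,
   where [u >= A]; [delta] is known before the poles are chosen, as [pot_lower] requires. *)
have [delta d0 hd] := @compact_unif_cont R u K (A / 2) cK
  (fun z (Kz : K z) => cu z ltac:(rewrite /K /= in Kz; lra)) A20.
have S0 : 0 < r / 8 by rewrite divr_gt0.
have [N N0 hN] := pot_lower S0 d0.
have N0' : (0 : R) < N%:R by rewrite ltr0n.
have [k hk] : {k : nat -> CC R & forall i, (i < N)%N ->
    nm (k i - p) = r / 8 * (1 + i.+1%:R / N%:R) /\ A <= u (k i)}.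
  apply: (choice (P := fun i k => (i < N)%N ->
    nm (k - p) = r / 8 * (1 + i.+1%:R / N%:R) /\ A <= u k)) => i.
  have [iN|iN] := boolP (i < N)%N; last by exists 0.
  have h1 : 0 < i.+1%:R / N%:R :> R by rewrite divr_gt0 // ltr0n.
  have h2 : i.+1%:R / N%:R <= 1 :> R by rewrite ler_pdivrMr // mul1r ler_nat.
  have [|k k1 k2] := pole (r / 8 * (1 + i.+1%:R / N%:R)); last by exists k.
  apply/andP; split; first by rewrite ltr_pMr // ltrDl.
  by rewrite (_ : r / 4 = r / 8 * (1 + 1)); [rewrite ler_pM2l // lerD2l | field].
have kr i : (i < N)%N -> r / 8 <= nm (k i - p) <= r / 4.
  move=> iN; have [-> _] := hk i iN.
  have h1 : 0 < i.+1%:R / N%:R :> R by rewrite divr_gt0 // ltr0n.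
  have h2 : i.+1%:R / N%:R <= 1 :> R by rewrite ler_pdivrMr // mul1r ler_nat.
  apply/andP; split; first by rewrite ler_pMr // lerDl ltW.
  by rewrite (_ : r / 4 = r / 8 * (1 + 1)); [rewrite ler_pM2l // lerD2l | field].
have far z : nm (z - p) <= 3 * r / 4 -> u z <= A / 2 ->
    forall i, (i < N)%N -> delta <= nm (z - k i).
  move=> zr uz i iN; rewrite leNgt; apply/negP => zk.
  have /andP[_ k4] := kr i iN; have [_ Ak] := hk i iN.
  have := hd (k i) z ltac:(rewrite /K /=; lra) zr zk.
  by rewrite ltr_norml => /andP[]; lra.
have neq z : nm (z - p) <= 3 * r / 4 -> u z <= A / 2 ->
    forall i, (i < N)%N -> z != k i.
  move=> zr uz i iN; have := far z zr uz i iN.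
  by apply: contraTneq => ->; rewrite subrr nm0 -ltNge.
(* Poles on the scale [r / 8] have potential at least [ln (r / 8) - 4 = ln (r / 2) - C] on the
   region considered. *)
pose C := ln 4 + 4 : R.
have ln4 : ln (4 : R) = 2 * ln 2.
  have -> : (4 : R) = 2 * 2 by ring.
  by rewrite lnM ?posrE //; ring.
have l2 := ln2_ge R; have l2' := ln2_le1 R.
have C0 : 0 < C by rewrite /C ln4; lra.
pose kap := A / 2 / C.
have kap0 : 0 < kap by rewrite divr_gt0.
pose O := [set z : CC R | nm (z - p) < 3 * r / 4 /\ u z < A / 2].
have clO z : closure O z -> nm (z - p) <= 3 * r / 4 /\ u z <= A / 2.
  move=> /closureCP cz.
  have zr : nm (z - p) <= 3 * r / 4.
    apply: closure_cdisk_sub; apply/closureCP => e e0.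
    by have [w [h _] wz] := cz e e0; exists w.
  split=> //; rewrite leNgt; apply/negP => lt.
  have [d' d'0 hd'] := (contCRP u z).1 (cu z ltac:(lra)) (u z - A / 2)
    ltac:(by rewrite subr_gt0).
  have [w [_ w1] /hd'] := cz d' d'0.
  by rewrite ltr_norml => /andP[]; lra.
(* On the circle of radius [3 * r / 4] all poles are at distance at least [r / 2], so the first term
   is nonpositive; where [u = A / 2] it is at most [kap * C = A / 2]. *)
have main : kap * (ln (r / 2) + - 1 * pot N k p) + -1 * u p <= 0.
  apply: (@max_principle R (fun z => kap * (ln (r / 2) + - 1 * pot N k z) + -1 * u z)
    O (nm p + r)).
  - apply/openCP => z [z1' z2].
    have [d1 d10 h1] := (contCRP u z).1 (cu z ltac:(lra)) (A / 2 - u z)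
      ltac:(by rewrite subr_gt0).
    exists (Num.min d1 (3 * r / 4 - nm (z - p))); first by rewrite lt_min d10 subr_gt0.
    move=> w; rewrite lt_min => /andP[/h1 w1 w2]; split.
      by have := nm_dist_tri z w p; lra.
    by move: w1; rewrite ltr_norml => /andP[]; lra.
  - by move=> z [zr _]; have := nm_leD z p; lra.
  - move=> z /clO[zr uz]; apply: contCR_D; last by apply: contCR_Z; apply: cu; lra.
    apply: contCR_Z; apply: contCR_D; first exact: contCR_cst.
    by apply: contCR_Z; apply: (@pot_cont R (fun w : CC R => w)); [exact: cvg_id | exact: neq].
  - move=> z [zr uz]; apply: harm_atD; last by apply: harm_atZ; apply: hu; lra.
    apply: harm_atZ; apply: harm_atD; first exact: harm_at_cst.
    apply: harm_atZ; apply: (@pot_harm R (fun w : CC R => w) N k z 1 ltr01).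
      by move=> w _; exact: derivable_id.
    by apply: neq; exact: ltW.
  - move=> z cz nO; have [zr uz] := clO z cz.
    have [zlt|zge] := ltP (nm (z - p)) (3 * r / 4).
      have uE : u z = A / 2.
        apply/eqP; rewrite eq_le uz /= leNgt; apply/negP => lt; exact: nO.
      have := hN p k (fun i iN => (hk i iN).1) z (far z zr uz).
      have -> : ln (r / 8) = ln (r / 2) - ln 4.
        by rewrite -ln_div ?posrE ?divr_gt0 //; congr ln; field.
      move=> pl; have : kap * (ln (r / 2) + -1 * pot N k z) <= kap * C.
        by rewrite ler_pM2l // /C; lra.
      have -> : kap * C = A / 2 by rewrite /kap mulfVK // gt_eqF.
      by rewrite uE; lra.
    have pl : ln (r / 2) <= pot N k z.
      apply: pot_ge => //; first by rewrite divr_gt0.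
      move=> i iN; have /andP[_ k4] := kr i iN.
      by have := nm_dist_tri (k i) z p; lra.
    have uz0 : 0 <= u z by apply: u0; lra.
    have : kap * (ln (r / 2) + -1 * pot N k z) <= 0.
      by rewrite pmulr_rle0 //; lra.
    by lra.
  - by split; [rewrite subrr nm0; lra | ].
have pp : pot N k p <= ln (r / 4).
  apply: pot_le => // i iN; have /andP[k1 k2] := kr i iN.
  by rewrite nm_distC k2 andbT; lra.
have rr : ln (r / 2) - ln (r / 4) = ln 2.
  by rewrite -ln_div ?posrE ?divr_gt0 //; congr ln; field; rewrite gt_eqF.
have : kap * ln 2 <= u p.
  have : kap * ln 2 <= kap * (ln (r / 2) + - 1 * pot N k p).
    by rewrite ler_pM2l //; lra.
  by lra.
have -> : kap * ln 2 = A * (ln 2 / (2 * C)).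
  by rewrite /kap; field; rewrite gt_eqF.
(* As [C = 2 * ln 2 + 4], the quotient increases with [ln 2], and [ln 2 >= 1/2] already gives
   [1/20]. *)
move=> h; have : 1 / 20 <= ln 2 / (2 * C).
  by rewrite ler_pdivlMr ?mulr_gt0 // /C ln4; lra.
move=> h2; have : A * (1 / 20) <= A * (ln 2 / (2 * C)) by rewrite ler_pM2l.
by lra.
Qed.

Definition unboundedC (R : realType) (Q : set (CC R)) :=
  forall M : R, exists2 z, Q z & M < nm z.

Lemma connected_meets_circle (R : realType) (Q : set (CC R)) (c a b : CC R) (s : R) :
  connected Q -> Q a -> Q b -> nm (a - c) < s -> s < nm (b - c) ->
  exists2 k, Q k & nm (k - c) = s.
Proof.
move=> cQ Qa Qb as_ sb; apply: contrapT => no.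
have QE : Q `&` [set z | nm (z - c) < s] = Q.
  apply: cQ; first by exists a.
  - by exists [set z | nm (z - c) < s] => //; exact: open_cdisk.
  - exists [set z | nm (z - c) <= s]; first exact: closed_cdisc.
    apply/seteqP; split => z [Qz /= zs]; split => //=; first exact: ltW.
    rewrite lt_neqAle zs andbT; apply/eqP => zE; apply: no; by exists z.
have : (Q `&` [set z | nm (z - c) < s]) b by rewrite QE.
by move=> [_ /= h]; move: (lt_trans sb h); rewrite ltxx.
Qed.

(** [Q] meets every circle about [c], but [pot_lower] fixes the number of poles from their distance
    to [K], so one [delta] must serve all radii in [[S, 2S]]. Compactness of this interval and
    openness of [Q] provide it. *)
Lemma escape_pot (R : realType) (Q K : set (CC R)) (c : CC R) (S : R) :
  open Q -> connected Q -> unboundedC Q -> Q c -> 0 < S ->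
  (forall w, K w -> ~ Q w) ->
  exists N k, [/\ (0 < N)%N, forall i, (i < N)%N -> Q (k i),
    forall i, (i < N)%N -> S <= nm (k i - c) <= 2 * S &
    forall w, K w -> ln S - 4 <= pot N k w].
Proof.
move=> oQ cQ uQ Qc S0 KQ.
have hit (s : R) : 0 < s -> exists2 k, Q k & nm (k - c) = s.
  move=> s0; have [b Qb bs] := uQ (s + nm c).
  apply: (connected_meets_circle cQ Qc Qb); first by rewrite subrr nm0.
  by have := nm_leD b c; lra.
have [delta d0 hd] : exists2 delta : R, 0 < delta & forall s : R, S <= s <= 2 * S ->
    exists k, [/\ Q k, nm (k - c) = s & forall w, K w -> delta <= nm (w - k)].
  apply: contrapT => no.
  have sel n : exists s : R, S <= s <= 2 * S /\
      ~ exists k, [/\ Q k, nm (k - c) = s & forall w, K w -> n.+1%:R^-1 <= nm (w - k)].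
    apply: contrapT => /forallNP no'; apply: no.
    exists (n.+1%:R^-1); first by rewrite invr_gt0 ltr0n.
    by move=> s sS; apply: contrapT => h; apply: (no' s).
  have [s hs] := choice sel.
  have sK n : `[S, 2 * S]%classic (s n) by rewrite /= in_itv /=; exact: (hs n).1.
  have [t tS ht] := compact_seq_cluster (@segment_compact R S (2 * S)) sK.
  rewrite /= in_itv /= in tS; have /andP[t1 t2] := tS.
  have t0 : 0 < t by lra.
  have [k Qk kt] := hit t t0.
  have [eta eta0 he] := (openCP Q).1 oQ k Qk.
  have nb : nbhs t [set x : R | `|x - t| < eta / 2].
    apply/nbhs_ballP; exists (eta / 2) => /=; first by rewrite divr_gt0.
    by move=> x; rewrite /ball /= distrC.
  have [n0 hn0] : exists n : nat, 2 / eta < n%:R.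
    by exists (Num.truncn (2 / eta)).+1; exact: truncnS_gt.
  have [n nn0 /= st] := ht _ nb n0.
  have [/andP[sn1 sn2] []] := hs n.
  have sn0 : 0 < s n by lra.
  (* The pole [k] on the limit circle, rescaled radially to radius [s n], moves by less than
     [eta / 2] and stays in the disk of radius [eta] contained in [Q]. *)
  pose k' := c + (k - c) * (s n / t)%:C.
  have k'c : nm (k' - c) = s n.
    rewrite /k' [c + _ - c]addrC addKr nmM nmR kt ger0_norm ?divr_ge0 ?ltW //.
    by rewrite mulrC mulfVK // gt_eqF.
  have k'k : nm (k' - k) < eta / 2.
    have -> : k' - k = (k - c) * ((s n - t) / t)%:C.
      have -> : ((s n - t) / t) = s n / t - 1 by field; rewrite gt_eqF.
      by rewrite rmorphB /= /k'; ring.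
    rewrite nmM nmR kt normrM normfV (gtr0_norm t0) mulrC mulfVK //.
    by rewrite gt_eqF.
  exists k'; split => //; first by apply: he; lra.
  move=> w Kw; have wk : eta <= nm (w - k).
    by rewrite leNgt; apply/negP => h; apply: (KQ w Kw); exact: he.
  have hn : (n.+1%:R)^-1 <= eta / 2.
    rewrite -[leRHS]invf_div lef_pV2 ?posrE ?ltr0n ?divr_gt0 //.
    by apply: le_trans (ltW hn0) _; rewrite ler_nat ltnW.
  apply: le_trans hn _; by have := nm_dist_tri k' w k; lra.
have [N N0 hN] := pot_lower S0 d0.
have N0' : (0 : R) < N%:R by rewrite ltr0n.
have rad (i : nat) : (i < N)%N -> S <= S * (1 + i.+1%:R / N%:R) <= 2 * S.
  move=> iN; have h1 : 0 < i.+1%:R / N%:R :> R by rewrite divr_gt0 // ltr0n.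
  have h2 : i.+1%:R / N%:R <= 1 :> R by rewrite ler_pdivrMr // mul1r ler_nat.
  apply/andP; split; first by rewrite ler_pMr // lerDl ltW.
  by rewrite [leRHS]mulrC ler_pM2l //; lra.
have [k hk] : {k : nat -> CC R & forall i, (i < N)%N ->
    [/\ Q (k i), nm (k i - c) = S * (1 + i.+1%:R / N%:R) &
      forall w, K w -> delta <= nm (w - k i)]}.
  apply: (choice (P := fun i k => (i < N)%N -> [/\ Q k, nm (k - c) = S * (1 + i.+1%:R / N%:R) &
      forall w, K w -> delta <= nm (w - k)])) => i.
  have [iN|iN] := boolP (i < N)%N; last by exists 0.
  by have [k hk] := hd _ (rad i iN); exists k.
exists N, k; split => //.
- by move=> i /hk[].
- by move=> i iN; have [_ -> _] := hk i iN; exact: rad.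
- move=> w Kw; apply: (hN c) => i iN; first by have [] := hk i iN.
  by have [_ _ h] := hk i iN; exact: h.
Qed.

(** * The unbounded complementary component of a compact set *)

Lemma connected_local (R : realType) (C Q : set (CC R)) (a : CC R) :
  connected C -> C a -> Q a ->
  (forall z, C z -> Q z -> exists2 r : R, 0 < r &
    forall w, C w -> nm (w - z) < r -> Q w) ->
  (forall z, C z -> ~ Q z -> exists2 r : R, 0 < r &
    forall w, C w -> nm (w - z) < r -> ~ Q w) ->
  C `<=` Q.
Proof.
move=> cC Ca Qa hQ hnQ.
pose O (P : set (CC R)) := [set w | exists z (r : R), [/\ C z, P z, 0 < r,
  (forall w', C w' -> nm (w' - z) < r -> P w') & nm (w - z) < r]].
have oO P : open (O P).
  apply/openCP => w [z [r [Cz Pz r0 h wz]]].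
  exists (r - nm (w - z)); first by rewrite subr_gt0.
  move=> w' ww'; exists z, r; split => //.
  by have := nm_dist_tri w w' z; lra.
have OQ : C `&` Q = C `&` O Q.
  apply/seteqP; split => z [Cz]; last by move=> [y [r [_ _ _ h zy]]]; split => //; exact: h.
  move=> Qz; have [r r0 h] := hQ z Cz Qz; split => //; exists z, r; split => //.
  by rewrite subrr nm0.
have OnQ : C `&` Q = C `&` ~` O (~` Q).
  apply/seteqP; split => z [Cz].
    by move=> Qz; split => // -[y [r [_ _ _ h zy]]]; exact: (h z Cz zy).
  move=> nO; split => //; apply: contrapT => nQz; apply: nO.
  have [r r0 h] := hnQ z Cz nQz; exists z, r; split => //.
  by rewrite subrr nm0.
have <- : C `&` Q = C; last by move=> z [].
apply: cC; first by exists a.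
- by exists (O Q).
- by exists (~` O (~` Q)) => //; apply: open_closedC.
Qed.

Definition segC (R : realType) (x y : CC R) (t : R) : CC R := x + t%:C * (y - x).

Lemma convex_connected (R : realType) (A : set (CC R)) :
  (forall x y, A x -> A y -> forall t : R, 0 <= t <= 1 -> A (segC x y t)) ->
  connected A.
Proof.
move=> cA; have [[x Ax]|] := pselect (A !=set0); last first.
  by move=> /set0P/negP; rewrite negbK => /eqP ->; exact: connected0.
pose S y := segC x y @` `[0 : R, 1]%classic.
have -> : A = \bigcup_(y in A) S y.
  apply/seteqP; split => [y Ay|z [y Ay [t ht <-]]].
    exists y => //; exists 1; first by rewrite /= in_itv /= ler01 lexx.
    by rewrite /segC mul1r subrKC.
  by apply: cA => //; move: ht; rewrite /= in_itv.
apply: bigcup_connected.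
  exists x => y Ay; exists 0; first by rewrite /= in_itv /= ler01 lexx.
  by rewrite /segC mul0r addr0.
move=> y Ay; apply: connected_continuous_connected.
  by apply/connected_intervalP; exact: interval_is_interval.
apply: continuous_subspaceT => t A' /nbhsCP[e e0 eA].
pose d := e / (nm (y - x) + 1).
have n0 : 0 < nm (y - x) + 1 by rewrite ltr_pwDr // nm_ge0.
apply/nbhs_ballP; exists d => /=; first by rewrite divr_gt0.
move=> t'; rewrite /ball /= distrC => tt'; apply: eA.
have -> : segC x y t' - segC x y t = (t' - t)%:C * (y - x).
  by rewrite /segC rmorphB /=; ring.
rewrite nmM nmR; apply: (@le_lt_trans _ _ (`|t' - t| * (nm (y - x) + 1))).
  by rewrite ler_wpM2l // lerDl.
by rewrite -ltr_pdivlMr.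
Qed.

Lemma ReSeg (R : realType) (x y : CC R) (t : R) :
  Re (segC x y t) = Re x + t * (Re y - Re x).
Proof. by rewrite /segC ReD ReM ReB /=; ring. Qed.

Lemma ImSeg (R : realType) (x y : CC R) (t : R) :
  Im (segC x y t) = Im x + t * (Im y - Im x).
Proof. by rewrite /segC ImD ImM ImB /=; ring. Qed.

Lemma nmSeg (R : realType) (c x y : CC R) (t r : R) : 0 <= t <= 1 ->
  nm (x - c) < r -> nm (y - c) < r -> nm (segC x y t - c) < r.
Proof.
move=> /andP[t0 t1] xr yr.
have -> : segC x y t - c = (1 - t)%:C * (x - c) + t%:C * (y - c).
  by rewrite /segC rmorphB /=; ring.
apply: le_lt_trans (nmD _ _) _; rewrite !nmM !nmR !ger0_norm ?subr_ge0 //.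
have [->|tn0] := eqVneq t 0; first by rewrite mul0r addr0 subr0 mul1r.
have tp : 0 < t by rewrite lt_neqAle eq_sym tn0.
have : t * nm (y - c) < t * r by rewrite ltr_pM2l.
have : (1 - t) * nm (x - c) <= (1 - t) * r by rewrite ler_wpM2l ?subr_ge0 // ltW.
by lra.
Qed.

Lemma disk_connected (R : realType) (c : CC R) (r : R) :
  connected [set z : CC R | nm (z - c) < r].
Proof. by apply: convex_connected => x y /= hx hy t ht; exact: nmSeg. Qed.

Lemma seg_gt (R : realType) (m a b t : R) : 0 <= t <= 1 -> m < a -> m < b ->
  m < a + t * (b - a).
Proof.
move=> /andP[t0 t1] ma mb.
have [->|tn0] := eqVneq t 0; first by rewrite mul0r addr0.
have tp : 0 < t by rewrite lt_neqAle eq_sym tn0.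
have : t * m < t * b by rewrite ltr_pM2l.
have : (1 - t) * m <= (1 - t) * a by rewrite ler_wpM2l ?subr_ge0 // ltW.
by lra.
Qed.

(* The set is a chain of four convex pieces; D = setT gives the outside of a
   square, and M = 0 with D a disk gives the punctured disk. *)
Lemma four_sides_connected (R : realType) (D : set (CC R)) (c : CC R) (M : R) :
  (forall x y, D x -> D y -> forall t : R, 0 <= t <= 1 -> D (segC x y t)) ->
  (exists2 e : R, M < e & forall a b, `|a| = e -> `|b| = e -> D (c + Complex a b)) ->
  0 <= M ->
  connected [set z | D z /\ (M < `|Re (z - c)| \/ M < `|Im (z - c)|)].
Proof.
move=> cD [e Me De] M0.
have e0 : 0 < e by lra.
have ne : `|e| = e by rewrite gtr0_norm.
have nNe : `|- e| = e by rewrite normrN.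
pose H1 := [set z | D z /\ M < Re (z - c)].
pose H2 := [set z | D z /\ M < Im (z - c)].
pose H3 := [set z | D z /\ M < - Re (z - c)].
pose H4 := [set z | D z /\ M < - Im (z - c)].
have c1 : connected H1.
  apply: convex_connected => x y [Dx hx] [Dy hy] t ht; split; first exact: cD.
  have := seg_gt ht hx hy; rewrite !ReB ReSeg; lra.
have c2 : connected H2.
  apply: convex_connected => x y [Dx hx] [Dy hy] t ht; split; first exact: cD.
  have := seg_gt ht hx hy; rewrite !ImB ImSeg; lra.
have c3 : connected H3.
  apply: convex_connected => x y [Dx hx] [Dy hy] t ht; split; first exact: cD.
  have := seg_gt ht hx hy; rewrite !ReB ReSeg; lra.
have c4 : connected H4.
  apply: convex_connected => x y [Dx hx] [Dy hy] t ht; split; first exact: cD.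
  have := seg_gt ht hx hy; rewrite !ImB ImSeg; lra.
have -> : [set z | D z /\ (M < `|Re (z - c)| \/ M < `|Im (z - c)|)] =
    ((H1 `|` H2) `|` H3) `|` H4.
  apply/seteqP; split => z.
    move=> [Dz]; rewrite !ltr_normr => -[/orP[h|h]|/orP[h|h]].
    - by left; left; left.
    - by left; right.
    - by left; left; right.
    - by right.
  by move=> [[[[Dz h]|[Dz h]]|[Dz h]]|[Dz h]]; split => //; rewrite !ltr_normr ?h ?orbT;
    [left|right|left|right].
apply: connectedU => //; first (exists (c + Complex e (- e)); split).
- by left; left; split; [exact: De | rewrite [c + _]addrC addrK].
- by split; [exact: De | rewrite [c + _]addrC addrK /= opprK].
apply: connectedU => //; first (exists (c + Complex (- e) e); split).
- by right; split; [exact: De | rewrite [c + _]addrC addrK].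
- by split; [exact: De | rewrite [c + _]addrC addrK /= opprK].
apply: connectedU => //; exists (c + Complex e e); split.
- by split; [exact: De | rewrite [c + _]addrC addrK].
- by split; [exact: De | rewrite [c + _]addrC addrK].
Qed.

Lemma punctured_disk_connected (R : realType) (c : CC R) (r : R) : 0 < r ->
  connected [set z : CC R | nm (z - c) < r /\ z != c].
Proof.
move=> r0; have := @four_sides_connected R [set z | nm (z - c) < r] c 0.
have <- : [set z : CC R | nm (z - c) < r /\ z != c] =
  [set z | [set z | nm (z - c) < r] z /\ (0 < `|Re (z - c)| \/ 0 < `|Im (z - c)|)].
  apply/seteqP; split => z /= [zr h]; split => //.
    rewrite !normr_gt0; apply/orP; rewrite -negb_and; apply: contra h.
    move=> /andP[h1 h2]; rewrite -subr_eq0 -nm_eq0 eq_le nm_ge0 andbT.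
    by apply: le_trans (nm_le_ReIm _) _; rewrite (eqP h1) (eqP h2) normr0 addr0.
  by apply/eqP => zc; move: h; rewrite zc subrr /= normr0 ltxx => -[].
apply => //.
- by move=> x y /= hx hy t ht; exact: nmSeg.
- exists (r / 4); first by rewrite divr_gt0.
  move=> a b ha hb /=; rewrite [c + _]addrC addrK.
  by apply: le_lt_trans (nm_le_ReIm _) _ => /=; rewrite ha hb; lra.
Qed.

Definition farC (R : realType) (M : R) : set (CC R) :=
  [set z | M < `|Re z| \/ M < `|Im z|].

Lemma farC_connected (R : realType) (M : R) : 0 <= M -> connected (@farC R M).
Proof.
move=> M0; have := @four_sides_connected R setT 0 M.
have <- : @farC R M =
  [set z | [set: CC R] z /\ (M < `|Re (z - 0)| \/ M < `|Im (z - 0)|)].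
  by apply/seteqP; split => z /=; rewrite subr0 // => -[].
by apply => //; exists (M + 1) => //; rewrite ltrDl.
Qed.

Lemma farC_out (R : realType) (M : R) (z : CC R) : farC M z -> M < nm z.
Proof.
by move=> [h|h]; apply: lt_le_trans h _; [exact: normr_Re_le | exact: normr_Im_le].
Qed.

Lemma farC_big (R : realType) (M : R) (z : CC R) : 2 * M < nm z -> farC M z.
Proof.
move=> h; have := lt_le_trans h (nm_le_ReIm z).
by have [?|?] := ltP M `|Re z|; [left | right; lra].
Qed.

(** For compact [E], the unbounded component of the complement. In this form membership is proved by
    exhibiting one connected unbounded set that misses [E]. *)
Definition ext (R : realType) (E : set (CC R)) : set (CC R) :=
  [set z | exists C, [/\ connected C, C z, unboundedC C & forall w, C w -> ~ E w]].

Lemma ext_disj (R : realType) (E : set (CC R)) (z : CC R) : ext E z -> ~ E z.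
Proof. by move=> [C [_ Cz _ h]]; exact: h. Qed.

Lemma unboundedC_S (R : realType) (A B : set (CC R)) :
  A `<=` B -> unboundedC A -> unboundedC B.
Proof. by move=> AB uA M; have [z Az zM] := uA M; exists z => //; exact: AB. Qed.

Lemma ext_join (R : realType) (E C : set (CC R)) (z : CC R) :
  connected C -> (forall w, C w -> ~ E w) -> C z -> ext E z -> C `<=` ext E.
Proof.
move=> cC CE Cz [D [cD Dz uD DE]] w Cw; exists (C `|` D); split.
- by apply: connectedU => //; exists z.
- by left.
- by apply: unboundedC_S uD => x; right.
- by move=> x [/CE|/DE].
Qed.

Lemma ext_far (R : realType) (E : set (CC R)) (M : R) : 0 <= M ->
  (forall z, E z -> nm z <= M) -> farC M `<=` ext E.
Proof.
move=> M0 EM z fz; exists (farC M); split => //.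
- exact: farC_connected.
- move=> T; exists ((`|T| + 2 * M + 1)%:C : CC R).
    by apply: farC_big; rewrite nmR ger0_norm; have := normr_ge0 T; lra.
  by rewrite nmR ger0_norm; have := normr_ge0 T; have := ler_norm T; lra.
- by move=> w /farC_out wM /EM; rewrite leNgt wM.
Qed.

Lemma ext_open (R : realType) (E : set (CC R)) : closed E -> open (ext E).
Proof.
move=> cE; apply/openCP => z ez.
have /openCP /(_ z (ext_disj ez))[r r0 h] : open (~` E) by exact: closed_openC.
exists r => // w wr.
apply: (@ext_join R E [set w | nm (w - z) < r] z) => //.
- exact: disk_connected.
- by rewrite /= subrr nm0.
Qed.

Lemma ext_closure (R : realType) (E : set (CC R)) (z : CC R) : closed E ->
  closure (ext E) z -> ~ E z -> ext E z.
Proof.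
move=> cE /closureCP cz nEz.
have /openCP /(_ z nEz)[r r0 h] : open (~` E) by exact: closed_openC.
have [w ew wz] := cz r r0.
apply: (@ext_join R E [set w | nm (w - z) < r] w) => //.
- exact: disk_connected.
- by rewrite /= subrr nm0.
Qed.

Lemma ext_connected (R : realType) (E : set (CC R)) : compact E -> connected (ext E).
Proof.
move=> /compactC_bounded[M M0 EM].
have fE : farC M `<=` ext E by apply: ext_far => [|z /EM]; exact: ltW.
have -> : ext E = \bigcup_(C in [set C | [/\ connected C, unboundedC C &
    forall w, C w -> ~ E w]]) (C `|` farC M).
  apply/seteqP; split => z.
    by move=> [C [cC Cz uC CE]]; exists C => //; left.
  move=> [C [cC uC CE]] [Cz|fz]; last exact: fE.
  by exists C.
have f0 : farC M ((2 * M + 1)%:C : CC R).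
  by apply: farC_big; rewrite nmR ger0_norm; lra.
apply: bigcup_connected; first by exists ((2 * M + 1)%:C : CC R) => C _; right.
move=> C [cC uC CE]; apply: connectedU => //; last exact/farC_connected/ltW.
by have [z Cz zM] := uC (2 * M); exists z; split => //; exact: farC_big.
Qed.

Lemma ext_unbounded (R : realType) (E : set (CC R)) : compact E -> unboundedC (ext E).
Proof.
move=> /compactC_bounded[M M0 EM] T.
exists ((`|T| + 2 * M + 1)%:C : CC R); last first.
  by rewrite nmR ger0_norm; have := normr_ge0 T; have := ler_norm T; lra.
apply: (@ext_far R E M); [exact: ltW | by move=> z /EM /ltW |].
by apply: farC_big; rewrite nmR ger0_norm; have := normr_ge0 T; lra.
Qed.

(** The points surrounded by [E]. Removing the closure makes the set open with boundary in [E], as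
    the maximum principle needs; it may contain points of [E] itself. *)
Definition inside (R : realType) (E : set (CC R)) : set (CC R) := ~` closure (ext E).

Lemma inside_open (R : realType) (E : set (CC R)) : open (inside E).
Proof. by apply: closed_openC; exact: closed_closure. Qed.

Lemma inside_bounded (R : realType) (E : set (CC R)) : compact E ->
  exists2 B : R, 0 < B & forall z, inside E z -> nm z <= B.
Proof.
move=> /compactC_bounded[M M0 EM]; exists (2 * M); first by rewrite mulr_gt0.
move=> z iz; rewrite leNgt; apply/negP => zM; apply: iz; apply: subset_closure.
by apply: (@ext_far R E M); [exact: ltW | by move=> w /EM /ltW | exact: farC_big].
Qed.

Lemma inside_bdry (R : realType) (E : set (CC R)) (z : CC R) : closed E ->
  closure (inside E) z -> ~ inside E z -> E z.
Proof.
move=> cE ciz niz; apply: contrapT => nEz.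
have ez : ext E z by apply: ext_closure => //; exact: contrapT.
have [r r0 h] := (openCP _).1 (ext_open cE) z ez.
have [w iw wz] := (closureCP _ _).1 ciz r r0.
by apply: iw; apply/subset_closure/h.
Qed.

Lemma inside_intro (R : realType) (E : set (CC R)) (z : CC R) : closed E ->
  ~ E z -> ~ ext E z -> inside E z.
Proof. by move=> cE nE ne cz; apply/ne/ext_closure. Qed.

Lemma inside_nonempty (R : realType) (E : set (CC R)) (z : CC R) :
  compact E -> inside E z -> E !=set0.
Proof.
move=> cE iz; apply/set0P/negP => /eqP E0; apply: iz; apply: subset_closure.
exists setT; split => //.
- by apply: convex_connected.
- by move=> T; have [w _ h] := ext_unbounded cE T; exists w.
- by move=> w _; rewrite E0.
Qed.

(* For c in N off g(G), the minimum principle bounds |g - c| from below on G by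
   its minimum on the boundary, so c cannot be approached by values in N. *)
Lemma image_clopen (R : realType) (g : CC R -> CC R) (G N : set (CC R)) (B : R) (z0 : CC R) :
  open G -> (forall z, G z -> nm z <= B) -> (forall z, derivable g z 1) ->
  connected N -> (forall z, closure G z -> ~ G z -> ~ N (g z)) ->
  G z0 -> N (g z0) -> N `<=` g @` G.
Proof.
move=> oG bG dg cN bdN Gz0 Nz0.
have cg z : {for z, continuous g} by exact/derivable_continuousC/dg.
have ccG : compact (closure G).
  apply: (@bounded_closed_compactC _ _ (B + 1)); first exact: closed_closure.
  move=> w /closureCP /(_ 1 ltr01)[w' /bG w'B ww'].
  by have := nm_leD w w'; rewrite nm_distC; lra.
have gap (K : set (CC R)) (c : CC R) : compact K -> (forall z, K z -> g z != c) ->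
    exists2 m : R, 0 < m & forall z, K z -> m <= nm (g z - c).
  move=> cK Kc; have cgK : closed (g @` K).
    by apply: compactC_closed; apply: (compact_image _ cK) => z; exact: cg.
  have /openCP /(_ c)[|m m0 hm] : open (~` (g @` K)) by exact: closed_openC.
    by move=> [z Kz gz]; have := Kc z Kz; rewrite gz eqxx.
  exists m => // z Kz; rewrite leNgt; apply/negP => h.
  by apply: (hm (g z) h); exists z.
apply: (@connected_local R N (g @` G) (g z0) cN Nz0); first by exists z0.
- move=> c Nc [z Gz gzc].
  have [||m m0 hm] := gap (closure G `&` ~` G) c.
  + by apply: compact_closedI => //; exact: open_closedC.
  + by move=> y [cy nGy]; apply: contraPneq Nc => <-; exact: bdN.
  exists (m / 3) => [|c' Nc' c'c]; first by rewrite divr_gt0.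
  apply: contrapT => ngc'.
  have far y : closure G y -> ~ G y -> 2 * m / 3 <= nm (g y - c').
    move=> cy nGy; have := hm y (conj cy nGy); have := nm_dist_tri c' (g y) c; lra.
  have neq y : closure G y -> g y != c'.
    move=> cy; have [Gy|nGy] := pselect (G y).
      by apply/eqP => h; apply: ngc'; exists y.
    by rewrite -subr_eq0 -nm_gt0; have := far y cy nGy; lra.
  have hc y : closure G y -> {for y, continuous (fun y => -1 * ln (nm (g y - c')))}.
    by move=> cy; apply: contCR_Z; exact: (cont_ln_sub (@cg y) (neq y cy)).
  have hh y : G y -> harm_at (fun y => -1 * ln (nm (g y - c'))) y.
    move=> Gy; apply: harm_atZ; apply: (@harm_ln_sub R g c' y 1 ltr01) => [w _|].
      exact: dg.
    exact/neq/subset_closure.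
  have bd y : closure G y -> ~ G y -> -1 * ln (nm (g y - c')) <= -1 * ln (2 * m / 3).
    move=> cy nGy; have h := far y cy nGy.
    have m3 : 0 < 2 * m / 3 by rewrite divr_gt0 // mulr_gt0.
    by rewrite !mulN1r lerN2 ler_ln ?posrE //; exact: lt_le_trans h.
  have := max_principle oG bG hc hh bd Gz; rewrite gzc !mulN1r lerN2 ler_ln ?posrE.
  + by rewrite nm_distC; lra.
  + by rewrite divr_gt0 // mulr_gt0.
  + by rewrite -gzc nm_gt0 subr_eq0; apply/neq/subset_closure.
- move=> c Nc ngc.
  have [||m m0 hm] := gap (closure G) c => //.
    move=> y cy; have [Gy|nGy] := pselect (G y).
      by apply/eqP => h; apply: ngc; exists y.
    by apply: contraPneq Nc => <-; exact: bdN.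
  exists m => // c' Nc' c'c [y Gy gy].
  have := hm y (subset_closure Gy); rewrite gy; lra.
Qed.

(** * Normality *)

Lemma derivable_iter (R : realType) (f : CC R -> CC R) (n : nat) (z : CC R) :
  entire f -> derivable (iter n f) z 1.
Proof.
move=> ef; elim: n => [|n IH]; first exact: derivable_id.
have -> : iter n.+1 f = f \o iter n f by [].
exact: (derivable_compC IH (ef _)).
Qed.

(** A Schottky-type bound. With poles in [Q] at distance 1 to 2 from [c], the potential of [g] plus
    4 is positive and harmonic; it is at most [T] at [p], since [|g p - k i| <= M + Rad + 2]. By
    Harnack it is at most [20 * T] at [z], and it dominates [ln (|g z - c| / 2)] once
    [|g z - c| > 4]. *)
Lemma omit_bound (R : realType) (Rad M : R) : 0 <= Rad -> 0 <= M ->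
  exists M' : R, forall (g : CC R -> CC R) (Q : set (CC R)) (p c : CC R) (r : R),
    0 < r -> (forall z, nm (z - p) < r -> derivable g z 1) ->
    open Q -> connected Q -> unboundedC Q -> Q c -> nm c <= Rad ->
    (forall z, nm (z - p) < r -> ~ Q (g z)) -> nm (g p) <= M ->
    forall z, nm (z - p) <= r / 8 -> nm (g z) <= M'.
Proof.
move=> R0 M0; pose T := ln (M + Rad + 2) + 4 : R.
exists (Rad + 4 + 2 * expR (20 * T)) => g Q p c r r0 dg oQ cQ uQ Qc cR gQ gp z zp.
pose K := g @` [set z | nm (z - p) < r].
have [N [k [N0 Qk kr lo]]] := @escape_pot R Q K c 1 oQ cQ uQ Qc ltr01
  ltac:(by move=> _ [w wr <-]; exact: gQ).
have neq w : nm (w - p) < r -> forall i, (i < N)%N -> g w != k i.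
  by move=> wr i iN; apply/eqP => h; apply: (gQ w wr); rewrite h; exact: Qk.
have pr : nm (p - p) < r by rewrite subrr nm0.
have zr : nm (z - p) < r by lra.
have up : pot N k (g p) + 4 <= T.
  rewrite lerD2r; apply: pot_le => // i iN.
  rewrite nm_gt0 subr_eq0 neq //=.
  have /andP[_ h] := kr i iN; have := nm_dist_tri c (g p) (k i).
  rewrite (nm_distC c (k i)); have := nmD (g p) (- c); rewrite nmN; lra.
have := @harnack R (fun w => pot N k (g w) + 4) p r r0.
have h1 w : nm (w - p) < r -> {for w, continuous (fun w => pot N k (g w) + 4)}.
  move=> wr; apply: contCR_D; last exact: contCR_cst.
  by apply: pot_cont; [exact/derivable_continuousC/dg | exact: neq].
have h2 w : nm (w - p) < r -> harm_at (fun w => pot N k (g w) + 4) w.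
  move=> wr; apply: harm_atD; last exact: harm_at_cst.
  apply: (@pot_harm R g N k w (r - nm (w - p))); [by rewrite subr_gt0 | | exact: neq].
  by move=> y yw; apply: dg; have := nm_dist_tri w y p; lra.
have h3 w : nm (w - p) < r -> 0 <= pot N k (g w) + 4.
  by move=> wr; have := lo (g w) ltac:(by exists w); rewrite ln1; lra.
move=> /(_ h1 h2 h3 z zp) H.
have {}H : pot N k (g z) <= 20 * T by lra.
have e0 := expR_gt0 (20 * T).
have gz := nm_leD (g z) c.
have [small|big] := leP (nm (g z - c)) 4; first by lra.
have l2 : ln (nm (g z - c) / 2) <= pot N k (g z).
  apply: pot_ge => //; first by rewrite divr_gt0 //; lra.
  move=> i iN; have /andP[_ h] := kr i iN; have := nm_dist_tri (k i) (g z) c; lra.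
have : nm (g z - c) / 2 <= expR (20 * T).
  have h0 : 0 < nm (g z - c) / 2 by rewrite divr_gt0 //; lra.
  rewrite -[leLHS]lnK ?posrE // ler_expR; exact: le_trans H.
by lra.
Qed.

Lemma ptws_nbhs (R : realType) (g : prod_topology (fun _ : CC R => CC R))
    (s : seq (CC R)) (e : R) : 0 < e ->
  nbhs g [set h : prod_topology (fun _ : CC R => CC R) |
    forall x, x \in s -> nm (h x - g x) < e].
Proof.
move=> e0; elim: s => [|x s IH].
  have -> : [set h : prod_topology (fun _ : CC R => CC R) |
    forall x, x \in [::] -> nm (h x - g x) < e] = setT by apply/seteqP; split.
  exact: filterT.
have nx : nbhs g [set h : prod_topology (fun _ : CC R => CC R) | nm (h x - g x) < e].
  have ne : nbhs (proj x g) [set y : CC R | nm (y - g x) < e].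
    by apply/nbhsCP; exists e.
  exact: (@proj_continuous _ (fun _ : CC R => CC R) x g _ ne).
apply: filterS (filterI nx IH) => h [hx hs] y.
by rewrite inE => /orP[/eqP ->|]; [exact: hx | exact: hs].
Qed.

(** Tychonoff's theorem replaces diagonal extraction: a cluster point in the product over the whole
    plane is approached on every finite set of points. *)
Lemma ptws_cluster (R : realType) (F : nat -> CC R -> CC R) (M : R) :
  (forall n z, nm (F n z) <= M) ->
  exists g : CC R -> CC R, forall (s : seq (CC R)) (e : R) (N : nat), 0 < e ->
    exists2 n, (N <= n)%N & forall x, x \in s -> nm (F n x - g x) < e.
Proof.
move=> FM; have cD : compact [set z : CC R | nm z <= M].
  have := @compact_cdisc R 0 M; congr compact; apply/seteqP.
  by split => z /=; rewrite subr0.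
have cT := @tychonoff (CC R) (fun _ => CC R) (fun _ => [set z : CC R | nm z <= M])
  (fun _ => cD).
pose F0 : nat -> prod_topology (fun _ : CC R => CC R) := F.
have FT n : [set h : forall _ : CC R, CC R | forall i, [set z : CC R | nm z <= M] (h i)] (F0 n).
  by move=> z; exact: FM.
have [g _ hg] := compact_seq_cluster cT FT.
exists g => s e N e0.
have nb := ptws_nbhs g s e0.
by have [n Nn h] := hg _ nb N; exists n.
Qed.

Lemma finite_net (R : realType) (p : CC R) (r e : R) : 0 < e ->
  exists2 s : seq (CC R), (forall x, x \in s -> nm (x - p) <= r) &
    forall z, nm (z - p) <= r -> exists2 x, x \in s & nm (z - x) < e.
Proof.
move=> e0; have := @compact_cdisc R p r; rewrite compact_cover.
move=> /(_ (CC R) [set z | nm (z - p) <= r] (fun x => [set z | nm (z - x) < e])).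
case.
- by move=> x _; exact: open_cdisk.
- by move=> z zr; exists z => //=; rewrite subrr nm0.
move=> D DS Dc; exists (finmap.enum_fset D).
  by move=> x /DS; rewrite inE.
by move=> z zr; have [x xD xz] := Dc z zr; exists x.
Qed.

Lemma strict_incr_select (P : nat -> nat -> Prop) :
  (forall k N, exists2 n, (N <= n)%N & P k n) ->
  exists2 psi : nat -> nat, (forall k, (psi k < psi k.+1)%N) & forall k, P k (psi k).
Proof.
move=> h.
have [nxt hn] : {nxt : nat * nat -> nat & forall q, (q.2 <= nxt q)%N /\ P q.1 (nxt q)}.
  apply: (choice (P := fun q n => (q.2 <= n)%N /\ P q.1 n)) => -[k N].
  by have [n Nn Pn] := h k N; exists n.
pose psi := fix psi k := if k is k'.+1 then nxt (k, (psi k').+1) else nxt (0, 0)%N.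
exists psi => [k|[|k]]; first exact: (hn (k.+1, (psi k).+1)).1.
  exact: (hn (0, 0)%N).2.
exact: (hn (k.+1, (psi k).+1)).2.
Qed.

Lemma nat_gt_real (R : realType) (x : R) : exists n : nat, x < n%:R.
Proof. by exists (Num.truncn x).+1; exact: truncnS_gt. Qed.

(** The size at [p] decides the kind of limit. If it is unbounded along [phi], the last hypothesis
    gives a subsequence tending to infinity; otherwise uniform Lipschitz bounds turn pointwise
    approximation on a finite net into uniform convergence. *)
Lemma montel_normal (R : realType) (F : nat -> CC R -> CC R) (p : CC R) (r : R) : 0 < r ->
  (forall n z, nm (z - p) < r -> derivable (F n) z 1) ->
  (forall M : R, exists M' : R, forall n, nm (F n p) <= M ->
    forall z, nm (z - p) < r -> nm (F n z) <= M') ->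
  (forall M : R, exists M' : R, forall n, M' < nm (F n p) ->
    forall z, nm (z - p) < r -> M < nm (F n z)) ->
  normal_on [set z | nm (z - p) < r / 8] F.
Proof.
move=> r0 dF hb hu phi phiS.
have [[M bM]|unb] := pselect (exists M : R, forall n, nm (F (phi n) p) <= M); last first.
  have bigs (k N : nat) : exists2 n, (N <= n)%N & k%:R < nm (F (phi n) p).
    apply: contrapT => no; apply: unb.
    exists (k%:R + \sum_(i < N) nm (F (phi i) p)) => n.
    have s0 (P : pred 'I_N) : 0 <= \sum_(i < N | P i) nm (F (phi i) p).
      by apply: sumr_ge0 => i _; exact: nm_ge0.
    have [Nn|nN] := leqP N n.
      have h : nm (F (phi n) p) <= k%:R.
        by rewrite leNgt; apply/negP => h; apply: no; exists n.
      by have := s0 xpredT; lra.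
    rewrite (bigD1 (Ordinal nN)) //=.
    have := s0 (fun i => i != Ordinal nN); have : 0 <= k%:R :> R by [].
    by lra.
  have [psi psiS hpsi] := strict_incr_select bigs.
  exists psi; split => //; right => K Kd cK M.
  have [M' hM'] := hu M; have [k0 hk0] := nat_gt_real M'.
  exists k0 => // k /= kk z /Kd /= zr; rewrite nmE ltcR.
  apply: hM'; last by lra.
  apply: lt_trans hk0 _; apply: le_lt_trans (hpsi k).
  by rewrite ler_nat.
have [M' hM'] := hb M.
pose M1 := Num.max M' 0.
have bF n z : nm (z - p) < r -> nm (F (phi n) z) <= M1.
  by move=> zr; rewrite le_max hM'.
have M10 : 0 <= M1 by rewrite le_max lexx orbT.
pose L := 8 * M1 / r.
have L0 : 0 <= L by rewrite divr_ge0 ?mulr_ge0 // ltW.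
have lip n z w : nm (z - p) < r / 4 -> nm (w - p) < r / 4 ->
    nm (F (phi n) w - F (phi n) z) <= L * nm (w - z).
  exact: (cauchy_lipschitz r0 (dF (phi n)) (bF n)).
(* Cut off, because [ptws_cluster] needs a bound on the whole plane. *)
pose F' n z := if nm (z - p) < r / 4 then F (phi n) z else 0.
have [n z|g hg] := @ptws_cluster R F' M1.
  by rewrite /F'; case: ifPn => h; [apply: bF; lra | rewrite nm0].
have lipg z w : nm (z - p) < r / 4 -> nm (w - p) < r / 4 ->
    nm (g w - g z) <= L * nm (w - z).
  move=> zr wr; apply/ler_addgt0Pr => e e0.
  have [|n _ hn] := hg [:: z; w] (e / 2) 0%N; first by rewrite divr_gt0.
  have h1 := hn z ltac:(by rewrite !inE eqxx); have h2 := hn w ltac:(by rewrite !inE eqxx orbT).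
  rewrite /F' zr in h1; rewrite /F' wr in h2.
  have h3 := lip n z w zr wr.
  have := nm_dist_tri (F (phi n) w) (g w) (g z).
  have := nm_dist_tri (F (phi n) z) (F (phi n) w) (g z).
  by rewrite (nm_distC (g w) (F (phi n) w)); lra.
(* On a net of mesh [1 / (k + 1)] the error is [L] times the mesh for [F], the same for [g], and one
   mesh for the closeness at the net points. *)
have good (k N : nat) : exists2 n, (N <= n)%N &
    forall z, nm (z - p) <= r / 8 -> nm (F (phi n) z - g z) <= (2 * L + 1) / k.+1%:R.
  have k0 : 0 < k.+1%:R^-1 :> R by rewrite invr_gt0 ltr0n.
  have [s sr hs] := finite_net p (r / 8) k0.
  have [n Nn hn] := hg s _ N k0.
  exists n => // z zr; have [x xs zx] := hs z zr.
  have xr := sr x xs.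
  have h1 := hn x xs; rewrite /F' ifT in h1; last by lra.
  have h2 := lip n x z ltac:(lra) ltac:(lra).
  have h3 := lipg z x ltac:(lra) ltac:(lra).
  have h4 : L * nm (z - x) <= L * k.+1%:R^-1 by rewrite ler_wpM2l // ltW.
  rewrite (nm_distC x z) in h3.
  have := nm_dist_tri (F (phi n) x) (F (phi n) z) (g z).
  have := nm_dist_tri (g x) (F (phi n) x) (g z).
  by move: (k.+1%:R^-1) h1 h4 => q; lra.
have [psi psiS hpsi] := strict_incr_select good.
exists psi; split => //; left; exists g => K Kd cK eps eps0.
have [k0 hk0] := nat_gt_real ((2 * L + 1) / eps).
exists k0 => // k /= kk z /Kd /= zr; rewrite nmE ltcR.
apply: le_lt_trans (hpsi k z (ltW zr)) _.
rewrite ltr_pdivrMr ?ltr0n // -ltr_pdivrMl // [_^-1 * _]mulrC.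
by apply: lt_le_trans hk0 _; rewrite ler_nat ltnW.
Qed.

(** The boundary of [inside E] lies in [E], so its image misses [ext] of the image of [E]. A single
    common value would by [image_clopen] put this whole unbounded set into the bounded image of
    [inside E]. *)
Lemma ext_image_disj (R : realType) (g : CC R -> CC R) (E : set (CC R)) (z : CC R) :
  (forall z, derivable g z 1) -> compact E -> inside E z -> ~ ext (g @` E) (g z).
Proof.
move=> dg cE iz ez.
have cg : continuous g by move=> y; exact/derivable_continuousC/dg.
have cgE : compact (g @` E) by exact: compact_image.
have [B B0 bB] := inside_bounded cE.
have sub := @image_clopen R g (inside E) (ext (g @` E)) B z (@inside_open R E) bB dg
  (ext_connected cgE).
have cgB : compact (g @` [set z : CC R | nm (z - 0) <= B]).
  by apply: compact_image => //; exact: compact_cdisc.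
have [T T0 hT] := compactC_bounded cgB.
have [w ew Tw] := ext_unbounded cgE T.
have [|y iy gy] := sub _ iz ez w ew.
  move=> y cy niy ey; apply: (ext_disj ey); exists y; last exact: erefl.
  exact: (inside_bdry (compactC_closed cE) cy niy).
have := hT w ltac:(by exists y => //=; rewrite subr0; exact: bB).
by rewrite ltNge (ltW Tw).
Qed.

(** Otherwise every iterate omits, near [p], its own connected unbounded set through a point of
    modulus at most [Rad]. The bound of [omit_bound] is the same for all these sets, so the iterates
    would be normal at [p]. *)
Lemma julia_blowup (R : realType) (f : CC R -> CC R) (E : set (CC R)) (p : CC R) (Rad : R) :
  entire f -> compact E -> julia f p -> inside E p -> 0 <= Rad ->
  exists n, forall c, ext (iter n f @` E) c -> Rad < nm c.
Proof.
move=> ef cE Jp ip R0; apply: contrapT => no; apply: Jp.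
have dfn n z : derivable (iter n f) z 1 by exact: derivable_iter.
have cfn n : continuous (iter n f) by move=> y; exact/derivable_continuousC/dfn.
have cfE n : compact (iter n f @` E) by exact: (compact_image (cfn n) cE).
have [c hc] : {c : nat -> CC R & forall n, ext (iter n f @` E) (c n) /\ nm (c n) <= Rad}.
  apply: (choice (P := fun n c => ext (iter n f @` E) c /\ nm c <= Rad)) => n.
  apply: contrapT => /forallNP no'; apply: no; exists n => c ec.
  by rewrite ltNge; apply/negP => h; exact: (no' c).
have [r r0 hr] := (openCP _).1 (@inside_open R E) p ip.
have omit n w : inside E w -> ~ ext (iter n f @` E) (iter n f w).
  by move=> iw; exact: (ext_image_disj (dfn n) cE iw).
have r16 : 0 < r / 16 by rewrite divr_gt0.
exists [set z | nm (z - p) < r / 16 / 8]; split; first exact: open_cdisk.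
split; first by rewrite /= subrr nm0 divr_gt0.
apply: (montel_normal r16).
- by move=> n z _; exact: dfn.
- move=> M; pose M0 := Num.max M 0.
  have M00 : 0 <= M0 by rewrite le_max lexx orbT.
  have [M' hM'] := omit_bound R0 M00; exists M' => n pn z zr.
  apply: (hM' (iter n f) (ext (iter n f @` E)) p (c n) r r0).
  + by move=> w _; exact: dfn.
  + exact: (ext_open (compactC_closed (cfE n))).
  + exact: (ext_connected (cfE n)).
  + exact: (ext_unbounded (cfE n)).
  + exact: (hc n).1.
  + exact: (hc n).2.
  + by move=> w /hr; exact: omit.
  + by rewrite le_max pn.
  + by lra.
- move=> M; pose M0 := Num.max M 0.
  have M00 : 0 <= M0 by rewrite le_max lexx orbT.
  have [M' hM'] := omit_bound R0 M00; exists M' => n pn z zr.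
  rewrite ltNge; apply/negP => zM; move: pn; rewrite ltNge => /negP; apply.
  (* The roles are exchanged: a moderate value at [z] bounds the value at [p]. The disk about [z] of
     radius [r / 2] stays where values are omitted, and its eighth reaches [p]. *)
  apply: (hM' (iter n f) (ext (iter n f @` E)) z (c n) (r / 2)).
  + by rewrite divr_gt0.
  + by move=> w _; exact: dfn.
  + exact: (ext_open (compactC_closed (cfE n))).
  + exact: (ext_connected (cfE n)).
  + exact: (ext_unbounded (cfE n)).
  + exact: (hc n).1.
  + exact: (hc n).2.
  + by move=> w wz; apply/omit/hr; have := nm_dist_tri z w p; lra.
  + by rewrite le_max zM.
  + by rewrite nm_distC; lra.
Qed.

(** * The logarithmic tract *)

Lemma component_mem_closure (R : realType) (A : set (CC R)) (x z : CC R) :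
  open A -> closure (connected_component A x) z -> A z -> connected_component A x z.
Proof.
move=> oA /closureCP cz Az.
have [r r0 hr] := (openCP A).1 oA z Az.
have [w cw wz] := cz r r0.
apply: (connected_component_trans cw).
apply: (@connected_component_max _ A [set y | nm (y - z) < r] w wz hr).
  exact: disk_connected.
by rewrite /= subrr nm0.
Qed.

Lemma component_openC (R : realType) (A : set (CC R)) (x : CC R) :
  open A -> open (connected_component A x).
Proof.
move=> oA; apply/openCP => z cz.
have [r r0 hr] := (openCP A).1 oA z (connected_component_sub cz).
exists r => // w wz; apply: (connected_component_trans cz).
apply: (@connected_component_max _ A [set y | nm (y - z) < r] z _ hr) => //.
  by rewrite /= subrr nm0.
exact: disk_connected.
Qed.

Lemma cdiskE (R : realType) (a z : CC R) (r : R) : cdisk a r z <-> nm (z - a) < r.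
Proof. by rewrite /cdisk /= nmE ltcR. Qed.

Definition tract (R : realType) (f : CC R -> CC R) (alpha : CC R) (r : R) (z0 : CC R) :=
  connected_component (f @^-1` cdisk alpha r) z0.

Lemma open_preimage_cdisk (R : realType) (f : CC R -> CC R) (alpha : CC R) (r : R) :
  continuous f -> open (f @^-1` cdisk alpha r).
Proof.
move=> cf; apply/openCP => z /cdiskE fz.
have [d d0 hd] := (contCP f z).1 (cf z) (r - nm (f z - alpha)) ltac:(by rewrite subr_gt0).
exists d => // w /hd wz; apply/cdiskE.
by have := nm_dist_tri (f z) (f w) alpha; lra.
Qed.

Lemma within_contP (R : realType) (W : set (CC R)) (q : CC R -> CC R) (v : CC R) :
  open W -> {within W, continuous q} -> W v -> {for v, continuous q}.
Proof.
move=> oW /subspace_continuousP cq Wv A /(cq v Wv); rewrite /= => h.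
have h' : nbhs v [set x | W x -> A (q x)] by [].
have nW : nbhs v W by apply: open_nbhs_nbhs.
by apply: filterS (filterI h' nW) => x [hx Wx]; exact: hx.
Qed.

(** Compactness of the circle together with continuous local inverse branches. It provides a
    starting point for lifts in a disk fixed before the set to be lifted is known. *)
Lemma tract_bound (R : realType) (f : CC R -> CC R) (alpha : CC R) (r : R) (U : set (CC R)) :
  covering_map U (cdisk alpha r `\ alpha) f -> forall s : R, 0 < s < r ->
  exists2 B : R, 0 < B & forall y, nm (y - alpha) = s ->
    exists z, [/\ U z, f z = y & nm z < B].
Proof.
move=> [_ [fU cov]] s /andP[s0 sr]; apply: contrapT => no.
have sel (n : nat) : exists y, nm (y - alpha) = s /\
    ~ exists z, [/\ U z, f z = y & nm z < n.+1%:R].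
  apply: contrapT => /forallNP no'; apply: no; exists (n.+1%:R) => // y ys.
  by apply: contrapT => h; exact: (no' y).
have [y hy] := choice sel.
have yK n : [set z : CC R | nm (z - alpha) <= s] (y n) by rewrite /= (hy n).1.
have [v _ hv] := compact_seq_cluster (@compact_cdisc R alpha s) yK.
have vs : nm (v - alpha) = s.
  apply/eqP; rewrite -subr_eq0 -normr_le0; apply/ler_addgt0Pl => e e0; rewrite addr0.
  have nb : nbhs v [set w | nm (w - v) < e] by apply/nbhsCP; exists e.
  have [n _ /= nv] := hv _ nb 0%N; rewrite -(hy n).1 ler_norml.
  have := nm_dist_tri v (y n) alpha; have := nm_dist_tri (y n) v alpha.
  by rewrite (nm_distC v (y n)) => ? ?; apply/andP; split; lra.
have Vv : (cdisk alpha r `\ alpha) v.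
  split; first by apply/cdiskE; rewrite vs.
  by move=> /= va; move: s0; rewrite -vs va subrr nm0 ltxx.
have [W [oW [Wv [WV [F [Fo [Fd [FU Fq]]]]]]]] := cov v Vv.
have [z Uz fz] : (f @` U) v by rewrite fU.
have [S FS Sz] : (\bigcup_(S in F) S) z.
  by rewrite -FU; split => //=; rewrite fz.
have [q [cq [qS qK]]] := Fq S FS.
have cqv := within_contP oW cq Wv.
have [d d0 hd] := (contCP q v).1 cqv 1 ltr01.
have [d' d'0 hd'] := (openCP W).1 oW v Wv.
have [N hN] := nat_gt_real (nm (q v) + 1).
have nb : nbhs v [set w | nm (w - v) < Num.min d d'].
  by apply/nbhsCP; exists (Num.min d d') => //; rewrite lt_min d0.
have [n Nn /=] := hv _ nb N; rewrite lt_min => /andP[n1 n2].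
have [_ []] := hy n.
have [Sq fq] := qS (y n) (hd' _ n2).
exists (q (y n)); split => //.
  have : (\bigcup_(S in F) S) (q (y n)) by exists S.
  by rewrite -FU => -[].
have := nm_leD (q (y n)) (q v); have := hd _ n1.
have : N%:R <= n.+1%:R :> R by rewrite ler_nat ltnW.
by move: (n.+1%:R : R) => x; lra.
Qed.

(** Replaces path lifting. A local inverse carries a small disk of [Y] to a connected set, which
    lies in the component as soon as one of its points does; so the image of the component is open
    and closed in [Y]. *)
Lemma tract_lift (R : realType) (f : CC R -> CC R) (U V Y : set (CC R)) (z1 : CC R) :
  covering_map U V f -> open Y -> connected Y -> Y `<=` V -> U z1 -> Y (f z1) ->
  Y `<=` f @` connected_component (U `&` f @^-1` Y) z1.
Proof.
move=> [_ [fU cov]] oY cY YV Uz1 Yz1; set Z := connected_component _ _.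
have Zz1 : Z z1 by apply: connected_component_refl.
have key v : Y v -> exists2 eta : R, 0 < eta & forall y, nm (y - v) < eta ->
    (f @` Z) y -> forall w, nm (w - v) < eta -> (f @` Z) w.
  move=> Yv; have [W [oW [Wv [WV [F [Fo [Fd [FU Fq]]]]]]]] := cov v (YV _ Yv).
  have [d1 d10 h1] := (openCP W).1 oW v Wv.
  have [d2 d20 h2] := (openCP Y).1 oY v Yv.
  exists (Num.min d1 d2) => [|y]; first by rewrite lt_min d10.
  set eta := Num.min d1 d2.
  have BW x : nm (x - v) < eta -> W x by rewrite lt_min => /andP[h _]; exact: h1.
  have BY x : nm (x - v) < eta -> Y x by rewrite lt_min => /andP[_ h]; exact: h2.
  move=> yv [z Zz fz] w wv.
  have [Uz Yz] := connected_component_sub Zz.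
  have [S FS Sz] : (\bigcup_(S in F) S) z.
    by rewrite -FU; split => //=; rewrite fz; exact: BW.
  have [q [cq [qS qK]]] := Fq S FS.
  have cB : connected (q @` [set x | nm (x - v) < eta]).
    apply: connected_continuous_connected; first exact: disk_connected.
    by apply: continuous_subspaceW cq => x /= /BW.
  have zq : z = q y by rewrite -fz qK.
  have sub : q @` [set x | nm (x - v) < eta] `<=` U `&` f @^-1` Y.
    move=> _ [x /= xv <-]; have [Sx fx] := qS x (BW x xv).
    have : (\bigcup_(S in F) S) (q x) by exists S.
    by rewrite -FU => -[Ux _]; split => //=; rewrite fx; exact: BY.
  exists (q w); last by have [] := qS w (BW w wv).
  apply: (connected_component_trans Zz).
  by apply: (connected_component_max _ sub cB); [exists y | exists w].
apply: (@connected_local R Y (f @` Z) (f z1) cY Yz1); first by exists z1.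
- move=> v Yv fv; have [eta eta0 h] := key v Yv; exists eta => // w _ wv.
  by apply: (h v) => //; rewrite subrr nm0.
- move=> v Yv nfv; have [eta eta0 h] := key v Yv; exists eta => // w _ wv fw.
  by apply: nfv; apply: (h w) => //; rewrite subrr nm0.
Qed.

Lemma tract_step (R : realType) (f : CC R -> CC R) (alpha z0 : CC R) (r : R) :
  entire f -> 0 < r ->
  covering_map (tract f alpha r z0) (cdisk alpha r `\ alpha) f ->
  exists RK : R, forall (E : set (CC R)) (Rad : R), compact E -> RK <= Rad ->
    (forall c, ext E c -> Rad < nm c) ->
    exists E2, [/\ compact E2, inside E2 alpha &
      forall y, E2 y -> nm (y - alpha) <= r / 2 /\
        exists x, [/\ E x, Rad <= nm x & f x = y]].
Proof.
move=> ef r0 cov; set U := tract f alpha r z0 in cov *.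
have cf : continuous f by move=> z; exact/derivable_continuousC/ef.
have r4 : 0 < r / 4 < r by apply/andP; split; lra.
have [RK RK0 hRK] := tract_bound cov r4.
exists RK => E Rad cE RKR hE.
have Uin z : closure U z -> nm (f z - alpha) < r -> U z.
  move=> cz fz; apply: component_mem_closure => //.
    exact: open_preimage_cdisk.
  exact/cdiskE.
have fUa z : U z -> f z != alpha.
  move=> Uz; have : (f @` U) (f z) by exists z.
  by rewrite cov.2.1 => -[_ /eqP].
(* The closure of [U] makes [P] compact; the bound [r / 2 < r] brings its points back into [U],
   where [f] omits [alpha]. *)
pose P := E `&` ([set z | Rad <= nm z] `&` (closure U `&` [set z | nm (f z - alpha) <= r / 2])).
have PU z : P z -> U z by move=> [_ [_ [cz fz]]]; apply: Uin => //; rewrite /= in fz; lra.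
have cP : compact P.
  apply: compact_closedI => //; apply: closedI; last apply: closedI.
  - apply/closedCP => z h /=; apply/ler_addgt0Pl => e e0.
    by have [w /= wR wz] := h e e0; have := nm_leD w z; lra.
  - exact: closed_closure.
  - apply/closedCP => z h /=; apply/ler_addgt0Pl => e e0.
    have [d d0 hd] := (contCP f z).1 (cf z) e e0.
    have [w /= wr /hd wz] := h d d0.
    by have := nm_dist_tri (f w) (f z) alpha; rewrite (nm_distC (f z) (f w)); lra.
pose E2 := f @` P.
have cE2 : compact E2 by exact: compact_image.
have clE2 : closed E2 by exact: compactC_closed.
exists E2; split => //; last first.
  by move=> _ [x [Ex [xR [_ fx]]] <-]; split => //; exists x.
have E2a : ~ E2 alpha by move=> [x /PU /fUa /eqP].
apply: inside_intro => // ea.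
have [d d0 hd] := (openCP _).1 (ext_open clE2) alpha ea.
pose rho := r / 2; have rho0 : 0 < rho by rewrite divr_gt0.
pose d' := Num.min d rho.
have d'0 : 0 < d' by rewrite lt_min d0.
pose A := ext E2 `&` [set z | nm (z - alpha) < rho /\ z != alpha].
have oA : open A.
  apply: openI; first exact: ext_open.
  apply/openCP => z [zr za].
  exists (Num.min (rho - nm (z - alpha)) (nm (z - alpha))).
    by rewrite lt_min subr_gt0 zr nm_gt0 subr_eq0.
  move=> w; rewrite lt_min => /andP[w1 w2]; split.
    by have := nm_dist_tri z w alpha; lra.
  by apply/eqP => wa; move: w2; rewrite wa nm_distC ltxx.
pose D := [set z : CC R | nm (z - alpha) < d' /\ z != alpha].
have DA : D `<=` A.
  move=> z [zd za]; move: zd; rewrite lt_min => /andP[z1 z2]; split => //.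
  exact: hd.
pose y0 : CC R := alpha + (d' / 2)%:C.
have y0n : nm (y0 - alpha) = d' / 2.
  by rewrite /y0 addrC addKr nmR ger0_norm // divr_ge0 // ltW.
have Dy0 : D y0.
  by split; [rewrite y0n; lra | rewrite -subr_eq0 -nm_gt0 y0n divr_gt0].
pose Y := connected_component A y0.
have DY : D `<=` Y.
  apply: connected_component_max => //; exact: punctured_disk_connected.
have cY : connected Y by exact: component_connected.
have oY : open Y by exact: component_openC.
have YA : Y `<=` A by exact: connected_component_sub.
have Yy0 : Y y0 by exact: DY.
have drho : d' <= rho by rewrite ge_min lexx orbT.
(* If [Y] missed this circle, [Y] with [alpha] added would be open and closed in the connected set
   [ext E2], which would then be bounded. *)
have [y Yy yr] : exists2 y, Y y & nm (y - alpha) = r / 4.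
  apply: contrapT => no.
  pose y1 : CC R := alpha + (d' / 4)%:C.
  have y1n : nm (y1 - alpha) = d' / 4.
    by rewrite /y1 addrC addKr nmR ger0_norm // divr_ge0 // ltW.
  have Yy1 : Y y1.
    by apply: DY; split; [rewrite y1n; lra | rewrite -subr_eq0 -nm_gt0 y1n divr_gt0].
  have Ysm z : Y z -> nm (z - alpha) < r / 4.
    move=> Yz; rewrite ltNge; apply/negP; rewrite le_eqVlt => /orP[/eqP h|h].
      by apply: no; exists z.
    apply: no; apply: (connected_meets_circle cY Yy1 Yz) => //.
    by rewrite y1n; rewrite /rho in drho; lra.
  have : ext E2 `<=` Y `|` [set alpha].
    apply: (@connected_local R (ext E2) _ alpha (ext_connected cE2) ea); first by right.
    - move=> z ez [Yz|->].
        have [e e0 he] := (openCP Y).1 oY z Yz.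
        by exists e => // w _ /he; left.
      exists d' => // w ew wd; have [->|wa] := eqVneq w alpha; first by right.
      by left; apply: DY.
    - move=> z ez nz; have [zbig|zsm] := ltP (r / 4) (nm (z - alpha)).
        exists (nm (z - alpha) - r / 4); first by rewrite subr_gt0.
        move=> w _ wz; have := nm_dist_tri w z alpha; rewrite (nm_distC z w).
        by move=> ? [/Ysm|/= wa]; [lra | move: wz; rewrite wa (nm_distC alpha z); lra].
      have za : z != alpha by apply/eqP => za; apply: nz; right.
      have Az : A z by split => //; split => //; rewrite /rho; lra.
      have [e e0 he] := (openCP A).1 oA z Az.
      exists e => // w _ wz [Yw|wa].
        apply: nz; left; apply: (connected_component_trans Yw).
        apply: (@connected_component_max _ A [set x | nm (x - z) < e] w wz he).
          exact: disk_connected.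
        by rewrite /= subrr nm0.
      by have [_ []] := he w wz; rewrite wa eqxx.
  move=> sub; have [z ez zb] := ext_unbounded cE2 (nm alpha + r).
  have zr := nm_leD z alpha.
  by case: (sub z ez) => [/Ysm|za]; [lra | move: zb; rewrite za; lra].
have [z1 [Uz1 fz1 z1R]] := hRK y yr.
have YV : Y `<=` cdisk alpha r `\ alpha.
  move=> z /YA[_ [zr za]]; split; last exact/eqP.
  by apply/cdiskE; rewrite /rho in zr; lra.
pose Z := connected_component (U `&` f @^-1` Y) z1.
have Yfz1 : Y (f z1) by rewrite fz1.
have YZ : Y `<=` f @` Z by exact: (tract_lift cov oY cY YV Uz1 Yfz1).
have Zz1 : Z z1 by apply: connected_component_refl; split; [exact: Uz1 | exact: Yfz1].
have cZ : connected Z by exact: component_connected.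
have ZU z : Z z -> U z /\ Y (f z) by move=> /connected_component_sub[].
(* [Y] contains a punctured disk about [alpha], so [f] comes arbitrarily close to [alpha] on [Z].
   Were [Z] bounded, a cluster point would lie in [U] and have value [alpha]. *)
have uZ : unboundedC Z.
  move=> M; apply: contrapT => noM.
  have ZM z : Z z -> nm z <= M.
    by move=> Zz; rewrite leNgt; apply/negP => h; apply: noM; exists z.
  have sel (n : nat) : exists z, Z z /\ nm (f z - alpha) < n.+1%:R^-1.
    pose t := Num.min (d' / 2) (n.+1%:R^-1 / 2).
    have n0 : 0 < n.+1%:R^-1 :> R by rewrite invr_gt0 ltr0n.
    have t0 : 0 < t by rewrite lt_min !divr_gt0.
    have t1 : t <= d' / 2 by rewrite ge_min lexx.
    have t2 : t <= n.+1%:R^-1 / 2 by rewrite ge_min lexx orbT.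
    have tn : nm (alpha + t%:C - alpha) = t by rewrite addrC addKr nmR gtr0_norm.
    have /YZ[z Zz fz] : Y (alpha + t%:C).
      by apply: DY; split; [rewrite tn; lra | rewrite -subr_eq0 -nm_gt0 tn].
    by exists z; split => //; rewrite fz tn; move: (n.+1%:R^-1) n0 t2 => x; lra.
  have [z hz] := choice sel.
  have zK n : [set z : CC R | nm (z - 0) <= M] (z n).
    by rewrite /= subr0; apply: ZM; exact: (hz n).1.
  have [v _ hv] := compact_seq_cluster (@compact_cdisc R 0 M) zK.
  have cUv : closure U v.
    apply/closureCP => e e0.
    have nb : nbhs v [set w | nm (w - v) < e] by apply/nbhsCP; exists e.
    have [n _ /= nv] := hv _ nb 0%N.
    by exists (z n) => //; have [] := ZU _ (hz n).1.
  have fv : f v = alpha.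
    apply/eqP; rewrite -subr_eq0 -nm_eq0 eq_le nm_ge0 andbT.
    apply/ler_addgt0Pl => e e0; rewrite addr0.
    have [d1 d10 hd1] := (contCP f v).1 (cf v) (e / 2) ltac:(by rewrite divr_gt0).
    have nb : nbhs v [set w | nm (w - v) < d1] by apply/nbhsCP; exists d1.
    have [N hN] := nat_gt_real (2 / e).
    have [n Nn /= /hd1 nv] := hv _ nb N.
    have hn : (n.+1%:R)^-1 <= e / 2.
      rewrite -[leRHS]invf_div lef_pV2 ?posrE ?ltr0n ?divr_gt0 //.
      by apply: le_trans (ltW hN) _; rewrite ler_nat ltnW.
    have zn := lt_le_trans (hz n).2 hn.
    by have := nm_dist_tri (f (z n)) (f v) alpha; rewrite (nm_distC (f v) (f (z n))); lra.
  have Uv : U v by apply: Uin => //; rewrite fv subrr nm0.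
  by have := fUa v Uv; rewrite fv eqxx.
have Zout z : Z z -> E z -> Rad <= nm z -> False.
  move=> Zz Ez zR; have [Uz Yfz] := ZU z Zz.
  have [efz [fzr _]] := YA _ Yfz.
  apply: (ext_disj efz); exists z => //; split => //; split => //; split.
    exact: subset_closure.
  by rewrite /=; rewrite /rho in fzr; lra.
have [M M0 EM] := compactC_bounded cE.
have [b Zb bM] := uZ (2 * M).
have eb : ext E b.
  apply: (@ext_far R E M); [exact: ltW | by move=> w /EM /ltW | exact: farC_big].
have clE : closed E by exact: compactC_closed.
(* [Z] could leave [ext E] only through a point of [E] of modulus at least [Rad], which [Zout]
   forbids; yet [z1] has modulus below [RK], too small for a point of [ext E]. *)
suff : Z `<=` ext E by move=> /(_ z1 Zz1) /hE; lra.
apply: (@connected_local R Z (ext E) b cZ Zb eb).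
- move=> z _ ez; have [e e0 he] := (openCP _).1 (ext_open clE) z ez.
  by exists e => // w _ /he.
- move=> z Zz nez.
  have ncl : ~ closure (ext E) z.
    move=> cz; have Ez : E z by apply: contrapT => nEz; apply: nez; exact: ext_closure.
    apply: (Zout z Zz Ez); apply/ler_addgt0Pl => e e0.
    have [w /hE wR wz] := (closureCP _ _).1 cz e e0.
    by have := nm_leD w z; lra.
  have oC : open (~` closure (ext E)) by apply: closed_openC; exact: closed_closure.
  have [e e0 he] := (openCP _).1 oC z ncl.
  by exists e => // w _ /he nw ew; apply: nw; exact: subset_closure.
Qed.

(** * Compacta that surround a Julia point *)

Lemma bungee_intro (R : realType) (f : CC R -> CC R) (x : CC R) (M0 : R) :
  (forall N, exists2 n, (N <= n)%N & nm (iter n f x) <= M0) ->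
  (forall M : R, exists n, M <= nm (iter n f x)) -> bungee f x.
Proof.
move=> h1 h2 [esc|[K [K0 bnd]]].
  have [N _ hN] := esc M0; have [n Nn nM] := h1 N.
  by have := hN n Nn; rewrite /= nmE ltcR ltNge nM.
by have [n nK] := h2 K; have := bnd n; rewrite nmE ltcR ltNge nK.
Qed.

Lemma bungee_low (R : realType) (f : CC R -> CC R) (x : CC R) : bungee f x ->
  exists M : R, forall N, exists2 n, (N <= n)%N & nm (iter n f x) <= M.
Proof.
move=> bx; apply: contrapT => /forallNP no; apply: bx; left => M.
have /existsNP[N hN] := no M; exists N => // n /= Nn; rewrite nmE ltcR ltNge.
by apply/negP => h; apply: hN; exists n.
Qed.

Lemma bungee_high (R : realType) (f : CC R -> CC R) (x : CC R) : bungee f x ->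
  forall (M : R) N, exists2 n, (N <= n)%N & M < nm (iter n f x).
Proof.
move=> bx M N; apply: contrapT => no; apply: bx; right.
pose S := \sum_(i < N) nm (iter i f x).
have S0 : 0 <= S by apply: sumr_ge0 => i _; exact: nm_ge0.
exists (`|M| + S + 1); split; first by have := normr_ge0 M; lra.
move=> n; rewrite nmE ltcR; have [Nn|nN] := leqP N n.
  have h : nm (iter n f x) <= M by rewrite leNgt; apply/negP => h; apply: no; exists n.
  by have := ler_norm M; lra.
have : nm (iter n f x) <= S.
  rewrite /S (bigD1 (Ordinal nN)) //= lerDl.
  by apply: sumr_ge0 => i _; exact: nm_ge0.
by have := normr_ge0 M; lra.
Qed.

Lemma bungee_iter (R : realType) (f : CC R -> CC R) (m : nat) (x : CC R) :
  bungee f (iter m f x) <-> bungee f x.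
Proof.
split=> bx; have [M hM] := bungee_low bx.
  apply: (@bungee_intro _ _ _ M).
    move=> N; have [n Nn nM] := hM N; exists (n + m)%N.
      by rewrite (leq_trans Nn) ?leq_addr.
    by rewrite iterD.
  by move=> T; have [n _ nT] := bungee_high bx T 0; exists (n + m)%N; rewrite iterD ltW.
apply: (@bungee_intro _ _ _ M).
  move=> N; have [n Nn nM] := hM (N + m)%N; exists (n - m)%N.
    by lia.
  by rewrite -iterD subnK // (leq_trans _ Nn) // leq_addl.
move=> T; have [n mn nT] := bungee_high bx T m.
by exists (n - m)%N; rewrite -iterD subnK // ltW.
Qed.

Lemma leq_strict_incr (phi : nat -> nat) :
  (forall n, (phi n < phi n.+1)%N) -> forall n, (n <= phi n)%N.
Proof. by move=> h; elim=> // n IH; exact: leq_ltn_trans IH (h n). Qed.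

(** A subsequential limit is finite at both points or infinite at both. So times at which the orbit
    of [x] stays bounded, or tends to infinity, give a subsequence of times with the same behaviour
    at [y]. *)
Lemma normal_bungee (R : realType) (f : CC R -> CC R) (U : set (CC R)) (x y : CC R) :
  normal_on U (fun n => iter n f) -> U x -> U y -> bungee f x -> bungee f y.
Proof.
move=> nU Ux Uy bx.
have sx : [set x] `<=` U by move=> _ ->.
have sy : [set y] `<=` U by move=> _ ->.
have lowy : exists M : R, forall N, exists2 n, (N <= n)%N & nm (iter n f y) <= M.
  have [M hM] := bungee_low bx.
  have [phi phiS hphi] := strict_incr_select (fun _ : nat => hM).
  have [psi [psiS [[g hg]|hi]]] := nU phi phiS.
    have [N0 _ h0] := hg _ sy (@compact_set1 _ y) 1 ltr01.
    exists (nm (g y) + 1) => N; exists (phi (psi (maxn N N0))).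
      apply: leq_trans (leq_strict_incr phiS _).
      by apply: leq_trans (leq_strict_incr psiS _); rewrite leq_maxl.
    have := h0 (maxn N N0) (leq_maxr _ _) y erefl; rewrite nmE ltcR => h.
    by have := nm_leD (iter (phi (psi (maxn N N0))) f y) (g y); lra.
  have [N0 _ h0] := hi _ sx (@compact_set1 _ x) M.
  have := h0 N0 (leqnn _) x erefl; rewrite nmE ltcR.
  by rewrite ltNge hphi.
have [M hM] := lowy; apply: (bungee_intro hM) => T.
have sel (k N : nat) : exists2 n, (N <= n)%N & k%:R < nm (iter n f x).
  exact: bungee_high bx k%:R N.
have [phi phiS hphi] := strict_incr_select sel.
have [psi [psiS [[g hg]|hi]]] := nU phi phiS.
  have [N0 _ h0] := hg _ sx (@compact_set1 _ x) 1 ltr01.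
  have [N1 hN1] := nat_gt_real (nm (g x) + 1).
  have := h0 (maxn N1 N0) (leq_maxr _ _) x erefl; rewrite nmE ltcR => h.
  have := nm_leD (iter (phi (psi (maxn N1 N0))) f x) (g x).
  have := hphi (psi (maxn N1 N0)).
  have : N1%:R <= (psi (maxn N1 N0))%:R :> R.
    by rewrite ler_nat (leq_trans (leq_maxl _ N0)) // leq_strict_incr.
  by move: ((psi (maxn N1 N0))%:R : R) => q; lra.
have [N0 _ h0] := hi _ sy (@compact_set1 _ y) T.
exists (phi (psi N0)).
by have := h0 N0 (leqnn _) y erefl; rewrite nmE ltcR => /ltW.
Qed.

Lemma cluster_le (R : realType) (g : CC R -> CC R) (x : nat -> CC R) (p b : CC R)
    (T : R) (N : nat) :
  {for p, continuous g} ->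
  (forall A, nbhs p A -> forall N, exists2 n, (N <= n)%N & A (x n)) ->
  (forall n, (N <= n)%N -> nm (g (x n) - b) <= T) -> nm (g p - b) <= T.
Proof.
move=> cg cl h; apply/ler_addgt0Pl => e e0.
have [d d0 hd] := (contCP g p).1 cg e e0.
have nb : nbhs p [set w | nm (w - p) < d] by apply/nbhsCP; exists d.
have [n Nn /= /hd nv] := cl _ nb N.
have := h n Nn; have := nm_dist_tri (g (x n)) (g p) b.
by rewrite (nm_distC (g p) (g (x n))); lra.
Qed.

Lemma cluster_ge (R : realType) (g : CC R -> CC R) (x : nat -> CC R) (p b : CC R)
    (T : R) (N : nat) :
  {for p, continuous g} ->
  (forall A, nbhs p A -> forall N, exists2 n, (N <= n)%N & A (x n)) ->
  (forall n, (N <= n)%N -> T <= nm (g (x n) - b)) -> T <= nm (g p - b).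
Proof.
move=> cg cl h; apply/ler_addgt0Pl => e e0.
have [d d0 hd] := (contCP g p).1 cg e e0.
have nb : nbhs p [set w | nm (w - p) < d] by apply/nbhsCP; exists d.
have [n Nn /= /hd nv] := cl _ nb N.
by have := h n Nn; have := nm_dist_tri (g p) (g (x n)) b; lra.
Qed.

Lemma julia_inside_bungee (R : realType) (f : CC R -> CC R) (alpha z0 : CC R) (r : R)
    (E : set (CC R)) (p : CC R) :
  entire f -> 0 < r ->
  covering_map (tract f alpha r z0) (cdisk alpha r `\ alpha) f ->
  julia f alpha -> compact E -> julia f p -> inside E p -> E `&` bungee f !=set0.
Proof.
move=> ef r0 cov Ja cE Jp ip.
have cfn n : continuous (iter n f).
  by move=> z; apply: derivable_continuousC; exact: derivable_iter.
have [RK hRK] := tract_step ef r0 cov.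
pose good (E : set (CC R)) := compact E /\ exists2 p, julia f p & inside E p.
(* A state pairs a compact set with a number: in [q] the height to be reached, in [q'] the number of
   iterations that reaches it. One more application of [f] then lands near [alpha], the Julia point
   surrounded by the new set. *)
pose link (q : set (CC R) * nat) (q' : set (CC R) * nat) := good q.1 ->
  good q'.1 /\ forall y, q'.1 y -> nm (y - alpha) <= r / 2 /\
    exists x, [/\ q.1 x, q.2%:R <= nm (iter q'.2 f x) & iter q'.2.+1 f x = y].
have [nx hnx] : {nx : set (CC R) * nat -> set (CC R) * nat & forall q, link q (nx q)}.
  apply: (choice (P := link)) => -[E' k].
  have [g|ng] := pselect (good E'); last by exists (E', k) => /ng.
  have [cE' [p' Jp' ip']] := g.
  pose Rad := Num.max (Num.max RK k%:R) 0.
  have Rad0 : 0 <= Rad by rewrite le_max lexx orbT.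
  have RadK : RK <= Rad by rewrite !le_max lexx.
  have Radk : k%:R <= Rad by rewrite !le_max lexx !orbT.
  have [n hn] := julia_blowup ef cE' Jp' ip' Rad0.
  have cfE := compact_image (cfn n) cE'.
  have [E2 [cE2 iE2 hE2]] := hRK _ Rad cfE RadK hn.
  exists (E2, n) => _ /=; split; first by split => //; exists alpha.
  move=> y /hE2[ya [x [[x' Ex' <-] xR fx]]]; split => //.
  by exists x'; split => //; exact: le_trans xR.
pose Es := fix Es k := if k is k'.+1 then (nx (Es k', k')).1 else E.
pose ns k := (nx (Es k, k)).2.
(* The total time from [E] to [Es k]. It depends on the sets alone, so all points pulled back to [E]
   share the same times and the inequalities pass to a cluster point. *)
pose T := fix T k := if k is k'.+1 then (ns k' + (T k')).+1 else 0%N.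
have gE k : good (Es k).
  elim: k => [|k IH]; first by split => //; exists p.
  by have [] := hnx (Es k, k) IH.
have back k : forall y, Es k y -> exists x, [/\ E x, iter (T k) f x = y &
    forall j, (j < k)%N -> j%:R <= nm (iter (ns j + T j) f x) /\
      nm (iter (T j.+1) f x - alpha) <= r / 2].
  elim: k => [|k IH] y Ey; first by exists y.
  have [_ /(_ y Ey)[ya [x' [Ex' xk fx']]]] := hnx (Es k, k) (gE k).
  have [x [Ex fx hx]] := IH x' Ex'.
  have fT : iter (T k.+1) f x = y.
    by rewrite -fx' -fx -iterD.
  exists x; split => // j; rewrite ltnS leq_eqVlt => /orP[/eqP ->|jk]; last exact: hx.
  split; last by rewrite fT.
  by rewrite iterD fx; exact: xk.
have ne k : exists y, Es k y.
  by have [cEk [p' _ ip']] := gE k; have [y] := inside_nonempty cEk ip'; exists y.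
have sel k : exists x, E x /\ forall j, (j < k)%N ->
    j%:R <= nm (iter (ns j + T j) f x) /\ nm (iter (T j.+1) f x - alpha) <= r / 2.
  by have [y /back[x [Ex _ hx]]] := ne k; exists x.
have [x hx] := choice sel.
have xE n : E (x n) by have [] := hx n.
have [v Ev hv] := compact_seq_cluster cE xE.
exists v; split; first exact: Ev.
have low j : nm (iter (T j.+1) f v - alpha) <= r / 2.
  apply: (@cluster_le R (iter (T j.+1) f) x v alpha _ j.+1 (@cfn _ v) hv) => n jn.
  by have [_ /(_ j jn)[]] := hx n.
have high j : j%:R <= nm (iter (ns j + T j) f v).
  rewrite -[X in nm X]subr0.
  apply: (@cluster_ge R (iter (ns j + T j) f) x v 0 _ j.+1 (@cfn _ v) hv) => n jn.
  by have [_ /(_ j jn)[]] := hx n; rewrite subr0.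
have Tk k : (k <= T k)%N.
  elim: k => [|k IH]; first exact: leq0n.
  exact: leq_trans IH (leq_addl (ns k) (T k)).
apply: (@bungee_intro _ _ _ (nm alpha + r)).
  move=> N; exists (T N.+1); first exact: leq_trans (leqnSn N) (Tk _).
  by have := low N; have := nm_leD (iter (T N.+1) f v) alpha; lra.
move=> M; have [j hj] := nat_gt_real M; exists (ns j + T j)%N.
exact: le_trans (ltW hj) (high j).
Qed.

(** * Barriers *)

(** If [h z0 <= eps] and [h >= 1] on part of the boundary, that part has harmonic measure at most
    [eps] seen from [z0]. *)
Definition barrier (R : realType) (G : set (CC R)) (h : CC R -> R) :=
  [/\ forall z, closure G z -> {for z, continuous h},
      forall z, G z -> harm_at h z & forall z, closure G z -> 0 <= h z].

Lemma ln3_le2 (R : realType) : ln (3 : R) <= 2.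
Proof. by have := @le_ln1Dx R 2 ltac:(lra); have -> : 1 + 2 = 3 :> R by ring. Qed.

Lemma ln4_le2 (R : realType) : ln (4 : R) <= 2.
Proof.
have -> : (4 : R) = 2 * 2 by ring.
by rewrite lnM ?posrE //; have := ln2_le1 R; lra.
Qed.

Lemma ln_expR_quot (R : realType) (a x : R) : 0 < a -> ln (a * expR x / a) = x.
Proof. by move=> a0; rewrite mulrAC divff ?gt_eqF // mul1r expRK. Qed.

(** With poles at scale [S = a * expR (8 / eps)], the function [H] adds a constant to the potential
    minus [ln |g - c|]. Where [|g - c| <= a] it exceeds [ln S - ln a = 8 / eps]; at [z0] each pole
    is within [3 * |g z0 - c|], so [H <= ln 3 + 4 + ln 4 <= 8]. Hence the factor [eps / 8]. *)
Lemma barrier_near (R : realType) (G Q : set (CC R)) (g : CC R -> CC R) (c z0 : CC R)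
    (a eps : R) :
  (forall z, derivable g z 1) -> open Q -> connected Q -> unboundedC Q -> Q c ->
  (forall z, closure G z -> ~ Q (g z)) -> G z0 -> 0 < a -> 0 < eps ->
  a * expR (8 / eps) <= nm (g z0 - c) ->
  exists h, [/\ barrier G h, h z0 <= eps &
    forall z, closure G z -> nm (g z - c) <= a -> 1 <= h z].
Proof.
move=> dg oQ cQ uQ Qc GQ Gz0 a0 e0 big.
pose S := a * expR (8 / eps).
have S0 : 0 < S by rewrite mulr_gt0 // expR_gt0.
have lnSa : ln S - ln a = 8 / eps.
  by rewrite -ln_div ?posrE // ln_expR_quot.
have [N [k [N0 Qk kr lo]]] := @escape_pot R Q (g @` closure G) c S oQ cQ uQ Qc S0
  ltac:(by move=> _ [w wr <-]; exact: GQ).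
have neq w : closure G w -> forall i, (i < N)%N -> g w != k i.
  by move=> wr i iN; apply/eqP => h; apply: (GQ w wr); rewrite h; exact: Qk.
have neqc w : closure G w -> g w != c.
  by move=> wr; apply/eqP => h; apply: (GQ w wr); rewrite h.
have cg z : {for z, continuous g} by exact/derivable_continuousC/dg.
pose H (z : CC R) := pot N k (g z) + (4 + ln 4) + -1 * ln (nm (g z - c)).
have l2 := ln2_ge R; have l4 := ln4_le2 R; have l3 := ln3_le2 R.
have l4' : 0 <= ln (4 : R) by rewrite ln_ge0 // ler1n.
have pos z : closure G z -> 0 < nm (g z - c).
  by move=> cz; rewrite nm_gt0 subr_eq0; exact: neqc.
have H0 z : closure G z -> 0 <= H z.
  move=> cz; have rho0 := pos z cz; have [sm|bg] := leP (nm (g z - c)) (4 * S).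
    have h1 := lo (g z) ltac:(by exists z).
    have : ln (nm (g z - c)) <= ln (4 * S) by rewrite ler_ln ?posrE // mulr_gt0.
    by rewrite lnM ?posrE // /H; lra.
  have : ln (nm (g z - c) / 2) <= pot N k (g z).
    apply: pot_ge => //; first by rewrite divr_gt0.
    by move=> i iN; have /andP[_ h] := kr i iN; have := nm_dist_tri (k i) (g z) c; lra.
  have l2' := ln2_le1 R.
  by rewrite ln_div ?posrE // /H; lra.
pose q := eps / 8; have q0 : 0 < q by rewrite divr_gt0.
exists (fun z => q * H z); split.
- split.
  + move=> z cz; apply: contCR_Z; apply: contCR_D; last first.
      by apply: contCR_Z; exact: (cont_ln_sub (@cg z) (neqc z cz)).
    apply: contCR_D; last exact: contCR_cst.
    exact: (pot_cont (@cg z) (neq z cz)).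
  + move=> z Gz; have cz := subset_closure Gz; apply: harm_atZ; apply: harm_atD; last first.
      by apply: harm_atZ; exact: (harm_ln_sub ltr01 (fun w _ => dg w) (neqc z cz)).
    apply: harm_atD; last exact: harm_at_cst.
    exact: (pot_harm ltr01 (fun w _ => dg w) (neq z cz)).
  + by move=> z cz; rewrite mulr_ge0 ?H0 // ltW.
- have cz := subset_closure Gz0; have rho0 := pos _ cz.
  have : pot N k (g z0) <= ln (3 * nm (g z0 - c)).
    apply: pot_le => // i iN; rewrite nm_gt0 subr_eq0 neq //=.
    have /andP[_ h] := kr i iN; have := nm_dist_tri c (g z0) (k i).
    by rewrite (nm_distC c (k i)) -/S in big *; lra.
  rewrite lnM ?posrE // => h.
  have : H z0 <= 8 by rewrite /H; lra.
  by rewrite -ler_pdivlMl //; congr (_ <= _); rewrite /q; field; rewrite gt_eqF.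
- move=> z cz za; have rho0 := pos z cz.
  have h1 := lo (g z) ltac:(by exists z).
  have h2 : ln (nm (g z - c)) <= ln a by rewrite ler_ln ?posrE.
  have : 8 / eps <= H z by rewrite /H; lra.
  rewrite -[1 <= _](ler_pM2l (_ : 0 < 8 / eps)) ?divr_gt0 //.
  by congr (_ <= _); rewrite /q; field; rewrite gt_eqF.
Qed.

(** Here the potential at scale [a], shifted by [4 - ln a], suffices: at [z0] it is at most
    [ln 3 + 4], and far from [c] it grows like [ln (|g - c| / 2)]. The bound [eps <= 1] puts the
    threshold beyond [4 * a], where this growth estimate holds. *)
Lemma barrier_far (R : realType) (G Q : set (CC R)) (g : CC R -> CC R) (c z0 : CC R)
    (a eps : R) :
  (forall z, derivable g z 1) -> open Q -> connected Q -> unboundedC Q -> Q c ->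
  (forall z, closure G z -> ~ Q (g z)) -> G z0 -> 0 < a -> 0 < eps <= 1 ->
  nm (g z0 - c) <= a ->
  exists h, [/\ barrier G h, h z0 <= eps &
    forall z, closure G z -> 2 * a * expR (8 / eps) <= nm (g z - c) -> 1 <= h z].
Proof.
move=> dg oQ cQ uQ Qc GQ Gz0 a0 /andP[e0 e1] sml.
have [N [k [N0 Qk kr lo]]] := @escape_pot R Q (g @` closure G) c a oQ cQ uQ Qc a0
  ltac:(by move=> _ [w wr <-]; exact: GQ).
have neq w : closure G w -> forall i, (i < N)%N -> g w != k i.
  by move=> wr i iN; apply/eqP => h; apply: (GQ w wr); rewrite h; exact: Qk.
have cg z : {for z, continuous g} by exact/derivable_continuousC/dg.
pose H (z : CC R) := pot N k (g z) + (4 - ln a).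
have l3 := ln3_le2 R.
have H0 z : closure G z -> 0 <= H z.
  by move=> cz; have := lo (g z) ltac:(by exists z); rewrite /H; lra.
pose q := eps / 8; have q0 : 0 < q by rewrite divr_gt0.
exists (fun z => q * H z); split.
- split.
  + move=> z cz; apply: contCR_Z; apply: contCR_D; last exact: contCR_cst.
    exact: (pot_cont (@cg z) (neq z cz)).
  + move=> z Gz; have cz := subset_closure Gz; apply: harm_atZ.
    apply: harm_atD; last exact: harm_at_cst.
    exact: (pot_harm ltr01 (fun w _ => dg w) (neq z cz)).
  + by move=> z cz; rewrite mulr_ge0 ?H0 // ltW.
- have cz := subset_closure Gz0.
  have : pot N k (g z0) <= ln (3 * a).
    apply: pot_le => // i iN; rewrite nm_gt0 subr_eq0 neq //=.
    have /andP[_ h] := kr i iN; have := nm_dist_tri c (g z0) (k i).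
    by rewrite (nm_distC c (k i)); lra.
  rewrite lnM ?posrE // => h.
  have : H z0 <= 8 by rewrite /H; lra.
  by rewrite -ler_pdivlMl //; congr (_ <= _); rewrite /q; field; rewrite gt_eqF.
- move=> z cz za; have x0 := expR_gt0 (8 / eps).
  have e9 : 9 <= expR (8 / eps).
    apply: le_trans (expR_ge1Dx _).
    have : 8 <= 8 / eps by rewrite ler_pdivlMr // -[leRHS]mulr1 ler_pM2l.
    by lra.
  have big : 4 * a <= nm (g z - c).
    apply: le_trans za; have : 2 * a * 9 <= 2 * a * expR (8 / eps).
      by rewrite ler_pM2l // mulr_gt0.
    by lra.
  have h1 : ln (nm (g z - c) / 2) <= pot N k (g z).
    apply: pot_ge => //; first by rewrite divr_gt0 //; lra.
    by move=> i iN; have /andP[_ h] := kr i iN; have := nm_dist_tri (k i) (g z) c; lra.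
  have h2 : ln (a * expR (8 / eps)) <= ln (nm (g z - c) / 2).
    have n2 : 0 < nm (g z - c) / 2 by rewrite divr_gt0 //; lra.
    have n3 : 0 < a * expR (8 / eps) by rewrite mulr_gt0.
    rewrite ler_ln ?posrE //.
    by rewrite ler_pdivlMr // mulrC mulrA.
  have h3 : 8 / eps <= H z.
    by rewrite /H; move: h2; rewrite lnM ?posrE // expRK; lra.
  move: h3; rewrite -[1 <= _](ler_pM2l (_ : 0 < 8 / eps)) ?divr_gt0 //.
  by congr (_ <= _); rewrite /q; field; rewrite gt_eqF.
Qed.

Lemma sum_geom_lt (R : realType) (k : nat) :
  \sum_(i < k) ((2^-1 : R) ^+ i.+3 + 2^-1 ^+ i.+3) < 1.
Proof.
have -> : \sum_(i < k) ((2^-1 : R) ^+ i.+3 + 2^-1 ^+ i.+3) = 2^-1 - 2^-1 ^+ k.+1.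
  elim: k => [|k IH]; first by rewrite big_ord0 expr1 subrr.
  by rewrite big_ord_recr /= IH !exprS; field.
have : 0 < (2^-1 : R) ^+ k.+1 by rewrite exprn_gt0.
by lra.
Qed.

(** Otherwise the sum of all barriers would be at least 1 on the boundary, hence at [z0] by the
    minimum principle, whereas there it is below 1. *)
Lemma barrier_selection (R : realType) (G : set (CC R)) (B : R) (z0 : CC R)
    (h h' : nat -> CC R -> R) (k : nat) :
  open G -> (forall z, G z -> nm z <= B) -> G z0 ->
  (forall i, barrier G (h i)) -> (forall i, barrier G (h' i)) ->
  (forall i, h i z0 <= 2^-1 ^+ i.+3) -> (forall i, h' i z0 <= 2^-1 ^+ i.+3) ->
  exists z, [/\ closure G z, ~ G z & forall i, (i < k)%N -> h i z < 1 /\ h' i z < 1].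
Proof.
move=> oG bG Gz0 bh bh' hz0 h'z0; apply: contrapT => no.
pose u i (z : CC R) := h i z + h' i z.
have bd z : closure G z -> ~ G z -> -1 * \sum_(i < k) u i z <= -1.
  move=> cz nGz; suff : 1 <= \sum_(i < k) u i z by lra.
  have u0 i : 0 <= u i z.
    by have [_ _ p1] := bh i; have [_ _ p2] := bh' i; rewrite addr_ge0 ?p1 ?p2.
  have [i ik hi] : exists2 i, (i < k)%N & 1 <= u i z.
    apply: contrapT => no'; apply: no; exists z; split => // i ik.
    have [_ _ p1] := bh i; have [_ _ p2] := bh' i.
    have := p1 z cz; have := p2 z cz.
    have : u i z < 1 by rewrite ltNge; apply/negP => ?; apply: no'; exists i.
    by rewrite /u => ? ? ?; split; lra.
  rewrite (bigD1 (Ordinal ik)) //=; apply: le_trans hi _; rewrite lerDl.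
  by apply: sumr_ge0 => j _; exact: u0.
have := @max_principle R (fun z => -1 * \sum_(i < k) u i z) G B (-1) oG bG.
have hc z : closure G z -> {for z, continuous (fun z => -1 * \sum_(i < k) u i z)}.
  move=> cz; apply: contCR_Z; apply: contCR_sum => i _.
  have [c1 _ _] := bh i; have [c2 _ _] := bh' i.
  exact: (contCR_D (c1 z cz) (c2 z cz)).
have hh z : G z -> harm_at (fun z => -1 * \sum_(i < k) u i z) z.
  move=> Gz; apply: harm_atZ; apply: harm_at_sum => i _.
  have [_ c1 _] := bh i; have [_ c2 _] := bh' i.
  exact: (harm_atD (c1 z Gz) (c2 z Gz)).
move=> /(_ hc hh bd z0 Gz0).
have : \sum_(i < k) u i z0 < 1.
  apply: le_lt_trans (sum_geom_lt R k); apply: ler_sum => i _.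
  by apply: lerD.
by lra.
Qed.

(** * Boundaries of bounded open sets *)

Lemma closure_bounded (R : realType) (U : set (CC R)) (B : R) :
  (forall z, U z -> nm z <= B) -> forall z, closure U z -> nm z <= B.
Proof.
move=> bU z /closureCP cz; apply/ler_addgt0Pr => e e0.
by have [w /bU wB wz] := cz e e0; have := nm_leD z w; rewrite nm_distC; lra.
Qed.

Lemma bdry_compact (R : realType) (U : set (CC R)) (B : R) :
  open U -> (forall z, U z -> nm z <= B) -> compact (closure U `&` ~` U).
Proof.
move=> oU bU; apply: (@bounded_closed_compactC R _ B).
  by apply: closedI; [exact: closed_closure | exact: open_closedC].
by move=> z [cz _]; exact: (closure_bounded bU cz).
Qed.

(** A connected set that starts in [U] and avoids its boundary stays in [U], so it cannot be
    unbounded. *)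
Lemma sub_inside_bdry (R : realType) (U : set (CC R)) (B : R) :
  open U -> (forall z, U z -> nm z <= B) -> U `<=` inside (closure U `&` ~` U).
Proof.
move=> oU bU z Uz.
apply: inside_intro; first exact: compactC_closed (bdry_compact oU bU).
  by move=> [].
move=> [C [cC Cz uC CE]].
have CU : C `<=` U.
  apply: (@connected_local R C U z cC Cz Uz).
  - move=> w _ Uw; have [r r0 hr] := (openCP U).1 oU w Uw.
    by exists r => // y _; exact: hr.
  - move=> w Cw nUw.
    have ncl : (~` closure U) w by move=> cw; apply: (CE w Cw).
    have oC : open (~` closure U) by apply: closed_openC; exact: closed_closure.
    have [r r0 hr] := (openCP _).1 oC w ncl.
    by exists r => // y _ /hr ncy Uy; apply: ncy; exact: subset_closure.
have [w Cw wB] := uC B.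
by move: wB; rewrite ltNge bU //; exact: CU.
Qed.

(* Two visits of the orbit near a Fatou limit point would make some f^p map the
   bounded set f^n1(G) into itself. *)
Lemma bungee_limit_julia (R : realType) (f : CC R -> CC R) (G : set (CC R)) (B : R)
    (z0 w : CC R) :
  entire f -> open G -> connected G -> (forall z, G z -> nm z <= B) ->
  (forall z, G z -> bungee f z) ->
  (forall z, closure G z -> ~ G z -> ~ bungee f z) -> G z0 ->
  (forall (e : R) N, 0 < e -> exists2 n, (N <= n)%N & nm (iter n f z0 - w) < e) ->
  julia f w.
Proof.
move=> ef oG cG bG Gb bdG Gz0 acc [V [oV [Vw nV]]].
have dfn n z : derivable (iter n f) z 1 by exact: derivable_iter.
have cfn n : continuous (iter n f) by move=> z; exact/derivable_continuousC/dfn.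
have [e e0 he] := (openCP V).1 oV w Vw.
pose N := [set y : CC R | nm (y - w) < e].
have [n1 _ N1] := acc e 0%N e0.
have [n2 n12 N2] := acc e n1.+1 e0.
have bit n z : bungee f z -> bungee f (iter n f z) by move=> ?; apply/bungee_iter.
have Nb y : N y -> bungee f y.
  move=> Ny; apply: (@normal_bungee R f V (iter n1 f z0) y nV).
  - exact: he.
  - exact: he.
  - exact/bit/Gb.
have NG : N `<=` iter n1 f @` G.
  apply: (@image_clopen R (iter n1 f) G N B z0 oG bG (dfn n1)) => //.
    exact: disk_connected.
  by move=> z cz nGz /Nb /bungee_iter; exact: bdG.
have [z1 Gz1 fz1] := NG _ N2.
have GG : iter n2 f @` G `<=` iter n1 f @` G.
  apply: (@image_clopen R (iter n1 f) G (iter n2 f @` G) B z1 oG bG (dfn n1)) => //.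
  - apply: (connected_continuous_connected cG).
    by apply: continuous_subspaceT; exact: cfn.
  - move=> z cz nGz [y Gy fy]; apply: (bdG z cz nGz); apply/(bungee_iter f n1).
    by rewrite -fy; exact/bit/Gb.
  - by rewrite fz1; exists z0.
pose p := (n2 - n1)%N.
have p0 : (0 < p)%N by rewrite subn_gt0.
(* Whenever [i] reaches [p], the inclusion [GG] resets it to 0. The orbit of [z0] thus stays in
   finitely many bounded sets, although [z0] is a bungee point. *)
have orbit n : exists i y, [/\ (i < p)%N, G y & iter (n + n1) f z0 = iter (i + n1) f y].
  elim: n => [|n [i [y [ip Gy fy]]]]; first by exists 0%N, z0.
  have [ip'|pi] := ltnP i.+1 p.
    by exists i.+1, y; split => //; rewrite !addSn !iterS fy.
  have [y' Gy' fy'] : (iter n1 f @` G) (iter n2 f y) by apply: GG; exists y.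
  exists 0%N, y'; split => //.
  have -> : iter (n.+1 + n1) f z0 = iter n2 f y.
    have -> : n2 = (i + n1).+1 by move: pi ip n12; rewrite /p; lia.
    by rewrite addSn !iterS fy.
  by rewrite fy'.
have [b hb] : {b : nat -> R & forall m z, G z -> nm (iter m f z) <= b m}.
  apply: (choice (P := fun m b => forall z, G z -> nm (iter m f z) <= b)) => m.
  have [T _ hT] := compactC_bounded (compact_image (cfn m) (@compact_cdisc R 0 B)).
  exists T => z Gz; apply/ltW/hT; exists z => //=.
  by rewrite subr0; exact: bG.
pose T := \sum_(i < p) `|b (i + n1)%N|.
have [n nn1 nT] := bungee_high (Gb _ Gz0) T n1.
have [i [y [ip Gy fy]]] := orbit (n - n1)%N.
move: nT; rewrite -(subnK nn1) fy ltNge => /negP; apply.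
apply: le_trans (hb _ _ Gy) _; apply: le_trans (ler_norm _) _.
by rewrite /T (bigD1 (Ordinal ip)) //= lerDl; apply: sumr_ge0.
Qed.

Lemma bungee_boundary (R : realType) (f : CC R -> CC R) (U : set (CC R)) (B : R) (z0 : CC R) :
  entire f ->
  (forall E p, compact E -> julia f p -> inside E p -> E `&` bungee f !=set0) ->
  open U -> (forall z, U z -> nm z <= B) -> U z0 -> bungee f z0 ->
  exists z, [/\ closure U z, ~ U z & bungee f z].
Proof.
move=> ef HJ oU bU Uz0 bz0; apply: contrapT => no.
have bdU z : closure U z -> ~ U z -> ~ bungee f z.
  by move=> cz nUz bz; apply: no; exists z.
have dfn n z : derivable (iter n f) z 1 by exact: derivable_iter.
have cfn n : continuous (iter n f) by move=> z; exact/derivable_continuousC/dfn.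
have UF p : U p -> ~ julia f p.
  move=> Up Jp.
  have [z [[cz nUz] bz]] := HJ _ p (bdry_compact oU bU) Jp (sub_inside_bdry oU bU Up).
  exact: (bdU z cz nUz bz).
pose A := U `&` bungee f.
have oA : open A.
  apply/openCP => z [Uz bz].
  have /contrapT[V [oV [Vz nV]]] : ~ ~ (exists V, open V /\ V z /\
    normal_on V (fun n => iter n f)) by exact: UF.
  have [r1 r10 h1] := (openCP U).1 oU z Uz.
  have [r2 r20 h2] := (openCP V).1 oV z Vz.
  exists (Num.min r1 r2); first by rewrite lt_min r10.
  move=> w; rewrite lt_min => /andP[/h1 Uw /h2 Vw]; split; first exact: Uw.
  exact: (normal_bungee nV Vz Vw bz).
pose G := connected_component A z0.
have Gz0 : G z0 by apply: connected_component_refl; split.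
have oG : open G by exact: component_openC.
have cG : connected G by exact: component_connected.
have GA z : G z -> A z by exact: connected_component_sub.
have bG z : G z -> nm z <= B by move=> /GA[/bU].
have Gb z : G z -> bungee f z by move=> /GA[].
have bdG z : closure G z -> ~ G z -> ~ bungee f z.
  move=> cz nGz bz; have [Uz|nUz] := pselect (U z).
    by apply: nGz; exact: (component_mem_closure oA cz (conj Uz bz)).
  apply: (bdU z _ nUz bz); apply/closureCP => e e0.
  have [w Gw wz] := (closureCP _ _).1 cz e e0.
  by exists w => //; have [] := GA w Gw.
have [w acc] : exists w, forall (e : R) N, 0 < e ->
    exists2 n, (N <= n)%N & nm (iter n f z0 - w) < e.
  have [M hM] := bungee_low bz0.
  have [phi phiS hphi] := strict_incr_select (fun _ : nat => hM).
  have xK n : [set z : CC R | nm (z - 0) <= M] (iter (phi n) f z0).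
    by rewrite /= subr0; exact: hphi.
  have [w _ hw] := compact_seq_cluster (@compact_cdisc R 0 M) xK.
  exists w => e N e0.
  have nb : nbhs w [set y | nm (y - w) < e] by apply/nbhsCP; exists e.
  have [n Nn /= nw] := hw _ nb N.
  by exists (phi n) => //; exact: leq_trans Nn (leq_strict_incr phiS n).
have Jw := bungee_limit_julia ef oG cG bG Gb bdG Gz0 acc.
have cbd := bdry_compact oG bG; set bd := closure G `&` ~` G in cbd.
have cfbd n := compact_image (cfn n) cbd.
(* If [w] were inside the image of the boundary, that image would contain a bungee point, and so
   would the boundary. Hence omitted sets come arbitrarily near [w], which supplies the centres [c]
   of the barriers. *)
have clext n : closure (ext (iter n f @` bd)) w.
  apply: contrapT => iw.
  have [_ [[z [cz nGz] <-] /bungee_iter]] := HJ _ w (cfbd n) Jw iw.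
  exact: (bdG z cz nGz).
have omit n z : closure G z -> ~ ext (iter n f @` bd) (iter n f z).
  move=> cz; have [Gz|nGz] := pselect (G z); last first.
    by move=> /ext_disj; apply; exists z; [split | exact: erefl].
  by apply: (ext_image_disj (dfn n) cbd); exact: (sub_inside_bdry oG bG Gz).
have oQ n : open (ext (iter n f @` bd)) by exact: (ext_open (compactC_closed (cfbd n))).
have cQ n : connected (ext (iter n f @` bd)) by exact: (ext_connected (cfbd n)).
have uQ n : unboundedC (ext (iter n f @` bd)) by exact: (ext_unbounded (cfbd n)).
pose eps i : R := 2^-1 ^+ i.+3.
have eps0 i : 0 < eps i by rewrite exprn_gt0.
have eps1 i : eps i <= 1 by rewrite exprn_ile1 // invf_le1 // ler1n.
(* Times at which [z0] is far from [w]; the barrier penalizes boundary points still within [i] of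
   [w]. The radius [i + 1] allows for the distance from [c] to [w], less than 1. *)
have [nh hnh] : {nh : nat -> nat * (CC R -> R) & forall i, [/\ (i <= (nh i).1)%N,
    barrier G (nh i).2, (nh i).2 z0 <= eps i &
    forall z, closure G z -> nm (iter (nh i).1 f z - w) <= i%:R -> 1 <= (nh i).2 z]}.
  apply: (choice (P := fun i (q : nat * (CC R -> R)) => [/\ (i <= q.1)%N,
    barrier G q.2, q.2 z0 <= eps i &
    forall z, closure G z -> nm (iter q.1 f z - w) <= i%:R -> 1 <= q.2 z])) => i.
  pose a : R := i%:R + 1.
  have a0 : 0 < a by rewrite ltr_pwDr.
  have [n inn big] := bungee_high bz0 (a * expR (8 / eps i) + nm w + 1) i.
  have [c ec cw] := (closureCP _ _).1 (clext n) 1 ltr01.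
  have big' : a * expR (8 / eps i) <= nm (iter n f z0 - c).
    have := nm_leD (iter n f z0) c; have := nm_leD c w; lra.
  have [h [bh hz0 h1]] := barrier_near (dfn n) (oQ n) (cQ n) (uQ n) ec (omit n) Gz0 a0
    (eps0 i) big'.
  exists (n, h); split => // z cz zi; apply: h1 => //.
  rewrite /= in zi; have := nm_dist_tri w (iter n f z) c; rewrite (nm_distC w c) /a.
  by lra.
have [mh hmh] : {mh : nat -> nat * (CC R -> R) & forall i, [/\ (i <= (mh i).1)%N,
    barrier G (mh i).2, (mh i).2 z0 <= eps i &
    forall z, closure G z -> 1 <= nm (iter (mh i).1 f z - w) -> 1 <= (mh i).2 z]}.
  apply: (choice (P := fun i (q : nat * (CC R -> R)) => [/\ (i <= q.1)%N,
    barrier G q.2, q.2 z0 <= eps i &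
    forall z, closure G z -> 1 <= nm (iter q.1 f z - w) -> 1 <= q.2 z])) => i.
  pose x := expR (8 / eps i); have x0 : 0 < x by exact: expR_gt0.
  (* This puts the threshold of [barrier_far] at [1/2], and [c] is within [1/2] of [w]: a point at
     distance at least 1 from [w] is penalized. *)
  pose a : R := (4 * x)^-1.
  have a0 : 0 < a by rewrite invr_gt0 mulr_gt0.
  have ax : 2 * a * x = 1 / 2 by rewrite /a; field; rewrite gt_eqF.
  pose d := Num.min (a / 2) (1 / 2).
  have d0 : 0 < d by rewrite lt_min !divr_gt0.
  have da : d <= a / 2 by rewrite ge_min lexx.
  have d2 : d <= 1 / 2 by rewrite ge_min lexx orbT.
  have [n inn sml] := acc d i d0.
  have [c ec cw] := (closureCP _ _).1 (clext n) d d0.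
  have sml' : nm (iter n f z0 - c) <= a.
    by have := nm_dist_tri w (iter n f z0) c; rewrite (nm_distC w c); lra.
  have eps01 : 0 < eps i <= 1 by rewrite eps0 eps1.
  have [h [bh hz0 h1]] := barrier_far (dfn n) (oQ n) (cQ n) (uQ n) ec (omit n) Gz0 a0
    eps01 sml'.
  exists (n, h); split => // z cz zi; apply: h1 => //.
  rewrite -/x ax; rewrite /= in zi.
  by have := nm_dist_tri c (iter n f z) w; lra.
have sel k : exists z, bd z /\ forall i, (i < k)%N ->
    i%:R <= nm (iter (nh i).1 f z - w) /\ nm (iter (mh i).1 f z - w) <= 1.
  have [||||z [cz nGz hz]] := @barrier_selection R G B z0 (fun i => (nh i).2)
    (fun i => (mh i).2) k oG bG Gz0.
  - by move=> i; have [] := hnh i.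
  - by move=> i; have [] := hmh i.
  - by move=> i; have [] := hnh i.
  - by move=> i; have [] := hmh i.
  exists z; split; first by split.
  move=> i ik; have [h1 h2] := hz i ik.
  have [_ _ _ g1] := hnh i; have [_ _ _ g2] := hmh i; split.
    by rewrite leNgt; apply/negP => /ltW /(g1 z cz); rewrite leNgt h1.
  by rewrite leNgt; apply/negP => /ltW /(g2 z cz); rewrite leNgt h2.
have [x hx] := choice sel.
have xbd n : bd (x n) by have [] := hx n.
have [v [cv nGv] hv] := compact_seq_cluster cbd xbd.
apply: (bdG v cv nGv).
have low j : nm (iter (mh j).1 f v - w) <= 1.
  apply: (@cluster_le R (iter (mh j).1 f) x v w _ j.+1 (@cfn _ v) hv) => n jn.
  by have [_ /(_ j jn)[]] := hx n.
have high j : j%:R <= nm (iter (nh j).1 f v - w).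
  apply: (@cluster_ge R (iter (nh j).1 f) x v w _ j.+1 (@cfn _ v) hv) => n jn.
  by have [_ /(_ j jn)[]] := hx n.
apply: (@bungee_intro _ _ _ (nm w + 1)).
  move=> N; exists (mh N).1; first by have [] := hmh N.
  by have := low N; have := nm_leD (iter (mh N).1 f v) w; lra.
move=> M; have [j hj] := nat_gt_real (M + nm w); exists (nh j).1.
have := high j; have := nmD (iter (nh j).1 f v) (- w); rewrite nmN; lra.
Qed.

(** * Connectedness in the Riemann sphere *)

(** [U] is a union of disks with a third of the isolating radii of points of [A]. If a point [z] of
    [X] outside [A], with isolating radius [s], adhered to [U], some centre [a] would satisfy
    [s <= |a - z| < r / 3 + s / 3]; so [|a - z| < r], and [z] would lie in [A]. *)
Lemma separating_open (R : realType) (X A : set (CC R)) (M : R) :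
  (forall a, A a -> exists2 r : R, 0 < r & forall x, X x -> nm (x - a) < r -> A x) ->
  (forall b, X b -> ~ A b -> exists2 r : R, 0 < r & forall x, nm (x - b) < r -> ~ A x) ->
  (forall a, A a -> nm a <= M) ->
  exists U, [/\ open U, forall z, U z -> nm z <= M + 1, A `<=` U &
    forall z, closure U z -> ~ U z -> ~ X z].
Proof.
move=> hA hB bA.
pose U := [set w : CC R | exists a (r : R), [/\ A a, 0 < r, r <= 1,
  forall x, X x -> nm (x - a) < r -> A x & nm (w - a) < r / 3]].
have AU : A `<=` U.
  move=> a Aa; have [r r0 hr] := hA a Aa; exists a, (Num.min r 1); split => //.
  - by rewrite lt_min r0 ltr01.
  - by rewrite ge_min lexx orbT.
  - by move=> x Xx; rewrite lt_min => /andP[xa _]; exact: hr.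
  - by rewrite subrr nm0 divr_gt0 // lt_min r0 ltr01.
exists U; split => //.
- apply/openCP => w [a [r [Aa r0 r1 hr wa]]].
  exists (r / 3 - nm (w - a)); first by rewrite subr_gt0.
  by move=> y yw; exists a, r; split => //; have := nm_dist_tri w y a; lra.
- by move=> w [a [r [Aa r0 r1 hr wa]]]; have := bA a Aa; have := nm_leD w a; lra.
- move=> z cz nUz Xz; have nAz : ~ A z by move=> /AU.
  have [s s0 hs] := hB z Xz nAz.
  have s3 : 0 < s / 3 by rewrite divr_gt0.
  have [w [a [r [Aa r0 r1 hr wa]]] wz] := (closureCP _ _).1 cz (s / 3) s3.
  have az := nm_dist_tri w a z; rewrite (nm_distC a w) in az.
  have sa : s <= nm (a - z) by rewrite leNgt; apply/negP => h; exact: (hs a h).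
  by apply: nAz; apply: (hr z Xz); rewrite nm_distC; lra.
Qed.

Lemma with_infty_connected (R : realType) (X : set (CC R)) :
  (forall U B, open U -> (forall z, U z -> nm z <= B) -> U `&` X !=set0 ->
    exists z, [/\ closure U z, ~ U z & X z]) ->
  connected (with_infty X).
Proof.
move=> hX.
have XN : with_infty X None by right.
have XS z : with_infty X (Some z) <-> X z.
  by split; [move=> [[y Xy [<-]]|] | move=> Xz; left; exists z].
(* A relatively clopen part without the point at infinity is bounded, since the complement of [D] is
   a neighbourhood of infinity. It is applied to [S] or, if [S] contains infinity, to the rest of
   the set. *)
have core (S C D : set (riemann_sphere R)) : open C -> closed D ->
    S = with_infty X `&` C -> S = with_infty X `&` D -> ~ S None -> S = set0.
  move=> oC cD SC SD SN; apply/seteqP; split => // -[z0|] Sz0; last exact: SN.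
  have DN : ~ D None by move=> DN; apply: SN; rewrite SD.
  have oD : open (~` D) by exact: closed_openC.
  pose A := [set z : CC R | S (Some z)].
  have [K [cK _] KD] : nbhs (None : riemann_sphere R) (~` D) by exact: open_nbhs_nbhs.
  have [M _ hM] := compactC_bounded cK.
  have [||z Az|U [oU bU AU bdU]] := @separating_open R X A M.
  - move=> a; rewrite /A /= SC => -[_ Ca].
    have : nbhs (Some a : riemann_sphere R) C by exact: open_nbhs_nbhs.
    move=> /nbhsCP[r r0 hr]; exists r => // x Xx /hr Cx; split => //.
    exact/XS.
  - move=> b Xb nAb.
    have nDb : ~ D (Some b) by move=> Db; apply: nAb; rewrite /A /= SD; split => //; exact/XS.
    have : nbhs (Some b : riemann_sphere R) (~` D) by exact: open_nbhs_nbhs.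
    move=> /nbhsCP[r r0 hr]; exists r => // x /hr nDx; rewrite /A /= SD => -[_].
    exact: nDx.
  - apply/ltW/hM; apply: contrapT => nKz.
    have /KD : ((Some @` ~` K) `|` [set None]) (Some z) by left; exists z.
    by apply; move: Az; rewrite /A /= SD => -[].
  have Xz0 : X z0 by apply/XS; move: Sz0; rewrite SC => -[].
  have [|z [cz nUz Xz]] := hX U (M + 1) oU bU; first by exists z0; split => //; exact: AU.
  exact: (bdU z cz nUz Xz).
move=> S [s Ss] [C oC SC] [D cD SD].
have [SN|SN] := pselect (S None); last first.
  by move: Ss; rewrite (core S C D oC cD SC SD SN).
have S0 : with_infty X `&` ~` S = set0.
  apply: (core _ (~` D) (~` C)); first exact: closed_openC.
  - exact: open_closedC.
  - apply/seteqP; split => x [Xx h]; split => // h'; apply: h; first by rewrite SD.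
    by move: h'; rewrite SD => -[].
  - apply/seteqP; split => x [Xx h]; split => // h'; apply: h; first by rewrite SC.
    by move: h'; rewrite SC => -[].
  - by move=> [].
apply/seteqP; split; first by rewrite SC => x [].
move=> x Xx; apply: contrapT => nSx.
by have : (with_infty X `&` ~` S) x by []; rewrite S0.
Qed.

Theorem theorem1p3 (R : realType) (f : CC R -> CC R) (alpha : CC R) :
  transcendental_entire f ->
  finite_log_asymptotic_value f alpha ->
  julia f alpha ->
  connected (with_infty (bungee f)).
Proof.
move=> [ef _] [r [r0 [z0 [_ [cov _]]]]] Ja.
apply: with_infty_connected => U B oU bU [z [Uz bz]].
apply: (bungee_boundary ef _ oU bU Uz bz) => E p cE Jp ip.
exact: (julia_inside_bungee ef r0 cov Ja cE Jp ip).
Qed.
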